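(* Suppose $\mathcal A$ and $\mathcal B$ are unital AF-algebras in the class $\overrightarrow{\mathfrak D}$. Then $T(\mathcal A)\cong T(\mathcal B)$ if and only if $\mathcal A\otimes\mathcal Q\cong\mathcal B\otimes\mathcal Q$.
   Context: AF-algebras here are separable, i.e. direct limits of sequences of finite-dimensional C*-algebras. $\overrightarrow{\mathfrak D}$ denotes the class of unital AF-algebras that arise as the limit of a direct sequence of finite-dimensional C*-algebras whose connecting $*$-homomorphisms have exactly one non-zero entry in each row of their representing (multiplicity) matrices. Here the representing matrix of a $*$-homomorphism from $\bigoplus_{i=1}^r M_{p_i}$ to $\bigoplus_{j=1}^s M_{q_j}$ is the $s\times r$ matrix of the induced map $\mathbb Z^r\to\mathbb Z^s$ on $K_0$, so rows are indexed by the summands of the target. Equivalently, the Bratteli diagrams do not allow two distinct nodes to be joined by edges to one common node at the next level (multiple edges from a single node to a node are allowed). In the language of dimension groups, these are the unital AF-algebras $\mathcal A$ whose dimension group $K_0(\mathcal A)$ is the limit of a direct sequence of simplicial groups $\mathbb Z^{r}$ (with coordinatewise order) with connecting maps of the form $(x_1,\dots,x_r)\mapsto(k_1x_{i_1},\dots,k_sx_{i_s})$, where $i_j\in\{1,\dots,r\}$ and each $k_j$ is a positive integer. $T(\mathcal A)$ is the space of all tracial states of $\mathcal A$ (a Choquet simplex with the weak-* topology), and $T(\mathcal A)\cong T(\mathcal B)$ means that the two are affinely homeomorphic. $\mathcal Q$ is the universal UHF-algebra, i.e. the UHF-algebra whose $K_0$-group is isomorphic to $\mathbb Q$ with its usual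 ordering and order-unit $1$. The relation $\mathcal A\otimes\mathcal Q\cong\mathcal B\otimes\mathcal Q$ is isomorphism of C*-algebras. *)

(* Defs.v *)
From HB Require Import structures.
From mathcomp Require Import all_boot all_order all_algebra.
From mathcomp Require Import all_classical all_reals all_analysis.
From mathcomp Require Import complex.
Set Implicit Arguments.
Unset Strict Implicit.
Unset Printing Implicit Defensive.
Import Order.TTheory GRing.Theory Num.Theory.
Import numFieldNormedType.Exports.
Local Open Scope classical_set_scope.
Local Open Scope ring_scope.

HB.mixin Record isStarAlgebra (R : realType) A & GRing.Algebra R[i] A := {
  star : A -> A;
  starK : involutive star;
  starD : {morph star : x y / x + y};
  starM : forall x y : A, star (x * y) = star y * star x;
  starZ : forall (c : R[i]) (x : A), star (c *: x) = c^* *: star x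
}.

#[short(type="starAlgType")]
HB.structure Definition StarAlgebra (R : realType) :=
  {A of GRing.Algebra R[i] A & isStarAlgebra R A}.

(* The norm is a field of its own because Num.SemiNormedZmodule and
   GRing.PzSemiRing have no join other than Num.NumDomain, so that
   completeNormedModType and algType cannot be combined. *)
HB.mixin Record isCStarAlgebra (R : realType) A & StarAlgebra R A := {
  cnorm : A -> R;
  cnorm_eq0 : forall x : A, cnorm x = 0 -> x = 0;
  cnormD : forall x y : A, cnorm (x + y) <= cnorm x + cnorm y;
  cnormZ : forall (c : R[i]) (x : A), (cnorm (c *: x))%:C%C = `|c| * (cnorm x)%:C%C;
  cnormM : forall x y : A, cnorm (x * y) <= cnorm x * cnorm y;
  cnorm_star : forall x : A, cnorm (star x * x) = cnorm x ^+ 2;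
  cnorm_complete : forall u : nat -> A,
    (forall e : R, 0 < e -> exists N, forall m n,
      (N <= m)%N -> (N <= n)%N -> cnorm (u m - u n) < e) ->
    exists l : A, (fun n => cnorm (u n - l)) @ \oo --> (0 : R)
}.

#[short(type="cstarAlgType")]
HB.structure Definition CStarAlgebra (R : realType) :=
  {A of StarAlgebra R A & isCStarAlgebra R A}.

Definition cdense (R : realType) (A : cstarAlgType R) (S : set A) : Prop :=
  forall (x : A) (e : R), 0 < e -> exists2 y, S y & cnorm (x - y) < e.

(* *-homomorphisms are not required to preserve the unit. *)
Record star_hom (R : realType) (A B : starAlgType R) (f : A -> B) : Prop := {
  star_hom_linear : linear f;
  star_homM : {morph f : x y / x * y};
  star_hom_star : {morph f : x / star x}
}.

Definition cstar_iso (R : realType) (A B : cstarAlgType R) : Prop :=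
  exists2 f : A -> B, star_hom f & bijective f.

(* The direct sum of the full matrix algebras of sizes (p 0).+1, ..., (p r).+1.
   An algType has 1 != 0, so the zero algebra is excluded here and as a C*-algebra;
   a direct sequence with non-zero limit has no zero term. *)
Definition fdalg (R : realType) (r : nat) (p : 'I_r.+1 -> nat) : Type :=
  forall k : 'I_r.+1, 'M[R[i]]_((p k).+1).

Section FdAlgebra.
Context (R : realType) (r : nat) (p : 'I_r.+1 -> nat).
Local Notation F := (fdalg R p).

HB.instance Definition _ := gen_eqMixin F.
HB.instance Definition _ := gen_choiceMixin F.

Let addF (x y : F) : F := fun k => x k + y k.
Let oppF (x : F) : F := fun k => - x k.
Let mulF (x y : F) : F := fun k => x k * y k.
Let scaleF (c : R[i]) (x : F) : F := fun k => c *: x k.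

Fact fd_addA : associative addF.
Proof. by move=> x y z; apply: functional_extensionality_dep => k; exact: addrA. Qed.
Fact fd_addC : commutative addF.
Proof. by move=> x y; apply: functional_extensionality_dep => k; exact: addrC. Qed.
Fact fd_add0 : left_id (fun=> 0) addF.
Proof. by move=> x; apply: functional_extensionality_dep => k; exact: add0r. Qed.
Fact fd_addN : left_inverse (fun=> 0) oppF addF.
Proof. by move=> x; apply: functional_extensionality_dep => k; exact: addNr. Qed.
HB.instance Definition _ :=
  GRing.isZmodule.Build F fd_addA fd_addC fd_add0 fd_addN.

Fact fd_mulA : associative mulF.
Proof. by move=> x y z; apply: functional_extensionality_dep => k; exact: mulrA. Qed.
Fact fd_mul1l : left_id (fun=> 1) mulF.
Proof. by move=> x; apply: functional_extensionality_dep => k; exact: mul1r. Qed.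
Fact fd_mul1r : right_id (fun=> 1) mulF.
Proof. by move=> x; apply: functional_extensionality_dep => k; exact: mulr1. Qed.
Fact fd_mulDl : left_distributive mulF +%R.
Proof. by move=> x y z; apply: functional_extensionality_dep => k; exact: mulrDl. Qed.
Fact fd_mulDr : right_distributive mulF +%R.
Proof. by move=> x y z; apply: functional_extensionality_dep => k; exact: mulrDr. Qed.
Fact fd_one_neq0 : ((fun=> 1) : F) != 0.
Proof.
apply/eqP => /(congr1 (fun x : F => x ord0)) h.
by have := oner_neq0 ('M[R[i]]_((p ord0).+1)); rewrite h eqxx.
Qed.
HB.instance Definition _ := GRing.Zmodule_isNzRing.Build F
  fd_mulA fd_mul1l fd_mul1r fd_mulDl fd_mulDr fd_one_neq0.

Fact fd_scaleA c d x : scaleF c (scaleF d x) = scaleF (c * d) x.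
Proof. by apply: functional_extensionality_dep => k; exact: scalerA. Qed.
Fact fd_scale1 : left_id 1 scaleF.
Proof. by move=> x; apply: functional_extensionality_dep => k; exact: scale1r. Qed.
Fact fd_scaleDr : right_distributive scaleF +%R.
Proof. by move=> c x y; apply: functional_extensionality_dep => k; exact: scalerDr. Qed.
Fact fd_scaleDl x : {morph scaleF^~ x : c d / c + d}.
Proof. by move=> c d; apply: functional_extensionality_dep => k; exact: scalerDl. Qed.
HB.instance Definition _ := GRing.Zmodule_isLmodule.Build R[i] F
  fd_scaleA fd_scale1 fd_scaleDr fd_scaleDl.

Fact fd_scaleAl (c : R[i]) (x y : F) : c *: (x * y) = (c *: x) * y.
Proof. by apply: functional_extensionality_dep => k; exact: scalerAl. Qed.
HB.instance Definition _ := GRing.Lmodule_isLalgebra.Build R[i] F fd_scaleAl.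

Fact fd_scaleAr (c : R[i]) (x y : F) : c *: (x * y) = x * (c *: y).
Proof. by apply: functional_extensionality_dep => k; exact: scalerAr. Qed.
HB.instance Definition _ := GRing.Lalgebra_isAlgebra.Build R[i] F fd_scaleAr.

Let starF (x : F) : F := fun k => map_mx Num.conj (x k)^T.

Fact fd_starK : involutive starF.
Proof.
move=> x; apply: functional_extensionality_dep => k.
by apply/matrixP => a b; rewrite !mxE conjCK.
Qed.
Fact fd_starD : {morph starF : x y / x + y}.
Proof.
move=> x y; apply: functional_extensionality_dep => k.
by apply/matrixP => a b; rewrite !mxE rmorphD.
Qed.
Fact fd_starM (x y : F) : starF (x * y) = starF y * starF x.
Proof.
apply: functional_extensionality_dep => k.
apply/matrixP => a b; rewrite !mxE rmorph_sum; apply: eq_bigr => l _.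
by rewrite !mxE rmorphM mulrC.
Qed.
Fact fd_starZ (c : R[i]) (x : F) : starF (c *: x) = c^* *: starF x.
Proof.
apply: functional_extensionality_dep => k.
by apply/matrixP => a b; rewrite !mxE rmorphM.
Qed.
HB.instance Definition _ :=
  isStarAlgebra.Build R F fd_starK fd_starD fd_starM fd_starZ.

Definition l2norm n (v : 'cV[R[i]]_n) : R :=
  Num.sqrt (\sum_(a < n) (complex.Re (v a 0) ^+ 2 + complex.Im (v a 0) ^+ 2)).

(* The C*-norm of the direct sum: the largest operator norm of a component. *)
Definition fdnorm (x : F) : R :=
  sup [set t | exists k (v : 'cV[R[i]]_((p k).+1)),
                 l2norm v <= 1 /\ t = l2norm (x k *m v)].

(* A minimal projection of the k-th summand; its class is the k-th basis vector
   of K_0 = Z^(r+1). *)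
Definition fdproj (k : 'I_r.+1) : F :=
  fun l => if l == k then delta_mx ord0 ord0 else 0.

End FdAlgebra.

(* The matrix of the map induced on K_0, where the class of a projection of a
   full matrix algebra is identified with its rank. *)
Definition repr_mx (R : realType) (r s : nat) (p : 'I_r.+1 -> nat)
    (q : 'I_s.+1 -> nat) (phi : fdalg R p -> fdalg R q) : 'M[int]_(s.+1, r.+1) :=
  \matrix_(j, k) (\rank (phi (fdproj R p k) j))%:Z.

Section DirectLimit.
Context (R : realType) (r : nat -> nat).
Variable p : forall n, 'I_(r n).+1 -> nat.
Arguments p : clear implicits.
Variable phi : forall n, fdalg R (p n) -> fdalg R (p n.+1).
Arguments phi : clear implicits.

Fixpoint connecting (n m : nat) : fdalg R (p n) -> fdalg R (p (m + n)%N) :=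
  match m return fdalg R (p n) -> fdalg R (p (m + n)%N) with
  | 0%N => id
  | m'.+1 => phi (m' + n)%N \o @connecting n m'
  end.
Arguments connecting : clear implicits.

(* A is the completion of the algebraic direct limit for the C*-seminorm
   induced by  x |-> lim_m || phi_(n, m) x ||  (x in the n-th algebra). *)
Definition is_direct_limit (A : cstarAlgType R) : Prop :=
  (forall n, star_hom (phi n)) /\
  exists psi : forall n, fdalg R (p n) -> A,
  [/\ forall n, star_hom (psi n),
      forall n x, psi n.+1 (phi n x) = psi n x,
      forall n x, (fun m => fdnorm (connecting n m x)) @ \oo
                    --> cnorm (psi n x)
    & cdense (\bigcup_n range (psi n))].

End DirectLimit.

Definition classD (R : realType) (A : cstarAlgType R) : Prop :=
  exists (r : nat -> nat) (p : forall n, 'I_(r n).+1 -> nat)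
         (phi : forall n, fdalg R (p n) -> fdalg R (p n.+1)),
    is_direct_limit phi A /\
    forall n (j : 'I_(r n.+1).+1),
      exists! k : 'I_(r n).+1, repr_mx (phi n) j k != 0.

Definition tracial_states (R : realType) (A : cstarAlgType R) :
    set {ptws A -> R[i]^o} :=
  [set t : A -> R[i]^o |
    [/\ linear t, forall x, 0 <= t (star x * x), t 1 = 1
      & forall x y, t (x * y) = t (y * x)]].

Definition convex_comb (R : realType) (A : Type) (c : R)
    (s t : A -> R[i]^o) : A -> R[i]^o :=
  fun a => c%:C%C * s a + (1 - c)%:C%C * t a.

(* The weak-* topology on T(A) is the topology of pointwise convergence. *)
Definition traces_iso (R : realType) (A B : cstarAlgType R) : Prop :=
  exists (f : {ptws A -> R[i]^o} -> {ptws B -> R[i]^o})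
         (g : {ptws B -> R[i]^o} -> {ptws A -> R[i]^o}),
  [/\ (forall s, tracial_states s -> tracial_states (f s)) /\
      (forall t, tracial_states t -> tracial_states (g t)),
      (forall s, tracial_states s -> g (f s) = s) /\
      (forall t, tracial_states t -> f (g t) = t),
      {within @tracial_states R A, continuous f},
      {within @tracial_states R B, continuous g}
    & forall (c : R) s1 s2, 0 <= c <= 1 ->
        tracial_states s1 -> tracial_states s2 ->
        f (convex_comb c s1 s2) = convex_comb c (f s1) (f s2)].

Section K0.
Context (R : realType) (A : cstarAlgType R).

Definition star_mx m n (v : 'M[A]_(m, n)) : 'M[A]_(n, m) := map_mx star v^T.

Definition is_proj n (e : 'M[A]_n) : Prop := star_mx e = e /\ e *m e = e.

Definition mvn_equiv m n (e : 'M[A]_m) (f : 'M[A]_n) : Prop :=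
  exists v : 'M[A]_(n, m), star_mx v *m v = e /\ v *m star_mx v = f.

Definition dsum_mx m n (e : 'M[A]_m) (f : 'M[A]_n) : 'M[A]_(m + n) :=
  block_mx e 0 0 f.

Definition stably_equiv m n (e : 'M[A]_m) (f : 'M[A]_n) : Prop :=
  exists k (g : 'M[A]_k), is_proj g /\ mvn_equiv (dsum_mx e g) (dsum_mx f g).

(* (K_0(A), K_0(A)+, [1]) is isomorphic to (G, P, u). As K_0(A) is the
   Grothendieck group of the monoid of Murray-von Neumann classes of projections
   over A, an isomorphism [e] - [f] |-> d e - d f amounts to such a map d. *)
Definition K0_isomorphic (G : zmodType) (P : set G) (u : G) : Prop :=
  exists d : forall n, 'M[A]_n -> G,
  [/\ forall m n (e : 'M[A]_m) (f : 'M[A]_n), is_proj e -> is_proj f ->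
        d _ (dsum_mx e f) = d _ e + d _ f,
      forall m n (e : 'M[A]_m) (f : 'M[A]_n), is_proj e -> is_proj f ->
        d _ e = d _ f <-> stably_equiv e f,
      forall x, exists m n (e : 'M[A]_m) (f : 'M[A]_n),
        [/\ is_proj e, is_proj f & x = d _ e - d _ f],
      forall x, P x <-> exists n (e : 'M[A]_n), is_proj e /\ d _ e = x
    & d 1%N 1%:M = u].

End K0.

Definition is_UHF (R : realType) (A : cstarAlgType R) : Prop :=
  exists (p : nat -> nat)
         (phi : forall n, @fdalg R 0 (fun=> p n) -> @fdalg R 0 (fun=> p n.+1)),
    @is_direct_limit R (fun=> 0%N) (fun n _ => p n) phi A /\
    forall n, phi n 1 = 1.

Definition is_universal_UHF (R : realType) (Q : cstarAlgType R) : Prop :=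
  is_UHF Q /\ K0_isomorphic Q [set x : rat | 0 <= x] 1.

Section Tensor.
Context (R : realType) (A B T : cstarAlgType R).

Definition lin_indep n (b : 'I_n -> B) : Prop :=
  forall c : 'I_n -> R[i], \sum_(k < n) c k *: b k = 0 -> forall k, c k = 0.

(* T is a completion of the algebraic tensor product of A and B for a C*-norm,
   with a (x) b = f a * g b; the third condition says that the canonical map
   from the algebraic tensor product to T is injective. When A or B is nuclear,
   e.g. an AF-algebra, there is exactly one C*-norm on the algebraic tensor
   product. *)
Definition is_tensor_product : Prop :=
  exists (f : A -> T) (g : B -> T),
  [/\ [/\ star_hom f, star_hom g, f 1 = 1 & g 1 = 1],
      forall a b, f a * g b = g b * f a,
      forall n (a : 'I_n -> A) (b : 'I_n -> B), lin_indep b ->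
        \sum_(k < n) f (a k) * g (b k) = 0 -> forall k, a k = 0
    & cdense [set t | exists n (a : 'I_n -> A) (b : 'I_n -> B),
                 t = \sum_(k < n) f (a k) * g (b k)]].

End Tensor.

(* Main.v *)
Require Import Defs.
From HB Require Import structures.
From mathcomp Require Import all_boot all_order all_algebra.
From mathcomp Require Import all_classical all_reals all_analysis.
From mathcomp Require Import complex.
From mathcomp Require Import ring lra.
Set Implicit Arguments.
Unset Strict Implicit.
Unset Printing Implicit Defensive.
Import Order.TTheory GRing.Theory Num.Theory.
Import numFieldNormedType.Exports.
Local Open Scope classical_set_scope.
Local Open Scope ring_scope.

(** Let A be the limit of finite-dimensional algebras in which every block has a
    single parent.  The blocks form a forest, the block units are central
    projections of A (tw_central), and they are the clopen subsets of the compact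
    boundary X of the forest.  A trace is a consistent system of weights on the
    blocks, that is, a probability measure on X (tw_trace_unique,
    trace_of_weights).  Since the stages of Q have a single block, A and A (x) Q
    have the same forest (tensor_tower) and therefore the same traces
    (same_forest_traces_iso).  So an isomorphism of A (x) Q with B (x) Q gives one
    of the trace simplices of A and B (cstar_iso_traces), and what remains is that
    A (x) Q, which is C(X) (x) Q, can be reconstructed from its traces.

    The extreme traces are the points of X (extreme_pure, pure_extreme).  An affine
    homeomorphism of trace simplices preserves them, and by compactness of X, in
    the form of Koenig's lemma (locally_constant_uniform), it carries block units
    to finite sums of block units (clopen_transport, central_matching).

    As K_0(Q) contains 1/N, every integer N divides the size of some stage of Q
    (universal_divisible): the trace of a projection of class 1/N is computed in a
    stage, because close idempotents have equal traces (idem_trace_eq).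
    Consequently the commutant of a stage of A (x) Q contains full matrix algebras
    of every size (uhf_absorbing, tensor_absorbing).  Inside A (x) Q a full matrix
    algebra can then be enlarged to one that spans a given stage together with the
    block units (forth_stage), while in B (x) Q it can be enlarged to any multiple of
    its size (forth_other).  Doing this alternately on both sides yields dense
    subalgebras with the same matrix units and matching central projections
    (traces_iso_cstar_iso).  The resulting *-isomorphism between them is isometric,
    a finite-dimensional C*-algebra having only one C*-norm (cnorm_lincomb_le), so
    it extends to the completions (extend_iso).

    Two automatic continuity facts make the approximations work: positive
    functionals are bounded (positive_bounded) and unital homomorphisms are
    contractive (star_hom_contractive).  Both come from a square root of 1 - h for
    hermitian h of norm less than 1 (sqrt_one_sub). *)

(** * Complete norms *)

Notation md := (@ComplexField.Normc.normc _).

Section Modulus.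
Context (R : realType).
Implicit Types c d : R[i].

Lemma normC_md c : `|c| = (md c)%:C%C.
Proof. by []. Qed.

Lemma md_ge0 c : 0 <= md c.
Proof. by rewrite -lecR -normC_md normr_ge0. Qed.

Lemma md0 : md 0 = 0 :> R. Proof. exact: ComplexField.Normc.normc0. Qed.
Lemma md1 : md 1 = 1 :> R. Proof. exact: ComplexField.Normc.normc1. Qed.

Lemma md_eq0 c : md c = 0 -> c = 0.
Proof. exact: ComplexField.Normc.eq0_normc. Qed.

Lemma mdM c d : md (c * d) = md c * md d.
Proof. exact: ComplexField.Normc.normcM. Qed.

Lemma mdD c d : md (c + d) <= md c + md d.
Proof. exact: le_normcD. Qed.

Lemma mdN c : md (- c) = md c.
Proof. exact: normcN. Qed.

Lemma md_real (r : R) : 0 <= r -> md r%:C%C = r.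
Proof. by move=> r0; apply: complexI; rewrite -normC_md ger0_norm // lecR. Qed.

Lemma md_half : md (2^-1 : R[i]) = 2^-1.
Proof.
by rewrite (_ : 2^-1 = (2^-1 : R)%:C%C) ?md_real ?invr_ge0 // fmorphV rmorph_nat.
Qed.

Lemma md_i : md 'i = 1 :> R.
Proof. by rewrite -complexiE /= expr0n expr1n add0r sqrtr1. Qed.

Lemma md_Re c : `|complex.Re c| <= md c.
Proof. by rewrite -lecR -normC_md normc_ge_Re. Qed.

Lemma md_Im c : `|complex.Im c| <= md c.
Proof.
have h : md ('i * c) = md c by rewrite mdM md_i mul1r.
rewrite -h; apply: le_trans (md_Re _).
by rewrite mulrC -complexiE ReiNIm normrN.
Qed.

Lemma md_ReIm c : md c <= `|complex.Re c| + `|complex.Im c|.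
Proof.
have hr (r : R) : md r%:C%C = `|r| by rewrite /= expr0n /= addr0 sqrtr_sqr.
rewrite {1}[c]complexE -!hr; apply: le_trans (mdD _ _) _.
by rewrite mdM complexiE md_i mul1r.
Qed.

Lemma md_sum (I : finType) (P : pred I) (F : I -> R[i]) :
  md (\sum_(i | P i) F i) <= \sum_(i | P i) md (F i).
Proof.
elim/big_ind2: _ => [|x y z t h1 h2|//]; first by rewrite md0.
by apply: le_trans (mdD _ _) _; rewrite lerD.
Qed.

Lemma ge0_real c : 0 <= c -> c = (complex.Re c)%:C%C /\ 0 <= complex.Re c.
Proof.
move=> h; have e : c = (complex.Re c)%:C%C by rewrite RRe_real // ger0_real.
by split=> //; rewrite -lecR -e.
Qed.

Lemma ge0_md c : 0 <= c -> c = (md c)%:C%C.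
Proof. by move=> h; rewrite -normC_md ger0_norm. Qed.

End Modulus.

Lemma subr_subACA (V : zmodType) (x y z t : V) : (x - y) - (z - t) = (x - z) - (y - t).
Proof. by rewrite !opprB addrACA [RHS]addrACA; congr (_ + _); rewrite addrC. Qed.

Section CompleteNorm.
Context (R : realType).

Definition cvs (E : zmodType) (N : E -> R) (u : nat -> E) (l : E) : Prop :=
  forall e, 0 < e -> exists M, forall n, (M <= n)%N -> N (u n - l) < e.

Definition cauchy_seq (E : zmodType) (N : E -> R) (u : nat -> E) : Prop :=
  forall e, 0 < e -> exists M, forall m n, (M <= m)%N -> (M <= n)%N ->
    N (u m - u n) < e.

Record complete_norm (E : zmodType) (N : E -> R) : Prop := CompleteNorm {
  nrm0 : N 0 = 0;
  nrm_eq0 : forall x, N x = 0 -> x = 0;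
  nrmD : forall x y, N (x + y) <= N x + N y;
  nrmN : forall x, N (- x) = N x;
  nrm_complete : forall u, cauchy_seq N u -> exists l, cvs N u l }.

Lemma half_pos (e : R) : 0 < e -> 0 < e / 2.
Proof. by move=> e0; rewrite divr_gt0. Qed.

Lemma le_eps (a b : R) : (forall e, 0 < e -> a <= b + e) -> a <= b.
Proof. by move=> h; apply/ler_addgt0Pr => e /h. Qed.

Section Theory.
Context (E : zmodType) (N : E -> R) (HN : complete_norm N).

Lemma nrm_ge0 x : 0 <= N x.
Proof.
have := nrmD HN x (- x); rewrite subrr (nrm0 HN) (nrmN HN); lra.
Qed.

Lemma nrmB x y : N (x - y) = N (y - x).
Proof. by rewrite -(nrmN HN) opprB. Qed.

Lemma nrm_tri z x y : N (x - y) <= N (x - z) + N (z - y).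
Proof. by have := nrmD HN (x - z) (z - y); rewrite addrA subrK. Qed.

Lemma nrm_small_eq x y : (forall e, 0 < e -> N (x - y) < e) -> x = y.
Proof.
move=> h; apply/eqP; rewrite -subr_eq0; apply/eqP; apply: (nrm_eq0 HN).
apply/eqP; rewrite eq_le nrm_ge0 andbT leNgt; apply/negP => /h.
by rewrite ltxx.
Qed.

Lemma nrm_sum (I : finType) (P : pred I) (F : I -> E) :
  N (\sum_(i | P i) F i) <= \sum_(i | P i) N (F i).
Proof.
elim/big_ind2: _ => [|x y z t h1 h2|//]; first by rewrite (nrm0 HN).
by apply: le_trans (nrmD HN _ _) _; rewrite lerD.
Qed.

Lemma pow_small (r D e : R) : 0 <= r -> r < 1 -> 0 < e ->
  exists M, forall n, (M <= n)%N -> r ^+ n * D < e.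
Proof.
move=> r0 r1 e0.
have h : (fun n => r ^+ n * D) @ \oo --> (0 : R).
  rewrite -(mul0r D); apply: cvgM; last exact: cvg_cst.
  by apply: cvg_expr; rewrite ger0_norm.
have /cvgrPdist_lt /(_ _ e0) [M _ hM] := h.
exists M => n /hM /=; rewrite sub0r normrN; apply: le_lt_trans; exact: ler_norm.
Qed.

(** The contraction principle.  The closed set P carries the side conditions that
    the fixed point is to inherit: being hermitian, small, or commuting with
    given elements. *)
Lemma banach_fixpoint (P : E -> Prop) (Psi : E -> E) (r : R) (x0 : E) :
    0 <= r -> r < 1 ->
    (forall u l, (forall n, P (u n)) -> cvs N u l -> P l) ->
    (forall x, P x -> P (Psi x)) ->
    (forall x y, P x -> P y -> N (Psi x - Psi y) <= r * N (x - y)) ->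
    P x0 ->
  exists2 x, P x & Psi x = x.
Proof.
move=> r0 r1 Pcl PPsi ctr Px0.
pose u n := iter n Psi x0.
have Pu n : P (u n) by elim: n => //= n IH; apply: PPsi.
pose D := N (u 1%N - u 0%N) / (1 - r).
have r1' : 0 < 1 - r by lra.
have DE : D = r * D + N (u 1%N - u 0%N).
  have : D * (1 - r) = N (u 1%N - u 0%N) by rewrite /D divfK // gt_eqF.
  lra.
have hD k : N (u k - u 0%N) <= D.
  elim: k => [|k IH]; first by rewrite subrr (nrm0 HN) /D divr_ge0 ?nrm_ge0 // ltW.
  rewrite DE; apply: le_trans (nrm_tri (u 1%N) _ _) _; rewrite lerD2r.
  by apply: le_trans (ctr _ _ (Pu k) (Pu 0%N)) _; rewrite ler_wpM2l.
have hn n k : N (u (n + k)%N - u n) <= r ^+ n * D.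
  elim: n => [|n IH]; first by rewrite add0n expr0 mul1r.
  rewrite addSn; apply: le_trans (ctr _ _ (Pu _) (Pu n)) _.
  by rewrite exprS -mulrA ler_wpM2l.
have cau : cauchy_seq N u.
  move=> e e0; have [M hM] := pow_small D r0 r1 (half_pos e0).
  exists M => m n Mm Mn.
  apply: le_lt_trans (nrm_tri (u M) _ _) _.
  have h1 := hn M (m - M)%N; have h2 := hn M (n - M)%N.
  rewrite !subnKC // in h1 h2; have := hM M (leqnn _).
  by rewrite (nrmB (u M)); lra.
have [l cl] := nrm_complete HN cau.
have Pl : P l by apply: Pcl cl.
exists l => //; apply: nrm_small_eq => e e0.
have [M hM] := cl _ (half_pos e0).
apply: le_lt_trans (nrm_tri (u M.+1) _ _) _.
have h1 := ctr _ _ Pl (Pu M).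
have h2 := hM M (leqnn _); have h3 := hM M.+1 (leqnSn _).
rewrite nrmB in h2.
have h4 : r * N (l - u M) <= N (l - u M).
  by rewrite ler_piMl ?nrm_ge0 // ltW.
have -> : u M.+1 = Psi (u M) by [].
move: h3; have -> : u M.+1 = Psi (u M) by []; move: h1 h2 h4; lra.
Qed.

End Theory.

Lemma dense_zero (D E : zmodType) (N : D -> R) (N' : E -> R) (S : D -> Prop) (F : D -> E)
    (C : R) : complete_norm N' ->
  (forall x eps, 0 < eps -> exists2 x', S x' & N (x - x') < eps) -> 0 <= C ->
  (forall x y, F (x - y) = F x - F y) -> (forall x, N' (F x) <= C * N x) ->
  (forall x, S x -> F x = 0) -> forall x, F x = 0.
Proof.
move=> HN' Sd C0 FB Fb F0 x; apply: (nrm_small_eq HN') => eps e0.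
have C1 : 0 < C + 1 by rewrite ltr_wpDl.
have [y sy xy] := Sd x _ (divr_gt0 e0 C1).
have -> : F x - 0 = F (x - y) by rewrite FB (F0 y) // subr0.
apply: le_lt_trans (Fb _) _.
have k5 : C * (eps / (C + 1)) + eps / (C + 1) = eps by field; rewrite gt_eqF.
have k6 : C * N (x - y) <= C * (eps / (C + 1)) by rewrite ler_wpM2l // ltW.
have : 0 < eps / (C + 1) by rewrite divr_gt0.
lra.
Qed.

Lemma complete_norm_md : complete_norm (fun c : R[i] => md c).
Proof.
split; [exact: md0|exact: md_eq0|exact: mdD|exact: mdN|].
move=> u cu.
have cauR (v : nat -> R) : (forall e, 0 < e -> exists M, forall m n,
    (M <= m)%N -> (M <= n)%N -> `|v m - v n| < e) ->
    exists l : R, forall e, 0 < e -> exists M, forall n, (M <= n)%N -> `|v n - l| < e.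
  move=> h; have /cvg_ex [l hl] : cvg (v @ \oo).
    apply: R_complete; apply: cauchy_exP => e e0.
    have [M hM] := h e e0.
    by exists (v M); exists M => // n /= Mn; apply: hM.
  exists l => e e0; move/cvgrPdist_lt: hl => /(_ _ e0) [M _ hM].
  by exists M => n /hM /=; rewrite distrC.
have [l1 h1] : exists l : R, forall e, 0 < e ->
    exists M, forall n, (M <= n)%N -> `|complex.Re (u n) - l| < e.
  apply: cauR => e /cu [M hM]; exists M => m n Mm Mn.
  apply: le_lt_trans (hM _ _ Mm Mn).
  by have := md_Re (u m - u n); case: (u m) (u n) => a b [c d].
have [l2 h2] : exists l : R, forall e, 0 < e ->
    exists M, forall n, (M <= n)%N -> `|complex.Im (u n) - l| < e.
  apply: cauR => e /cu [M hM]; exists M => m n Mm Mn.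
  apply: le_lt_trans (hM _ _ Mm Mn).
  by have := md_Im (u m - u n); case: (u m) (u n) => a b [c d].
exists (l1 +i* l2)%C => e e0.
have [M1 hM1] := h1 _ (half_pos e0); have [M2 hM2] := h2 _ (half_pos e0).
exists (maxn M1 M2) => n; rewrite geq_max => /andP[/hM1 k1 /hM2 k2].
apply: le_lt_trans (md_ReIm _) _.
by move: k1 k2; case: (u n) => a b /=; lra.
Qed.

(** A bounded linear relation with dense domain is the graph of a bounded
    linear map after closing it up: this is how functionals and homomorphisms
    defined on an increasing union of finite-dimensional subalgebras, where
    an element has many presentations, are extended. *)
Section Extension.
Context (D E : lmodType R[i]) (N : D -> R) (N' : E -> R).
Context (HN : complete_norm N) (HN' : complete_norm N').
Hypothesis NZ : forall c x, N (c *: x) = md c * N x.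
Hypothesis NZ' : forall c x, N' (c *: x) = md c * N' x.
Variables (G : D -> E -> Prop) (C : R).
Hypothesis C0 : 0 <= C.
Hypothesis Glin : forall c x y x' y', G x y -> G x' y' -> G (c *: x + x') (c *: y + y').
Hypothesis Gbd : forall x y, G x y -> N' y <= C * N x.
Hypothesis Gdense : forall x e, 0 < e -> exists x' y', G x' y' /\ N (x - x') < e.

Lemma bounded_extension : exists h : D -> E,
  [/\ linear h, forall x y, G x y -> h x = y & forall x, N' (h x) <= C * N x].
Proof.
(* The closure of the graph G. *)
pose Gc x y := forall e, 0 < e ->
  exists x' y', [/\ G x' y', N (x - x') < e & N' (y - y') < e].
have GB x y x' y' : G x y -> G x' y' -> N' (y - y') <= C * N (x - x').
  move=> h h'; apply: Gbd.
  by have := Glin (-1) h' h; rewrite !scaleN1r ![- _ + _]addrC.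
have C1 : 0 < C + 1 by rewrite ltr_wpDl.
have Gcbd x y : Gc x y -> N' y <= C * N x.
  move=> h; apply: le_eps => e e0.
  have [x' [y' [g h1 h2]]] := h (e / (C + 1)) (divr_gt0 e0 C1).
  have k1 := nrmD HN' (y - y') y'; rewrite subrK in k1.
  have k2 := nrmD HN (x' - x) x; rewrite subrK (nrmB HN) in k2.
  have k3 := Gbd g.
  have k4 : C * N x' <= C * (e / (C + 1) + N x) by rewrite ler_wpM2l //; lra.
  have k5 : C * (e / (C + 1)) + e / (C + 1) = e.
    by field; rewrite gt_eqF.
  rewrite mulrDr in k4; lra.
have Gclin c x y x' y' : Gc x y -> Gc x' y' -> Gc (c *: x + x') (c *: y + y').
  move=> h h' e e0.
  have m1 : 0 < md c + 1 by have := md_ge0 c; lra.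
  have [a [b [g g1 g2]]] := h _ (divr_gt0 e0 m1 : 0 < e / (md c + 1)).
  have [a' [b' [g' g1' g2']]] := h' _ (divr_gt0 e0 m1 : 0 < e / (md c + 1)).
  have k5 : md c * (e / (md c + 1)) + e / (md c + 1) = e by field; rewrite gt_eqF.
  have bd (F : lmodType R[i]) (NF : F -> R) (HF : complete_norm NF)
      (HZ : forall c x, NF (c *: x) = md c * NF x) (z w z' w' : F) :
      NF (z - w) < e / (md c + 1) -> NF (z' - w') < e / (md c + 1) ->
      NF (c *: z + z' - (c *: w + w')) < e.
    move=> p q; rewrite opprD addrACA -scalerBr.
    apply: le_lt_trans (nrmD HF _ _) _; rewrite HZ.
    have : md c * NF (z - w) <= md c * (e / (md c + 1)).
      by rewrite ler_wpM2l ?md_ge0 // ltW.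
    lra.
  exists (c *: a + a'), (c *: b + b'); split; first exact: Glin.
    exact: bd.
  exact: bd.
have Gcfun x y y' : Gc x y -> Gc x y' -> y = y'.
  move=> h h'; have := Gcbd _ _ (Gclin (-1) _ _ _ _ h h').
  rewrite !scaleN1r addNr (nrm0 HN) mulr0 => k.
  apply: esym; apply/eqP; rewrite -subr_eq0 addrC; apply/eqP; apply: (nrm_eq0 HN').
  by apply/eqP; rewrite eq_le k (nrm_ge0 HN').
have Gctot x : exists y, Gc x y.
  have pos n : 0 < (n.+1%:R : R)^-1 by rewrite invr_gt0 ltr0n.
  have [u hu] := choice (fun n => Gdense x (pos n)).
  have [v hv] := choice hu.
  have small e : 0 < e -> exists M, forall n, (M <= n)%N -> N (x - u n) < e.
    move=> e0.
    have h0 := @near_infty_natSinv_lt R (PosNum e0).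
    have [M _ hM] := h0; exists M => n /hM /= h.
    by apply: lt_trans h; have [] := hv n.
  have cau : cauchy_seq N' v.
    move=> e e0; have e1 : 0 < e / (C + 1) / 2 by rewrite !divr_gt0.
    have [M hM] := small _ e1; exists M => m n /hM km /hM kn.
    have [g1 _] := hv m; have [g2 _] := hv n.
    apply: le_lt_trans (GB _ _ _ _ g1 g2) _.
    have k := nrm_tri HN x (u m) (u n); rewrite (nrmB HN (u m) x) in k.
    have : C * N (u m - u n) <= C * (e / (C + 1)).
      by rewrite ler_wpM2l //; set z := e / (C + 1) in km kn *; lra.
    have k5 : C * (e / (C + 1)) + e / (C + 1) = e by field; rewrite gt_eqF.
    have : 0 < e / (C + 1) by rewrite divr_gt0.
    lra.
  have [l hl] := nrm_complete HN' cau.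
  exists l => e e0; have [M1 h1] := small _ e0; have [M2 h2] := hl _ e0.
  exists (u (maxn M1 M2)), (v (maxn M1 M2)); split.
  - by have [] := hv (maxn M1 M2).
  - by apply: h1; rewrite leq_maxl.
  - by rewrite (nrmB HN'); apply: h2; rewrite leq_maxr.
have [h hh] := choice Gctot.
exists h; split => //.
- by move=> c x y; apply: (Gcfun (c *: x + y)) => //; apply: Gclin.
- move=> x y g; apply: (Gcfun x) => // e e0; exists x, y.
  by rewrite !subrr (nrm0 HN) (nrm0 HN').
- by move=> x; apply: Gcbd.
Qed.

End Extension.
End CompleteNorm.

(** * Norm and positivity in C*-algebras *)

Section LinearMaps.
Context (K : pzRingType) (D E : lmodType K) (f : D -> E).
Hypothesis fl : linear f.

Lemma lin0 : f 0 = 0.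
Proof.
have := fl (-1) 0 0; rewrite scaler0 addr0 scaleN1r addNr => {1}->; by [].
Qed.

Lemma linZ c x : f (c *: x) = c *: f x.
Proof. by have := fl c x 0; rewrite !addr0 lin0 addr0. Qed.

Lemma linD x y : f (x + y) = f x + f y.
Proof. by have := fl 1 x y; rewrite !scale1r. Qed.

Lemma linN x : f (- x) = - f x.
Proof. by rewrite -scaleN1r linZ scaleN1r. Qed.

Lemma linB x y : f (x - y) = f x - f y.
Proof. by rewrite linD linN. Qed.

Lemma lin_sum (I : Type) (r : seq I) (P : pred I) (F : I -> D) :
  f (\sum_(i <- r | P i) F i) = \sum_(i <- r | P i) f (F i).
Proof. by apply: (big_morph f linD lin0). Qed.

End LinearMaps.

Section CStar.
Context (R : realType).
Implicit Types A B : cstarAlgType R.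

Section Basics.
Context (A : cstarAlgType R).
Implicit Types x y p h : A.

Lemma cnormZr (c : R[i]) x : cnorm (c *: x) = md c * cnorm x.
Proof. by apply: complexI; rewrite cnormZ normC_md -rmorphM. Qed.

Lemma cscalerA (c d : R[i]) x : c *: (d *: x) = (c * d) *: x.
Proof. exact: scalerA. Qed.

Lemma half_double x : 2^-1 *: (x + x) = x.
Proof.
have e : 2^-1 + 2^-1 = 1 :> R[i] by field.
by rewrite scalerDr -scalerDl e scale1r.
Qed.

Lemma cnorm0 : cnorm (0 : A) = 0.
Proof. by rewrite -(scale0r (0 : A)) cnormZr md0 mul0r. Qed.

Lemma cnormN x : cnorm (- x) = cnorm x.
Proof. by rewrite -scaleN1r cnormZr mdN md1 mul1r. Qed.

Lemma complete_norm_cnorm : complete_norm (@cnorm R A).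
Proof.
split; [exact: cnorm0|exact: cnorm_eq0|exact: cnormD|exact: cnormN|].
move=> u cu; have [l hl] := cnorm_complete _ cu.
exists l => e e0; move/cvgrPdist_lt: hl => /(_ _ e0) [M _ hM].
exists M => n /hM /=; rewrite sub0r normrN; apply: le_lt_trans; exact: ler_norm.
Qed.
Local Notation HN := complete_norm_cnorm.

Lemma cnorm_ge0 x : 0 <= cnorm x.
Proof. exact: nrm_ge0 HN x. Qed.

Lemma star0 : star (0 : A) = 0.
Proof. by rewrite -[X in star X](scale0r (0 : A)) starZ conjC0 scale0r. Qed.

Lemma starN x : star (- x) = - star x.
Proof. by rewrite -scaleN1r starZ rmorphN1 scaleN1r. Qed.

Lemma starB x y : star (x - y) = star x - star y.
Proof. by rewrite starD starN. Qed.

Lemma star1 : star (1 : A) = 1.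
Proof.
have e : star (1 * star 1) = star 1 :> A by rewrite starM starK mul1r.
by rewrite mul1r starK in e.
Qed.

Lemma star_sum (I : Type) (r : seq I) (P : pred I) (F : I -> A) :
  star (\sum_(i <- r | P i) F i) = \sum_(i <- r | P i) star (F i).
Proof. by apply: (big_morph star (@starD R A) star0). Qed.

Lemma cnormS x : cnorm (star x) = cnorm x.
Proof.
have h y : cnorm y <= cnorm (star y).
  have [->|/eqP y0] := eqVneq y 0; first by rewrite star0.
  have yp : 0 < cnorm y.
    by rewrite lt_neqAle cnorm_ge0 andbT eq_sym; apply/eqP => /cnorm_eq0.
  by rewrite -(ler_pM2r yp) -expr2 -cnorm_star cnormM.
by apply/eqP; rewrite eq_le h -{2}(starK x) h.
Qed.

Lemma cnorm_proj p : star p = p -> p * p = p -> p != 0 -> cnorm p = 1.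
Proof.
move=> sp pp p0; have := cnorm_star p; rewrite sp pp => /eqP.
rewrite expr2 -{1}(mulr1 (cnorm p)) => /eqP /mulfI -> //.
by apply: contra_neq p0 => /cnorm_eq0.
Qed.

Lemma cnorm1 : cnorm (1 : A) = 1.
Proof. by apply: cnorm_proj; rewrite ?star1 ?mulr1 ?oner_neq0. Qed.

Lemma cnorm_projle p : star p = p -> p * p = p -> cnorm p <= 1.
Proof.
move=> sp pp; have [->|/cnorm_proj ->//] := eqVneq p 0; by rewrite cnorm0.
Qed.

(** On the ball of radius |h| the map v |-> (h + v^2)/2 is a contraction of ratio
    |h|; if v is its fixed point then (1 - v)^2 = 1 - h.  The root commutes with
    everything that commutes with h because all the iterates do. *)
Lemma sqrt_one_sub h : star h = h -> cnorm h < 1 ->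
  exists2 y, (1 - h = y * y) & star y = y /\ forall a, a * h = h * a -> a * y = y * a.
Proof.
move=> sh h1.
pose P v := [/\ star v = v, cnorm v <= cnorm h & forall a, a * h = h * a -> a * v = v * a].
pose Psi v : A := 2^-1 *: (h + v * v).
have h2 : cnorm h * cnorm h <= cnorm h.
  by rewrite ler_piMr ?cnorm_ge0 // ltW.
have [||u l Pu cl|v Pv|v w Pv Pw||y Py fy] := @banach_fixpoint _ A _ HN P Psi (cnorm h) 0.
- exact: cnorm_ge0.
- exact: h1.
- split.
  + apply: (nrm_small_eq HN) => e e0.
    have [M /(_ M (leqnn _)) hM] := cl _ (half_pos e0).
    apply: le_lt_trans (nrm_tri HN (u M) _ _) _.
    have [su _ _] := Pu M; rewrite -{1}su -starB cnormS (nrmB HN l).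
    by move: hM; lra.
  + apply: le_eps => e e0; have [M /(_ M (leqnn _)) hM] := cl _ e0.
    have [_ k _] := Pu M.
    have := cnormD (l - u M) (u M); rewrite subrK (nrmB HN); lra.
  + move=> a ca; apply: (nrm_small_eq HN) => e e0.
    have a1 : 0 < 2 * cnorm a + 1 by have := cnorm_ge0 a; lra.
    have [M /(_ M (leqnn _)) hM] := cl _ (divr_gt0 e0 a1).
    have [_ _ /(_ _ ca) k] := Pu M.
    apply: le_lt_trans (nrm_tri HN (a * u M) _ _) _.
    rewrite {2}k -mulrBr -mulrBl.
    have k1 := cnormM a (l - u M); have k2 := cnormM (u M - l) a.
    rewrite (nrmB HN l) in k1 *.
    have k3 : cnorm a * cnorm (u M - l) <= cnorm a * (e / (2 * cnorm a + 1)).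
      by rewrite ler_wpM2l ?cnorm_ge0 // ltW.
    have k4 : 2 * (cnorm a * (e / (2 * cnorm a + 1))) + e / (2 * cnorm a + 1) = e.
      by field; rewrite gt_eqF.
    have k5 : 0 < e / (2 * cnorm a + 1) by rewrite divr_gt0.
    rewrite (mulrC (cnorm (u M - l))) in k2; lra.
- have [sv nv cv] := Pv; split.
  + rewrite /Psi starZ starD starM sh sv fmorphV rmorph_nat; by [].
  + rewrite /Psi cnormZr md_half.
    have := cnormD h (v * v); have := cnormM v v.
    have : cnorm v * cnorm v <= cnorm h * cnorm h by rewrite ler_pM ?cnorm_ge0.
    move: h2; lra.
  + move=> a ca; rewrite /Psi -scalerAr -scalerAl mulrDr mulrDl ca.
    by congr (_ *: (_ + _)); rewrite mulrA (cv _ ca) -mulrA (cv _ ca) mulrA.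
- rewrite /Psi -scalerBr cnormZr md_half opprD addrACA subrr add0r.
  have -> : v * v - w * w = v * (v - w) + (v - w) * w.
    by rewrite mulrBr mulrBl addrA subrK.
  have [_ nv _] := Pv; have [_ nw _] := Pw.
  have := cnormD (v * (v - w)) ((v - w) * w).
  have := cnormM v (v - w); have := cnormM (v - w) w.
  have : cnorm v * cnorm (v - w) <= cnorm h * cnorm (v - w).
    by rewrite ler_wpM2r ?cnorm_ge0.
  have : cnorm (v - w) * cnorm w <= cnorm h * cnorm (v - w).
    by rewrite mulrC ler_wpM2r ?cnorm_ge0.
  lra.
- split; [exact: star0|by rewrite cnorm0 cnorm_ge0|by move=> a _; rewrite mulr0 mul0r].
exists (1 - y); last first.
  have [sy _ cy] := Py; split; first by rewrite starB star1 sy.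
  by move=> a /cy ca; rewrite mulrBr mulrBl mulr1 mul1r ca.
have e2 : h + y * y = y + y.
  have := congr1 (fun z => 2%:R *: z) fy.
  by rewrite /Psi /= scalerA mulfV ?pnatr_eq0 // scale1r scaler_nat mulr2n.
rewrite mulrBl mul1r mulrBr mulr1 opprB.
have -> : h = y + y - y * y by rewrite -e2 addrK.
by rewrite !opprD opprK addrA addrA addrAC [RHS]addrA addrAC.
Qed.

End Basics.

(** A positive functional is bounded because 1 - h and 1 + h are squares of
    hermitian elements when h is hermitian of norm less than 1. *)
Section PositiveFunctional.
Context (A : cstarAlgType R) (t : A -> R[i]^o).
Hypothesis (tl : linear t) (tp : forall x, 0 <= t (star x * x)) (t1 : t 1 = 1).

Lemma positive_herm_lt1 h : star h = h -> cnorm h < 1 -> md (t h) <= 1.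
Proof.
have key k : star k = k -> cnorm k < 1 -> t k <= 1.
  move=> sk k1; have [y e [sy _]] := sqrt_one_sub sk k1.
  by rewrite -subr_ge0 -[X in X - _]t1 -(linB tl) e -{1}sy tp.
move=> sh h1; rewrite -lecR -normC_md.
have k1 := key _ sh h1.
have k2 : t (- h) <= 1 by apply: key; rewrite ?starN ?sh ?cnormN.
rewrite (linN tl) in k2.
rewrite real_ler_norml; first by rewrite lerNl k2 k1.
by rewrite (ler_real k1) real1.
Qed.

Lemma positive_herm h : star h = h -> md (t h) <= cnorm h.
Proof.
move=> sh; apply: le_eps => e e0.
have k0 : 0 < cnorm h + e by have := cnorm_ge0 h; lra.
pose c : R[i] := ((cnorm h + e)^-1)%:C%C.
have mc : md c = (cnorm h + e)^-1 by rewrite md_real // invr_ge0 ltW.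
have cc : c^* = c.
  by apply/CrealP; apply: ger0_real; rewrite ler0c invr_ge0 ltW.
have := @positive_herm_lt1 (c *: h); rewrite starZ cc sh cnormZr mc (linZ tl).
rewrite [md (_ *: _)]mdM mc !ler_pdivrMl // ltr_pdivrMl // mulr1 => -> //.
by lra.
Qed.

Lemma positive_bounded x : md (t x) <= 2 * cnorm x.
Proof.
pose a := x + star x; pose b := 'i *: (x - star x).
have sa : star a = a by rewrite starD starK addrC.
have sb : star b = b.
  by rewrite /b starZ conjCi starB starK scaleNr -scalerN opprB.
have e : x = 2^-1 *: (a - 'i *: b).
  have -> : 'i *: b = - (x - star x) by rewrite /b cscalerA -expr2 sqrCi scaleN1r.
  rewrite opprK /a addrACA subrr addr0.
  by rewrite half_double.
have na : cnorm a <= 2 * cnorm x.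
  by have := cnormD x (star x); rewrite cnormS mulr_natl mulr2n.
have nb : cnorm b <= 2 * cnorm x.
  rewrite /b cnormZr md_i mul1r.
  by have := cnormD x (- star x); rewrite cnormN cnormS mulr_natl mulr2n.
have ha := positive_herm sa; have hb := positive_herm sb.
rewrite e (linZ tl) (linB tl) (linZ tl) [md (_ *: _)]mdM md_half.
rewrite -e.
have := mdD (t a) (- ('i *: t b)); rewrite mdN [md ('i *: _)]mdM md_i mul1r.
have := cnorm_ge0 x; lra.
Qed.

End PositiveFunctional.

(** If c and w are commuting hermitian elements with c^2 + w^2 = 1 then c + iw
    is unitary, so c has norm at most 1.  Applied to the image of h and of the
    square root of 1 - h^2, this bounds a homomorphism on hermitian elements. *)
Lemma herm_norm_le1 (B : cstarAlgType R) (c w : B) : star c = c -> star w = w ->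
  c * w = w * c -> c * c + w * w = 1 -> cnorm c <= 1.
Proof.
move=> sc sw cw e.
pose v := c + 'i *: w.
have sv : star v = c - 'i *: w by rewrite starD starZ conjCi sc sw scaleNr.
have vv : star v * v = 1.
  rewrite sv /v mulrDr !mulrBl -!scalerAr -!scalerAl cw addrA subrK cscalerA.
  by rewrite -(expr2 'i) sqrCi scaleN1r opprK.
have nv : cnorm v <= 1.
  rewrite -(@ler_pXn2r _ 2) ?nnegrE ?cnorm_ge0 //.
  by rewrite -cnorm_star vv cnorm1 expr1n.
have -> : c = 2^-1 *: (v + star v).
  rewrite sv /v addrACA subrr addr0.
  by rewrite half_double.
rewrite cnormZr md_half; have := cnormD v (star v); rewrite cnormS; lra.
Qed.

Section Contractive.
Context (A B : cstarAlgType R) (f : A -> B).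
Hypothesis (fh : star_hom f) (f1 : f 1 = 1).
Let fl := star_hom_linear fh.
Let fM := star_homM fh.
Let fS := star_hom_star fh.

Lemma star_hom_herm_lt1 h : star h = h -> cnorm h < 1 -> cnorm (f h) <= 1.
Proof.
move=> sh h1.
have [||w e [sw cw]] := @sqrt_one_sub A (h * h).
- by rewrite starM sh.
- apply: le_lt_trans (cnormM _ _) _.
  by apply: le_lt_trans (h1); rewrite ler_piMr ?cnorm_ge0 // ltW.
apply: (@herm_norm_le1 B _ (f w)); rewrite -?fS ?sh ?sw -?fM //.
  by rewrite cw // mulrA.
by rewrite -e -(linD fl) addrC subrK f1.
Qed.

Lemma star_hom_contractive x : cnorm (f x) <= cnorm x.
Proof.
have herm h : star h = h -> cnorm (f h) <= cnorm h.
  move=> sh; apply: le_eps => e e0.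
  have k0 : 0 < cnorm h + e by have := cnorm_ge0 h; lra.
  pose c : R[i] := ((cnorm h + e)^-1)%:C%C.
  have mc : md c = (cnorm h + e)^-1 by rewrite md_real // invr_ge0 ltW.
  have cc : c^* = c.
    by apply/CrealP; apply: ger0_real; rewrite ler0c invr_ge0 ltW.
  have := @star_hom_herm_lt1 (c *: h); rewrite starZ cc sh cnormZr mc (linZ fl).
  rewrite cnormZr mc !ler_pdivrMl // ltr_pdivrMl // mulr1 => -> //.
  by lra.
rewrite -(@ler_pXn2r _ 2) ?nnegrE ?cnorm_ge0 //.
by rewrite -!cnorm_star -fS -fM herm // starM starK.
Qed.

End Contractive.

End CStar.

(** * Systems of matrix units *)

Section MatrixUnits.
Context (R : realType).

(** A unital finite-dimensional C*-subalgebra given by matrix units: the blocks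
    are indexed by K, the diagonal matrix units by I, and b sends a diagonal
    matrix unit to its block.  A single square array e that vanishes off the
    blocks replaces a family of arrays of varying sizes. *)
Record mxunits (T : cstarAlgType R) (I K : finType) (b : I -> K)
    (e : I -> I -> T) : Prop := MxUnits {
  mu_surj : forall k, exists i, b i = k;
  mu_star : forall i j, star (e i j) = e j i;
  mu_off : forall i j, b i != b j -> e i j = 0;
  mu_mul : forall i j l, b i = b j -> e i j * e j l = e i l;
  mu_mul0 : forall i j k l, j != k -> e i j * e k l = 0;
  mu_sum : \sum_i e i i = 1;
  mu_neq0 : forall i, e i i != 0 }.

Definition lincomb (T : cstarAlgType R) (I : finType) (e : I -> I -> T)
    (a : I -> I -> R[i]) : T := \sum_i \sum_j a i j *: e i j.

Definition mxspan (T : cstarAlgType R) (I : finType) (e : I -> I -> T) (x : T) : Prop :=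
  exists a, x = lincomb e a.

Definition blockunit (T : cstarAlgType R) (I K : finType) (b : I -> K)
  (e : I -> I -> T) (k : K) : T := \sum_(i | b i == k) e i i.

Definition blocksize (I K : finType) (b : I -> K) (k : K) : nat := #|[pred i | b i == k]|.

Section Span.
Context (T : cstarAlgType R) (I : finType) (e : I -> I -> T).

Lemma lincombD a a' : lincomb e a + lincomb e a' = lincomb e (fun i j => a i j + a' i j).
Proof.
rewrite /lincomb -big_split; apply: eq_bigr => i _ /=.
by rewrite -big_split; apply: eq_bigr => j _ /=; rewrite scalerDl.
Qed.

Lemma lincombZ c a : c *: lincomb e a = lincomb e (fun i j => c * a i j).
Proof.
rewrite /lincomb scaler_sumr; apply: eq_bigr => i _.
by rewrite scaler_sumr; apply: eq_bigr => j _; rewrite cscalerA.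
Qed.

Lemma lincomb1 i j : lincomb e (fun k l => ((k == i) && (l == j))%:R) = e i j.
Proof.
rewrite /lincomb (bigD1 i) //= (bigD1 j) //= !eqxx scale1r big1 => [|l lj].
  rewrite addr0 big1 ?addr0 // => k ki; rewrite big1 // => l _.
  by rewrite (negPf ki) scale0r.
by rewrite (negPf lj) scale0r.
Qed.

Lemma mxspan_unit i j : mxspan e (e i j).
Proof. by exists (fun k l => ((k == i) && (l == j))%:R); rewrite lincomb1. Qed.

Lemma mxspanD x y : mxspan e x -> mxspan e y -> mxspan e (x + y).
Proof. by move=> [a ->] [c ->]; rewrite lincombD; eexists. Qed.

Lemma mxspanZ c x : mxspan e x -> mxspan e (c *: x).
Proof. by move=> [a ->]; rewrite lincombZ; eexists. Qed.

Lemma mxspan0 : mxspan e 0.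
Proof.
by exists (fun _ _ => 0); rewrite /lincomb big1 // => i _; rewrite big1 // => j _; rewrite scale0r.
Qed.

Lemma mxspanN x : mxspan e x -> mxspan e (- x).
Proof. by rewrite -scaleN1r; apply: mxspanZ. Qed.

Lemma mxspan_sum (J : Type) (r : seq J) (P : pred J) (F : J -> T) :
  (forall j, P j -> mxspan e (F j)) -> mxspan e (\sum_(j <- r | P j) F j).
Proof.
move=> h; elim/big_ind: _ => //; [exact: mxspan0|exact: mxspanD].
Qed.

End Span.

Lemma mxspan_sub (T : cstarAlgType R) (I J : finType) (e : I -> I -> T) (e' : J -> J -> T) :
  (forall i j, mxspan e' (e i j)) -> forall x, mxspan e x -> mxspan e' x.
Proof.
move=> h x [a ->]; rewrite /lincomb; apply: mxspan_sum => i _; apply: mxspan_sum => j _.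
exact: mxspanZ.
Qed.

Section Theory.
Context (T : cstarAlgType R) (I K : finType) (b : I -> K) (e : I -> I -> T).
Hypothesis E : mxunits b e.
Local Notation z := (blockunit b e).
Local Notation d := (blocksize b).

Definition mxprod (a a' : I -> I -> R[i]) : I -> I -> R[i] :=
  fun i l => \sum_(j | b j == b i) a i j * a' j l.

Definition mxadj (a : I -> I -> R[i]) : I -> I -> R[i] := fun i j => (a j i)^*.

Lemma mu_mulE i j k l :
  e i j * e k l = ((j == k) && (b j == b i))%:R *: e i l.
Proof.
have [<-{k}|jk] := eqVneq j k; last by rewrite (mu_mul0 E) // scale0r.
have [bji|bji] /= := eqVneq (b j) (b i); first by rewrite (mu_mul E) // scale1r.
by rewrite scale0r (mu_off E) ?mul0r // eq_sym.
Qed.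

Lemma lincombM a a' : lincomb e a * lincomb e a' = lincomb e (mxprod a a').
Proof.
rewrite /lincomb mulr_suml; apply: eq_bigr => i _.
rewrite mulr_suml.
transitivity (\sum_j \sum_l ((b j == b i)%:R * (a i j * a' j l)) *: e i l).
  apply: eq_bigr => j _; rewrite mulr_sumr (bigD1 j) //= [X in _ + X]big1 => [|k kj]; last first.
    rewrite mulr_sumr big1 // => l _.
    by rewrite -scalerAl -scalerAr mu_mulE eq_sym (negPf kj) scale0r !scaler0.
  rewrite addr0 mulr_sumr; apply: eq_bigr => l _.
  by rewrite -scalerAl -scalerAr mu_mulE eqxx !cscalerA mulrC mulrA.
rewrite exchange_big /=; apply: eq_bigr => l _; rewrite -scaler_suml; congr (_ *: _).
rewrite /mxprod [RHS]big_mkcond /=; apply: eq_bigr => j _.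
by case: eqP => _; rewrite ?mul1r ?mul0r.
Qed.

Lemma mxspanM x y : mxspan e x -> mxspan e y -> mxspan e (x * y).
Proof. by move=> [a ->] [a' ->]; rewrite lincombM; eexists. Qed.

Lemma star_lincomb a : star (lincomb e a) = lincomb e (mxadj a).
Proof.
rewrite /lincomb star_sum [RHS]exchange_big /=; apply: eq_bigr => i _.
by rewrite star_sum; apply: eq_bigr => j _; rewrite starZ (mu_star E).
Qed.

Lemma mxspanS x : mxspan e x -> mxspan e (star x).
Proof. by move=> [a ->]; rewrite star_lincomb; eexists. Qed.

Lemma mxspan_blockunit k : mxspan e (z k).
Proof. by apply: mxspan_sum => i _; apply: mxspan_unit. Qed.

Lemma mxspan1 : mxspan e 1.
Proof. by rewrite -(mu_sum E); apply: mxspan_sum => i _; apply: mxspan_unit. Qed.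

Lemma mu_idem i : e i i * e i i = e i i.
Proof. exact: (mu_mul E). Qed.

Lemma cnorm_mu i j : b i = b j -> cnorm (e i j) = 1.
Proof.
move=> bij; apply/eqP; rewrite -(@eqrXn2 _ 2) ?cnorm_ge0 // -cnorm_star (mu_star E).
by rewrite (mu_mul E) // (@cnorm_proj _ _ (e j j)) ?(mu_star E) ?mu_idem ?(mu_neq0 E) ?expr1n.
Qed.

Lemma cnorm_mu_le1 i j : cnorm (e i j) <= 1.
Proof.
have [bij|bij] := eqVneq (b i) (b j); first by rewrite cnorm_mu.
by rewrite (mu_off E) // cnorm0.
Qed.

Lemma mu_corner a i j : b i = b j -> e i i * lincomb e a * e j j = a i j *: e i j.
Proof.
move=> bij; rewrite /lincomb mulr_sumr mulr_suml (bigD1 i) //= [X in _ + X]big1 => [|k ki]; last first.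
  rewrite mulr_sumr mulr_suml big1 // => l _.
  by rewrite -scalerAr (mu_mul0 E) ?scaler0 ?mul0r // eq_sym.
rewrite addr0 mulr_sumr mulr_suml (bigD1 j) //= big1 => [|l lj]; last first.
  by rewrite -scalerAr -scalerAl -mulrA (mu_mul0 E _ _ lj) mulr0 scaler0.
by rewrite addr0 -scalerAr -scalerAl (mu_mul E) // (mu_mul E).
Qed.

(** The corner e i i x e j j isolates one coefficient of x. *)
Lemma coef_bound a i j : b i = b j -> md (a i j) <= cnorm (lincomb e a).
Proof.
move=> bij; rewrite -[X in X <= _]mulr1 -(cnorm_mu bij) -cnormZr -mu_corner //.
apply: le_trans (cnormM _ _) _; rewrite cnorm_mu // mulr1.
by apply: le_trans (cnormM _ _) _; rewrite cnorm_mu // mul1r.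
Qed.

Lemma blockunitE k i j : z k * e i j = (b i == k)%:R *: e i j.
Proof.
rewrite mulr_suml big_mkcond (bigD1 i) //= big1 => [|l li]; last first.
  by case: ifP => _ //; rewrite (mu_mul0 E).
rewrite addr0 (mu_mul E) //; case: eqP => _; by rewrite ?scale1r ?scale0r.
Qed.

Lemma blockunitEr k i j : e i j * z k = (b j == k)%:R *: e i j.
Proof.
rewrite mulr_sumr big_mkcond (bigD1 j) //= big1 => [|l lj]; last first.
  by case: ifP => _ //; rewrite (mu_mul0 E) // eq_sym.
rewrite addr0; case: (b j == k); rewrite ?scale1r ?scale0r //.
have [bij|bij] := eqVneq (b i) (b j); first by rewrite (mu_mul E).
by rewrite (mu_off E) ?mul0r.
Qed.

Lemma blockunit_comm k x : mxspan e x -> z k * x = x * z k.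
Proof.
move=> [a ->]; rewrite /lincomb mulr_sumr mulr_suml; apply: eq_bigr => i _.
rewrite mulr_sumr mulr_suml; apply: eq_bigr => j _.
rewrite -scalerAr -scalerAl blockunitE blockunitEr.
have [->//|bij] := eqVneq (b i) (b j).
by rewrite (mu_off E) // !scaler0.
Qed.

Lemma blockunitM k l : z k * z l = (k == l)%:R *: z l.
Proof.
rewrite [X in _ * X]/blockunit mulr_sumr scaler_sumr; apply: eq_bigr => i /eqP <-.
by rewrite blockunitE eq_sym.
Qed.

Lemma blockunit_star k : star (z k) = z k.
Proof. by rewrite star_sum; apply: eq_bigr => i _; rewrite (mu_star E). Qed.

Lemma blockunit_idem k : z k * z k = z k.
Proof. by rewrite blockunitM eqxx scale1r. Qed.

Lemma blockunit_sum : \sum_k z k = 1.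
Proof.
by rewrite -(mu_sum E) (partition_big b xpredT) //=.
Qed.

Lemma blockunit_neq0 k : z k != 0.
Proof.
have [i bi] := mu_surj E k; apply: contraTneq (mu_neq0 E i) => h.
by rewrite negbK -(scale1r (e i i)) -[1]/(true%:R) -(eqxx k) -{1}bi -blockunitE h mul0r.
Qed.

Lemma blocksize_gt0 k : (0 < d k)%N.
Proof. by have [i bi] := mu_surj E k; apply/card_gt0P; exists i; rewrite inE bi. Qed.

Lemma blocksize_neq0 k : (d k)%:R != 0 :> R[i].
Proof. by rewrite pnatr_eq0 -lt0n blocksize_gt0. Qed.

(** A trace sees of a matrix only the normalised traces of its blocks. *)
Lemma trace_lincomb (t : T -> R[i]^o) a : linear t -> (forall x y, t (x * y) = t (y * x)) ->
  t (lincomb e a) = \sum_i a i i * (t (z (b i)) / (d (b i))%:R).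
Proof.
move=> tl tM.
have t_off i j : i != j -> t (e i j) = 0.
  move=> ij; have [bij|bij] := eqVneq (b i) (b j); last by rewrite (mu_off E) // (lin0 tl).
  by rewrite -(mu_mul E j bij) // tM (mu_mul0 E) ?(lin0 tl) // eq_sym.
have t_diag i j : b i = b j -> t (e i i) = t (e j j).
  by move=> bij; rewrite -(mu_mul E i bij) tM (mu_mul E).
have t_ii i : t (e i i) = t (z (b i)) / (d (b i))%:R.
  apply: (canRL (mulfK (blocksize_neq0 _))).
  rewrite (lin_sum tl) (eq_bigr (fun=> t (e i i))); last by move=> j /eqP/t_diag.
  by rewrite sumr_const mulr_natr.
rewrite (lin_sum tl); apply: eq_bigr => i _.
rewrite (lin_sum tl) (bigD1 i) //= [X in _ + X]big1 => [|j ji]; last first.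
  by rewrite (linZ tl) t_off ?scaler0 // eq_sym.
by rewrite addr0 (linZ tl) t_ii.
Qed.

End Theory.

(** Uniqueness of the C*-norm on a finite-dimensional C*-algebra: two C*-norms
    are equivalent, and the C*-identity upgrades n1 <= C n2 to n1 <= n2 through
    the powers h^(2^k) of a hermitian element. *)
Section NormUnique.

Lemma powers_le (C x y : R) : 0 <= x -> 0 <= y -> 0 <= C ->
  (forall k, x ^+ (2 ^ k) <= C * y ^+ (2 ^ k)) -> x <= y.
Proof.
move=> x0 y0 C0 h; rewrite leNgt; apply/negP => yx.
have xp : 0 < x by apply: le_lt_trans yx.
have [|||M hM] := @pow_small R (y / x) C 1.
- by rewrite divr_ge0.
- by rewrite ltr_pdivrMr // mul1r.
- exact: ltr01.
have := hM (2 ^ M)%N (ltnW (ltn_expl M (ltnSn 1))).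
rewrite expr_div_n mulrAC ltr_pdivrMr ?exprn_gt0 // mul1r mulrC.
by move=> /lt_le_trans /(_ (h M)); rewrite ltxx.
Qed.

Context (T1 T2 : cstarAlgType R) (I K : finType) (b : I -> K).
Context (e1 : I -> I -> T1) (e2 : I -> I -> T2).
Hypotheses (E1 : mxunits b e1) (E2 : mxunits b e2).

Lemma cnorm_lincomb_le a : cnorm (lincomb e1 a) <= cnorm (lincomb e2 a).
Proof.
pose C : R := \sum_(i : I) \sum_(j : I) 1.
have C0 : 0 <= C by do 2!apply: sumr_ge0 => ? _.
have bd a' : cnorm (lincomb e1 a') <= C * cnorm (lincomb e2 a').
  apply: le_trans (nrm_sum (complete_norm_cnorm T1) _ _) _.
  rewrite mulr_suml; apply: ler_sum => i _.
  apply: le_trans (nrm_sum (complete_norm_cnorm T1) _ _) _.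
  rewrite mulr_suml; apply: ler_sum => j _.
  rewrite cnormZr mul1r; have [bij|bij] := eqVneq (b i) (b j); last first.
    by rewrite (mu_off E1) // cnorm0 mulr0 cnorm_ge0.
  by rewrite (cnorm_mu E1) // mulr1 (coef_bound E2).
have herm k a' : star (lincomb e1 a') = lincomb e1 a' ->
    star (lincomb e2 a') = lincomb e2 a' ->
    cnorm (lincomb e1 a') ^+ (2 ^ k) <= C * cnorm (lincomb e2 a') ^+ (2 ^ k).
  elim: k a' => [|k IH] a' s1 s2; first by rewrite !expr1.
  rewrite expnS !exprM -!cnorm_star s1 s2 (lincombM E1) (lincombM E2).
  by apply: IH; rewrite -?(lincombM E1) -?(lincombM E2) starM ?s1 ?s2.
rewrite -(@ler_pXn2r _ 2) ?nnegrE ?cnorm_ge0 // -!cnorm_star.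
rewrite (star_lincomb E1) (star_lincomb E2) (lincombM E1) (lincombM E2).
apply: (@powers_le C); rewrite ?cnorm_ge0 // => k; apply: herm.
  by rewrite -(lincombM E1) -(star_lincomb E1) starM starK.
by rewrite -(lincombM E2) -(star_lincomb E2) starM starK.
Qed.

End NormUnique.
End MatrixUnits.

(** * Towers of finite-dimensional algebras and their traces *)

Section Towers.
Context (R : realType).

(** An increasing sequence of finite-dimensional C*-subalgebras with dense union
    in which every block of a stage lies under exactly one block, its parent, of
    the stage before. *)
Record tower (T : cstarAlgType R) (I K : nat -> finType) (b : forall n, I n -> K n)
    (e : forall n, I n -> I n -> T) (pa : forall n, K n.+1 -> K n) : Prop := Tower {
  tw_mu : forall n, mxunits (b n) (e n);
  tw_inc : forall n i j, mxspan (e n.+1) (e n i j);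
  tw_dense : forall x eps, 0 < eps ->
    exists n y, mxspan (e n) y /\ cnorm (x - y) < eps;
  tw_pa : forall n k, blockunit (b n) (e n) k =
    \sum_(l | pa n l == k) blockunit (b n.+1) (e n.+1) l }.

Section Theory.
Context (T : cstarAlgType R) (I K : nat -> finType) (b : forall n, I n -> K n)
  (e : forall n, I n -> I n -> T) (pa : forall n, K n.+1 -> K n).
Arguments b : clear implicits.
Arguments e : clear implicits.
Arguments pa : clear implicits.
Hypothesis W : tower b e pa.
Local Notation z n k := (blockunit (b n) (e n) k).
Local Notation d n k := (blocksize (b n) k).

Lemma tw_incn m n x : (m <= n)%N -> mxspan (e m) x -> mxspan (e n) x.
Proof.
elim: n => [|n IH]; first by rewrite leqn0 => /eqP ->.
rewrite leq_eqVlt => /predU1P[->//|]; rewrite ltnS => /IH h /h.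
by apply: mxspan_sub => i j; apply: (tw_inc W).
Qed.

Lemma tw_zero (E : zmodType) (N : E -> R) (HN : complete_norm N) (F : T -> E) (C : R) :
  0 <= C -> (forall x y, F (x - y) = F x - F y) -> (forall x, N (F x) <= C * cnorm x) ->
  (forall n x, mxspan (e n) x -> F x = 0) -> forall x, F x = 0.
Proof.
move=> C0 FB Fb F0; apply: (dense_zero (S := fun y => exists n, mxspan (e n) y) HN _ C0 FB Fb).
  by move=> x eps /(tw_dense W x) [n [y [sy xy]]]; exists y => //; exists n.
by move=> x [n sx]; apply: F0 sx.
Qed.

Lemma tw_blockunit_comm_next n k m x : (n <= m)%N -> mxspan (e m) x -> z n k * x = x * z n k.
Proof.
move=> nm sx; rewrite -(subnKC nm) in sx; move: (m - n)%N sx => {nm}{}m.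
elim: m n k => [|m IH] n k; first by rewrite addn0; apply: blockunit_comm; exact: (tw_mu W).
rewrite addnS -addSn => sx; rewrite (tw_pa W) mulr_suml mulr_sumr.
by apply: eq_bigr => l _; apply: IH.
Qed.

(** A block unit is a sum of block units of every later stage, hence commutes with
    a dense subalgebra. *)
Lemma tw_central n k x : z n k * x = x * z n k.
Proof.
have nz : cnorm (z n k) <= 1.
  by apply: cnorm_projle; [apply: blockunit_star|apply: blockunit_idem]; exact: (tw_mu W).
apply/eqP; rewrite -subr_eq0; apply/eqP.
apply: (@tw_zero T (@cnorm R T) (complete_norm_cnorm T) (fun x => z n k * x - x * z n k) 2).
- by [].
- by move=> x1 x2; rewrite mulrBr mulrBl subr_subACA.
- move=> y; apply: le_trans (cnormD _ _) _; rewrite cnormN.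
  have := cnormM (z n k) y; have := cnormM y (z n k).
  have : cnorm (z n k) * cnorm y <= cnorm y by rewrite ler_piMl ?cnorm_ge0.
  have : cnorm y * cnorm (z n k) <= cnorm y by rewrite ler_piMr ?cnorm_ge0.
  lra.
- move=> m y sy; apply/eqP; rewrite subr_eq0; apply/eqP.
  by apply: (@tw_blockunit_comm_next _ _ (maxn n m)); rewrite ?leq_maxl //; apply: tw_incn sy; rewrite leq_maxr.
Qed.

Lemma tw_trace_bounded (t : T -> R[i]^o) : tracial_states t -> forall x, md (t x) <= 2 * cnorm x.
Proof. by move=> [tl tp t1 tM]; apply: positive_bounded. Qed.

Lemma tw_trace_unique (s t : T -> R[i]^o) : tracial_states s -> tracial_states t ->
  (forall n k, s (z n k) = t (z n k)) -> s = t.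
Proof.
move=> hs ht st; apply/funext => x; apply/eqP; rewrite -subr_eq0; apply/eqP.
have [sl _ _ sM] := hs; have [tl _ _ tM] := ht.
apply: (@tw_zero R[i] (fun c => md c) (complete_norm_md R) (fun x => s x - t x) 4) => //.
- by move=> y y'; rewrite (linB sl) (linB tl) subr_subACA.
- move=> y; apply: le_trans (mdD _ _) _; rewrite mdN.
  have := tw_trace_bounded hs y; have := tw_trace_bounded ht y; lra.
- move=> n y [a ->].
  rewrite (trace_lincomb (tw_mu W n) _ sl sM) (trace_lincomb (tw_mu W n) _ tl tM).
  by apply/eqP; rewrite subr_eq0; apply/eqP; apply: eq_bigr => i _; rewrite st.
Qed.

End Theory.
End Towers.

Section TraceOfWeights.
Context (R : realType).

Lemma ge0_closed (c : R[i]) :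
  (forall eps : R, 0 < eps -> exists2 p : R[i], 0 <= p & md (c - p) < eps) -> 0 <= c.
Proof.
move=> h; rewrite lecE /=; apply/andP; split.
  rewrite -normr_le0; apply: le_eps => eps /h [p p0 cp]; rewrite add0r.
  have := le_lt_trans (md_Im _) cp; rewrite raddfB /= (ger0_Im p0) subr0; exact: ltW.
apply: le_eps => eps /h [p /ge0_real [_ p0] cp].
have := le_lt_trans (md_Re _) cp; rewrite raddfB /= ltr_norml => /andP[]; lra.
Qed.

(** At a single stage the trace with prescribed weights on the blocks is the
    weighted sum of the normalised traces of the blocks.  It is a total function
    on T, meaningless off the stage, so that the functionals of two stages can be
    compared. *)
Section Stage.
Context (T : cstarAlgType R) (I K : finType) (b : I -> K) (e : I -> I -> T).
Hypothesis E : mxunits b e.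
Variable w : K -> R.
Hypotheses (w0 : forall k, 0 <= w k) (w1 : \sum_k w k = 1).

Definition diagcoef (i : I) (x : T) : R[i] :=
  xget 0 [set c | e i i * x * e i i = c *: e i i].

Definition wcoef (i : I) : R[i] := (w (b i) / (blocksize b (b i))%:R)%:C%C.

Definition wtrace (x : T) : R[i] := \sum_i diagcoef i x * wcoef i.

Lemma diagcoefE i a : diagcoef i (lincomb e a) = a i i.
Proof.
rewrite /diagcoef; case: xgetP => [c _ /= h|/(_ (a i i))]; last first.
  by case; rewrite /= (mu_corner E).
have : (c - a i i) *: e i i = 0 by rewrite scalerBl -h (mu_corner E) // subrr.
move/(congr1 (@cnorm R T)); rewrite cnormZr cnorm0 (cnorm_mu E) // mulr1.
by move/md_eq0/eqP; rewrite subr_eq0 => /eqP.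
Qed.

Lemma wtraceE a : wtrace (lincomb e a) = \sum_i a i i * wcoef i.
Proof. by apply: eq_bigr => i _; rewrite diagcoefE. Qed.

Lemma wcoef_ge0 i : 0 <= wcoef i.
Proof. by rewrite ler0c divr_ge0. Qed.

Lemma wcoef_sum : \sum_i wcoef i = 1.
Proof.
rewrite -(rmorph_sum (real_complex R)) -[RHS](rmorph1 (real_complex R)).
congr (_%:C%C); rewrite -[RHS]w1 (partition_big b xpredT) //=; apply: eq_bigr => k _.
rewrite (eq_bigr (fun=> w k / (blocksize b k)%:R)); last by move=> i /eqP ->.
rewrite sumr_const -[LHS]mulr_natr divfK // pnatr_eq0 -lt0n; exact: (blocksize_gt0 E).
Qed.

Lemma wtrace_lin c x y : mxspan e x -> mxspan e y ->
  wtrace (c *: x + y) = c * wtrace x + wtrace y.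
Proof.
move=> [a ->] [a' ->]; rewrite lincombZ lincombD !wtraceE mulr_sumr -big_split.
by apply: eq_bigr => i _ /=; rewrite mulrDl mulrA.
Qed.

Lemma wtrace0 : wtrace 0 = 0.
Proof.
have -> : 0 = lincomb e (fun _ _ => 0).
  by rewrite /lincomb big1 // => i _; rewrite big1 // => j _; rewrite scale0r.
by rewrite wtraceE big1 // => i _; rewrite mul0r.
Qed.

Lemma wtrace_lincomb (I' : finType) (F : I' -> T) (c : I' -> R[i]) (P : pred I') :
  (forall i, mxspan e (F i)) ->
  wtrace (\sum_(i | P i) c i *: F i) = \sum_(i | P i) c i * wtrace (F i).
Proof.
move=> h.
suff [] : mxspan e (\sum_(i | P i) c i *: F i) /\
  wtrace (\sum_(i | P i) c i *: F i) = \sum_(i | P i) c i * wtrace (F i) by [].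
elim/big_rec2: _ => [|i y x Pi [sy IH]]; first by rewrite wtrace0; split; first exact: mxspan0.
by rewrite wtrace_lin // IH; split => //; apply: mxspanD => //; apply: mxspanZ.
Qed.

Lemma wtraceM x y : mxspan e x -> mxspan e y -> wtrace (x * y) = wtrace (y * x).
Proof.
move=> [a ->] [a' ->]; rewrite !(lincombM E) !wtraceE /mxprod.
transitivity (\sum_i \sum_j (b j == b i)%:R * (a i j * a' j i) * wcoef i).
  apply: eq_bigr => i _; rewrite mulr_suml big_mkcond; apply: eq_bigr => j _.
  by case: eqP; rewrite ?mul1r ?mul0r.
rewrite exchange_big; apply: eq_bigr => i _; rewrite mulr_suml [RHS]big_mkcond.
apply: eq_bigr => j _; rewrite eq_sym.
by case: eqP => [bij|]; rewrite ?mul1r ?mul0r // /wcoef bij (mulrC (a j i)).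
Qed.

Lemma wtrace_ge0 x : mxspan e x -> 0 <= wtrace (star x * x).
Proof.
move=> [a ->]; rewrite (star_lincomb E) (lincombM E) wtraceE.
apply: sumr_ge0 => i _; apply: mulr_ge0; last exact: wcoef_ge0.
by apply: sumr_ge0 => j _; rewrite /mxadj mulrC mul_conjC_ge0.
Qed.

Lemma wtrace_bound x : mxspan e x -> md (wtrace x) <= cnorm x.
Proof.
move=> [a ->]; rewrite wtraceE; apply: le_trans (md_sum _ _) _.
have -> : cnorm (lincomb e a) = \sum_i cnorm (lincomb e a) * md (wcoef i).
  rewrite -mulr_sumr -[LHS]mulr1; congr (_ * _); apply: complexI.
  rewrite (rmorph1 (real_complex R)) -wcoef_sum rmorph_sum; apply: eq_bigr => i _.
  by apply: ge0_md; apply: wcoef_ge0.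
by apply: ler_sum => i _; rewrite mdM ler_wpM2r ?md_ge0 // (coef_bound E).
Qed.

Lemma wtrace_blockunit k : wtrace (blockunit b e k) = (w k)%:C%C.
Proof.
have -> : blockunit b e k = lincomb e (fun i j => ((i == j) && (b i == k))%:R).
  rewrite /blockunit /lincomb big_mkcond; apply: eq_bigr => i _.
  rewrite (bigD1 i) //= big1 ?addr0 ?eqxx => [|j ji].
    by case: eqP; rewrite ?scale1r ?scale0r.
  by rewrite eq_sym (negPf ji) scale0r.
rewrite wtraceE (eq_bigr (fun i => (b i == k)%:R * wcoef i)); last by move=> i _; rewrite eqxx.
transitivity (\sum_(i | b i == k) (w k / (blocksize b k)%:R)%:C%C : R[i]).
  rewrite [RHS]big_mkcond; apply: eq_bigr => i _.
  by case: eqP => [<-|_]; rewrite ?mul1r ?mul0r.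
rewrite sumr_const -[LHS]mulr_natr -(rmorph_nat (real_complex R)) -rmorphM divfK //.
rewrite pnatr_eq0 -lt0n; exact: (blocksize_gt0 E).
Qed.

Lemma wtrace1 : wtrace 1 = 1.
Proof.
rewrite -(mu_sum E).
have -> : \sum_i e i i = lincomb e (fun i j => (i == j)%:R).
  apply: eq_bigr => i _; rewrite (bigD1 i) //= big1 ?addr0 ?eqxx ?scale1r // => j ji.
  by rewrite eq_sym (negPf ji) scale0r.
rewrite wtraceE -[RHS]wcoef_sum; apply: eq_bigr => i _; by rewrite eqxx mul1r.
Qed.

End Stage.

Section Existence.
Context (T : cstarAlgType R) (I K : nat -> finType) (b : forall n, I n -> K n)
  (e : forall n, I n -> I n -> T) (pa : forall n, K n.+1 -> K n).
Arguments b : clear implicits.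
Arguments e : clear implicits.
Arguments pa : clear implicits.
Hypothesis W : tower b e pa.
Variable w : forall n, K n -> R.
Arguments w : clear implicits.
Hypotheses (w0 : forall n k, 0 <= w n k) (w1 : \sum_k w 0%N k = 1)
  (wpa : forall n k, w n k = \sum_(l | pa n l == k) w n.+1 l).

Lemma weight_sum n : \sum_k w n k = 1.
Proof.
elim: n => [//|n <-]; rewrite (partition_big (pa n) xpredT) //=.
by apply: eq_bigr => k _; rewrite wpa.
Qed.

Local Notation tr n := (wtrace (b n) (e n) (w n)).

(** The functional of stage n.+1 is a trace on stage n, and such a trace is
    determined by its values on the block units; consistency of the weights says
    that these values are the prescribed ones. *)
Lemma wtrace_level n x : mxspan (e n) x -> tr n.+1 x = tr n x.
Proof.
have E := tw_mu W n; have E' := tw_mu W n.+1.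
have sp i j : mxspan (e n.+1) (e n i j) by apply: (tw_inc W).
have off i j : i != j -> tr n.+1 (e n i j) = 0.
  move=> ij; have [bij|bij] := eqVneq (b n i) (b n j); last first.
    by rewrite (mu_off E) // (wtrace0 E').
  rewrite -(mu_mul E j bij) (wtraceM E') // (mu_mul0 E) 1?eq_sym //.
  by rewrite (wtrace0 E').
have diag i : tr n.+1 (e n i i) = wcoef (b n) (w n) i.
  have nz : (blocksize (b n) (b n i))%:R != 0 :> R[i] by apply: (blocksize_neq0 E).
  apply: (mulIf nz).
  transitivity (tr n.+1 (blockunit (b n) (e n) (b n i))).
    rewrite /blockunit (eq_bigr (fun j => 1 *: e n j j)); last by move=> j _; rewrite scale1r.
    rewrite (wtrace_lincomb E') // (eq_bigr (fun=> tr n.+1 (e n i i))).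
      by rewrite sumr_const mulr_natr.
    move=> j /eqP bji; rewrite mul1r -(mu_mul E j bji) (wtraceM E') //.
    by rewrite (mu_mul E).
  rewrite (tw_pa W) (eq_bigr (fun l => 1 *: blockunit (b n.+1) (e n.+1) l)); last first.
    by move=> l _; rewrite scale1r.
  rewrite (wtrace_lincomb E'); last by move=> l; apply: mxspan_blockunit.
  rewrite (eq_bigr (fun l => (w n.+1 l)%:C%C)); last first.
    by move=> l _; rewrite mul1r (wtrace_blockunit E').
  rewrite -rmorph_sum -wpa /wcoef -(rmorph_nat (real_complex R)) -rmorphM divfK //.
  by rewrite pnatr_eq0 -lt0n; exact: (blocksize_gt0 E).
move=> [a ->]; rewrite (wtraceE E) /lincomb.
rewrite (eq_bigr (fun i => 1 *: \sum_j a i j *: e n i j)); last by move=> i _; rewrite scale1r.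
rewrite (wtrace_lincomb E'); last by move=> i; apply: mxspan_sum => j _; apply: mxspanZ.
apply: eq_bigr => i _; rewrite mul1r (wtrace_lincomb E') // (bigD1 i) //= big1.
  by rewrite addr0 diag.
by move=> j ji; rewrite off ?mulr0 // eq_sym.
Qed.

Lemma wtrace_level_le m n x : (m <= n)%N -> mxspan (e m) x -> tr n x = tr m x.
Proof.
elim: n => [|n IH]; first by rewrite leqn0 => /eqP ->.
rewrite leq_eqVlt => /predU1P[->//|]; rewrite ltnS => mn sx.
by rewrite (wtrace_level (tw_incn W mn sx)) IH.
Qed.

(** The functionals of the stages fit together to one of norm 1 on a dense
    subalgebra; positivity and the trace identity survive the extension by
    continuity. *)
Lemma trace_of_weights : exists t : T -> R[i]^o,
  tracial_states t /\ forall n k, t (blockunit (b n) (e n) k) = (w n k)%:C%C.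
Proof.
pose G (x : T) (y : R[i]^o) := exists2 n, mxspan (e n) x & y = tr n x.
have [|||||h [hl hG hb]] := @bounded_extension R T R[i]^o (@cnorm R T)
  (fun c : R[i]^o => md c) (complete_norm_cnorm T) (complete_norm_md R) (@cnormZr R T) _ G 1.
- by move=> c x; rewrite [c *: x]/(c * x) mdM.
- exact: ler01.
- move=> c x y x' y' [n sx ->] [m sx' ->]; exists (maxn n m).
    by apply: mxspanD; [apply: mxspanZ|]; [apply: (tw_incn W _ sx)|apply: (tw_incn W _ sx')];
      rewrite ?leq_maxl ?leq_maxr.
  rewrite (wtrace_lin (tw_mu W _)); first last.
  + by apply: (tw_incn W _ sx'); rewrite leq_maxr.
  + by apply: (tw_incn W _ sx); rewrite leq_maxl.
  by rewrite (wtrace_level_le _ sx) ?(wtrace_level_le _ sx') ?leq_maxl ?leq_maxr.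
- move=> x y [n sx ->]; rewrite mul1r; apply: (wtrace_bound (tw_mu W n)) => //; exact: weight_sum.
- move=> x eps e0; have [n [y [sy xy]]] := tw_dense W x e0.
  by exists y, (tr n y); split => //; exists n.
have hE n x : mxspan (e n) x -> h x = tr n x by move=> sx; apply: hG; exists n.
have hBd x : md (h x) <= cnorm x by rewrite -[X in _ <= X]mul1r.
exists h; split; last first.
  move=> n k; rewrite (hE n) ?(wtrace_blockunit (tw_mu W n)) //.
  exact: mxspan_blockunit.
split=> //.
- move=> x; apply: ge0_closed => eps e0.
  pose M := 2 * cnorm x + 1.
  have M0 : 0 < M by rewrite /M; have := cnorm_ge0 x; lra.
  have m0 : 0 < Num.min 1 (eps / M) by rewrite lt_min ltr01 divr_gt0.
  have [n [y [sy]]] := tw_dense W x m0; rewrite lt_min => /andP[xy1 xy2].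
  exists (h (star y * y)).
    have sx : mxspan (e n) (star y * y).
      by apply: (mxspanM (tw_mu W n)) => //; apply: (mxspanS (tw_mu W n)).
    by rewrite (hE n) //; apply: (wtrace_ge0 (tw_mu W n)).
  rewrite -(linB hl); apply: le_lt_trans (hBd _) _.
  have -> : star x * x - star y * y = star x * (x - y) + star (x - y) * y.
    by rewrite starB mulrBr mulrBl addrA subrK.
  have k1 := cnormD (star x * (x - y)) (star (x - y) * y).
  have k2 := cnormM (star x) (x - y); have k3 := cnormM (star (x - y)) y.
  rewrite !cnormS in k2 k3.
  have k4 := cnormD (y - x) x; rewrite subrK (nrmB (complete_norm_cnorm T)) in k4.
  have k5 : cnorm (x - y) * cnorm y <= cnorm (x - y) * (1 + cnorm x).
    by rewrite ler_wpM2l ?cnorm_ge0 //; lra.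
  have k6 : cnorm (x - y) * M < eps by rewrite -ltr_pdivlMr.
  rewrite /M in k6; lra.
- rewrite (hE 0%N) ?(wtrace1 (tw_mu W 0%N)) //; exact: (mxspan1 (tw_mu W 0%N)).
have comm1 y m : mxspan (e m) y -> forall x, h (x * y) - h (y * x) = 0.
  move=> sy; apply: (tw_zero W (complete_norm_md R) (C := 2 * cnorm y)).
  - by rewrite mulr_ge0 ?cnorm_ge0.
  - move=> x1 x2; by rewrite mulrBr mulrBl !(linB hl) subr_subACA.
  - move=> x; apply: le_trans (mdD _ _) _; rewrite mdN.
    have := hBd (x * y); have := hBd (y * x); have := cnormM x y; have := cnormM y x; lra.
  - move=> n x sx; have sx' := tw_incn W (leq_maxl n m) sx.
    have sy' := tw_incn W (leq_maxr n m) sy; have E := tw_mu W (maxn n m).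
    rewrite (hE (maxn n m)) ?(hE (maxn n m) (y * x)); try exact: (mxspanM E).
    by rewrite (wtraceM E) // subrr.
move=> x y; apply/eqP; rewrite -subr_eq0; apply/eqP; move: y.
apply: (tw_zero W (complete_norm_md R) (C := 2 * cnorm x)).
- by rewrite mulr_ge0 ?cnorm_ge0.
- move=> x1 x2; by rewrite mulrBr mulrBl !(linB hl) subr_subACA.
- move=> y; apply: le_trans (mdD _ _) _; rewrite mdN.
  have := hBd (x * y); have := hBd (y * x); have := cnormM x y; have := cnormM y x; lra.
- by move=> n y sy; apply: (comm1 _ n).
Qed.
End Existence.
End TraceOfWeights.

(** * Towers from direct limits *)

Section FdUnits.
Context (R : realType) (r : nat) (p : 'I_r.+1 -> nat).
Local Notation F := (fdalg R p).
Local Notation node := ('I_r.+1).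

(** Matrix units of the summands. The indices are natural numbers, so that no
    cast is needed to compare units of different summands. *)
Definition fdunit (k : node) (i j : nat) : F :=
  fun l => if l == k then delta_mx (inord i) (inord j) else 0.

Definition fdblock (k : node) : F := fun l => if l == k then 1 else 0.

Lemma fd_mulE (x y : F) l : (x * y) l = x l * y l. Proof. by []. Qed.

Lemma fd_sumE (J : Type) (s : seq J) (P : pred J) (G : J -> F) l :
  (\sum_(i <- s | P i) G i) l = \sum_(i <- s | P i) G i l.
Proof. exact: (big_morph (fun x : F => x l)). Qed.

Lemma fdunit_proj k : fdunit k 0 0 = fdproj R p k.
Proof.
apply: functional_extensionality_dep => l; rewrite /fdunit /fdproj.
case: eqP => // _; congr (delta_mx _ _); by apply: val_inj; rewrite /= inordK.
Qed.

Lemma fdunitM k i j l : fdunit k i j * fdunit k j l = fdunit k i l.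
Proof.
apply: functional_extensionality_dep => m; rewrite fd_mulE /fdunit.
case: eqP => _; last by rewrite mulr0.
by rewrite -mulmxE mul_delta_mx.
Qed.

Lemma fdunitM0 k i j k' i' l : k != k' -> fdunit k i j * fdunit k' i' l = 0.
Proof.
move=> kk; apply: functional_extensionality_dep => m; rewrite fd_mulE /fdunit.
by case: eqP => [->|_]; rewrite ?mul0r // (negPf kk) mulr0.
Qed.

Lemma fdunitM0' k (i : nat) (j i' : 'I_(p k).+1) l : j != i' ->
  fdunit k i j * fdunit k i' l = 0.
Proof.
move=> kk; apply: functional_extensionality_dep => m; rewrite fd_mulE /fdunit.
case: eqP => [->|_]; rewrite ?mul0r // -mulmxE mul_delta_mx_0 //.
by rewrite !inord_val.
Qed.

Lemma fdunit_star k i j : star (fdunit k i j) = fdunit k j i.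
Proof.
apply: functional_extensionality_dep => m; rewrite /star /= /fdunit.
case: eqP => _; apply/matrixP => a c; rewrite !mxE ?conjC0 //.
by rewrite conjC_nat andbC.
Qed.

Lemma fd_expand (x : F) :
  x = \sum_k \sum_(i < (p k).+1) \sum_(j < (p k).+1) x k i j *: fdunit k i j.
Proof.
apply: functional_extensionality_dep => l; rewrite fd_sumE (bigD1 l) //=.
rewrite [X in _ + X]big1 => [|k kl]; last first.
  rewrite fd_sumE big1 // => i _; rewrite fd_sumE big1 // => j _.
  by rewrite /GRing.scale /= /fdunit eq_sym (negPf kl) scaler0.
rewrite addr0 fd_sumE {1}[x l]matrix_sum_delta; apply: eq_bigr => i _.
rewrite fd_sumE; apply: eq_bigr => j _.
by rewrite {2}/GRing.scale /= /fdunit eqxx !inord_val.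
Qed.

Lemma fdblockE k : fdblock k = \sum_(i < (p k).+1) fdunit k i i.
Proof.
apply: functional_extensionality_dep => l; rewrite fd_sumE /fdblock /fdunit.
case: eqP => [->|_]; last by rewrite big1.
rewrite -[LHS]/(1%:M) mx1_sum_delta; apply: eq_bigr => i _; by rewrite inord_val.
Qed.

Lemma fdblock_sum : \sum_k fdblock k = 1.
Proof.
apply: functional_extensionality_dep => l; rewrite fd_sumE (bigD1 l) //= big1 => [|k kl].
  by rewrite addr0 /fdblock eqxx.
by rewrite /fdblock eq_sym (negPf kl).
Qed.

Lemma fdblockM k k' i j : fdblock k * fdunit k' i j = (k' == k)%:R *: fdunit k' i j.
Proof.
apply: functional_extensionality_dep => l; rewrite fd_mulE /fdblock /fdunit.
rewrite /GRing.scale /=; case: (eqVneq l k) => [->|lk].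
  by rewrite mul1r eq_sym; case: eqP; rewrite ?scale1r ?scaler0.
case: eqP => [<-|]; rewrite mul0r ?scaler0 //.
by rewrite (negPf lk) scale0r.
Qed.

Section Image.
Context (T : cstarAlgType R) (psi : F -> T).
Hypotheses (hpsi : star_hom psi) (psi1 : psi 1 = 1).
Let psil := star_hom_linear hpsi.
Let psiM := star_homM hpsi.
Let psiS := star_hom_star hpsi.

(** A summand that the later connecting maps kill has image 0 in the limit; only
    the others contribute matrix units. *)
Definition alive (k : node) : bool := psi (fdproj R p k) != 0.

Lemma alive_unit k i : alive k = (psi (fdunit k i i) != 0).
Proof.
rewrite /alive -fdunit_proj; congr (~~ _); apply/eqP/eqP => h.
  by rewrite -(fdunitM k i 0 i) -(fdunitM k 0 0 i) !psiM h mul0r mulr0.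
by rewrite -(fdunitM k 0 i 0) -(fdunitM k i i 0) !psiM h mul0r mulr0.
Qed.

Lemma dead_unit k i j : ~~ alive k -> psi (fdunit k i j) = 0.
Proof.
by rewrite (alive_unit k i) negbK -(fdunitM k i i j) psiM => /eqP ->; rewrite mul0r.
Qed.

Definition allidx := {k : node & 'I_(p k).+1}.
Definition idx := {x : allidx | x \in [pred x : allidx | alive (tag x)]}.
Definition blk := {k : node | alive k}.

Definition idxblk (x : idx) : blk := exist _ (tag (val x)) (valP x).

(** As a natural number the index does not depend on the summand, which can then
    be rewritten. *)
Definition pos (x : allidx) : nat := tagged x.

Definition aunit (x y : allidx) : F :=
  if tag x == tag y then fdunit (tag x) (pos x) (pos y) else 0.

Definition iunit (x y : idx) : T := psi (aunit (val x) (val y)).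

Lemma aunit_mul x y w : tag x = tag y -> aunit x y * aunit y w = aunit x w.
Proof.
move=> xy; rewrite /aunit xy eqxx; case: eqP => [_|]; last by rewrite mulr0.
by rewrite fdunitM.
Qed.

Lemma aunit_mul0 x y y' w : y != y' -> aunit x y * aunit y' w = 0.
Proof.
move=> ne; rewrite /aunit; case: eqP => [xy|_]; last by rewrite mul0r.
case: eqP => [yw|_]; last by rewrite mulr0.
rewrite xy; move: (pos x) (pos w) => a c {xy yw}.
case: y y' ne => [k i] [k' i']; rewrite /pos /= => ne.
have [kk|kk] := eqVneq k k'; last by rewrite fdunitM0.
case: k' / kk i' ne => i' ne; rewrite fdunitM0' //.
by apply: contraNneq ne => ->.
Qed.

Lemma aunit_star x y : star (aunit x y) = aunit y x.
Proof.
rewrite /aunit [tag y == _]eq_sym; case: eqP => [xy|_].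
  by rewrite fdunit_star xy.
by apply: functional_extensionality_dep => l; apply/matrixP => a c; rewrite !mxE conjC0.
Qed.

Lemma sum_idx (G : allidx -> T) : (forall x, ~~ alive (tag x) -> G x = 0) ->
  \sum_(x : idx) G (val x) = \sum_k \sum_(i < (p k).+1) G (Tagged (fun k => 'I_(p k).+1) i).
Proof.
move=> h; rewrite -(big_sub [pred x : allidx | alive (tag x)] G).
rewrite sig_big_dep /= big_mkcond; apply: eq_bigr => -[k i] _ /=.
by case: ifP => // /negbT /h ->.
Qed.

Lemma image_mxunits : mxunits idxblk iunit.
Proof.
split.
- by move=> [k hk]; exists (exist _ (Tagged (fun k => 'I_(p k).+1) ord0) hk); apply: val_inj.
- by move=> x y; rewrite /iunit -psiS aunit_star.
- move=> x y; rewrite -val_eqE /= => xy; rewrite /iunit /aunit (negPf xy); exact: (lin0 psil).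
- by move=> x y w /(congr1 val) /= xy; rewrite /iunit -psiM aunit_mul.
- by move=> x y y' w yy; rewrite /iunit -psiM aunit_mul0 ?(lin0 psil).
- rewrite /iunit (sum_idx (G := fun x => psi (aunit x x))) => [|x dx]; last first.
    by rewrite /aunit eqxx dead_unit.
  rewrite -psi1 -fdblock_sum (lin_sum psil); apply: eq_bigr => k _.
  by rewrite fdblockE (lin_sum psil); apply: eq_bigr => i _; rewrite /aunit /= eqxx.
- by move=> x; rewrite /iunit /aunit eqxx -alive_unit; exact: (valP x).
Qed.

Lemma image_span y : mxspan iunit (psi y).
Proof.
rewrite (fd_expand y) (lin_sum psil); apply: mxspan_sum => k _.
rewrite (lin_sum psil); apply: mxspan_sum => i _.
rewrite (lin_sum psil); apply: mxspan_sum => j _.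
rewrite (linZ psil); apply: mxspanZ.
have [ak|dk] := boolP (alive k); last by rewrite dead_unit //; apply: mxspan0.
pose mk i : idx := exist _ (Tagged (fun k => 'I_(p k).+1) i) ak.
have -> : psi (fdunit k i j) = iunit (mk i) (mk j) by rewrite /iunit /aunit /= eqxx.
exact: mxspan_unit.
Qed.

Lemma image_blockunit (k : blk) : blockunit idxblk iunit k = psi (fdblock (val k)).
Proof.
have E := image_mxunits.
rewrite -[RHS]mulr1 -(mu_sum E) mulr_sumr [LHS]big_mkcond; apply: eq_bigr => x _.
rewrite /iunit -psiM /aunit eqxx fdblockM (linZ psil) -val_eqE /=.
by case: eqP; rewrite ?scale1r ?scale0r.
Qed.

Lemma blockunit_dead k : ~~ alive k -> psi (fdblock k) = 0.
Proof.
move=> dk; rewrite fdblockE (lin_sum psil) big1 // => i _; exact: dead_unit.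
Qed.

End Image.
End FdUnits.

Section LimitTower.
Context (R : realType) (T : cstarAlgType R) (r : nat -> nat).
Variable p : forall n, 'I_(r n).+1 -> nat.
Arguments p : clear implicits.
Variable phi : forall n, fdalg R (p n) -> fdalg R (p n.+1).
Arguments phi : clear implicits.
Variable psi : forall n, fdalg R (p n) -> T.
Arguments psi : clear implicits.
Hypotheses (phih : forall n, star_hom (phi n)) (psih : forall n, star_hom (psi n))
  (psiphi : forall n x, psi n.+1 (phi n x) = psi n x)
  (psid : cdense (\bigcup_n range (psi n))).

Lemma psi_lift m n x : (m <= n)%N -> exists y, psi m x = psi n y.
Proof.
elim: n => [|n IH]; first by rewrite leqn0 => /eqP mn; subst m; exists x.
rewrite leq_eqVlt => /predU1P[mn|]; first by subst m; exists x.
by rewrite ltnS => /IH [y ->]; exists (phi n y); rewrite psiphi.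
Qed.

(** The images of the units increase to a projection at distance less than 1
    from the unit of the limit, hence are eventually equal to it. *)
Lemma psi_unital : exists n0, forall n, (n0 <= n)%N -> psi n 1 = 1.
Proof.
have [y [n0 _ [x _ <-]] ny] := psid 1 ltr01.
have e0 : psi n0 1 = 1.
  set P := psi n0 1.
  have Py : P * psi n0 x = psi n0 x by rewrite -(star_homM (psih n0)) mul1r.
  have e : 1 - P = (1 - P) * (1 - psi n0 x).
    by rewrite mulrBl mul1r mulrBr mulr1 Py opprB addrA subrK.
  apply: esym; apply: (nrm_small_eq (complete_norm_cnorm T)) => eps eps0.
  have := cnormM (1 - P) (1 - psi n0 x); rewrite -e.
  have := cnorm_ge0 (1 - P); rewrite le_eqVlt => /predU1P[<- //|P0].
  by rewrite -ler_pdivrMl // mulVf ?gt_eqF // leNgt ny.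
exists n0 => n n0n; have [w hw] := psi_lift 1 n0n.
by rewrite -[LHS]mulr1 -e0 hw -(star_homM (psih n)) mul1r -hw.
Qed.

Hypothesis onepar : forall n j, exists! k, repr_mx (phi n) j k != 0.

Lemma repr_mx0 n j k : repr_mx (phi n) j k = 0 -> phi n (fdblock R (p n) k) j = 0.
Proof.
rewrite mxE => -[/eqP]; rewrite mxrank_eq0 => /eqP h.
rewrite fdblockE (lin_sum (star_hom_linear (phih n))) fd_sumE big1 // => i _.
by rewrite -(fdunitM R (p n) k i 0 i) -(fdunitM R (p n) k 0 0 i) !(star_homM (phih n)) !fd_mulE
  fdunit_proj h mul0r mulr0.
Qed.

(** The unit of a block of the next level is fixed by the image of exactly one
    block unit, because every row of the representing matrix has one non-zero
    entry and the images of the block units add up to 1. *)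
Lemma tower_of_limit : exists n0 (I K : nat -> finType) (b : forall n, I n -> K n)
    (e : forall n, I n -> I n -> T) (pa : forall n, K n.+1 -> K n),
  tower b e pa /\ forall n, exists h : K n -> 'I_(r (n + n0)%N).+1, injective h.
Proof.
have [n0 hn0] := psi_unital.
pose N n := (n + n0)%N.
have u1 n : psi (N n) 1 = 1 by apply: hn0; rewrite leq_addl.
pose K n : finType := blk (psi (N n)).
pose I n : finType := idx (psi (N n)).
pose b n : I n -> K n := @idxblk _ _ _ _ (psi (N n)).
pose e n : I n -> I n -> T := @iunit _ _ _ _ (psi (N n)).
have E n : mxunits (b n) (e n) by apply: image_mxunits.
have zE n (k : K n) : blockunit (b n) (e n) k = psi (N n) (fdblock _ _ (val k)).
  by apply: image_blockunit.
have par n (l : K n.+1) : exists k : K n, forall k' : K n,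
    blockunit (b n) (e n) k' * blockunit (b n.+1) (e n.+1) l =
    (k == k')%:R *: blockunit (b n.+1) (e n.+1) l.
  have [k [_ kuniq]] := onepar (val l).
  have zero k' : k' != k -> psi (N n) (fdblock _ _ k') * blockunit (b n.+1) (e n.+1) l = 0.
    move=> kk; rewrite -psiphi zE -[psi (N n.+1)]/(psi (N n).+1) -(star_homM (psih _)).
    rewrite (_ : _ * _ = 0) ?(lin0 (star_hom_linear (psih _))) //.
    apply: functional_extensionality_dep => j; rewrite fd_mulE /fdblock.
    case: eqP => [->|_]; last by rewrite mulr0.
    rewrite repr_mx0 ?mul0r //; apply/eqP; apply: contraNT kk => /kuniq ->.
    exact: eqxx.
  have one : psi (N n) (fdblock _ _ k) * blockunit (b n.+1) (e n.+1) l =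
      blockunit (b n.+1) (e n.+1) l.
    rewrite -[RHS]mul1r -(u1 n) -fdblock_sum (lin_sum (star_hom_linear (psih _))) mulr_suml.
    rewrite [RHS](bigD1 k) //= big1 ?addr0 // => k' kk; exact: zero.
  have ak : alive (psi (N n)) k.
    apply: contraNT (blockunit_neq0 (E n.+1) l) => dk.
    by rewrite -one (blockunit_dead (psih _)) // mul0r.
  exists (exist _ k ak) => k'; rewrite zE -val_eqE /=; case: eqP => [<-|kk].
    by rewrite one scale1r.
  by rewrite zero ?scale0r // eq_sym; apply/eqP.
pose pa n (l : K n.+1) : K n := projT1 (cid (par n l)).
have paP n (l : K n.+1) k' : blockunit (b n) (e n) k' * blockunit (b n.+1) (e n.+1) l =
    (pa n l == k')%:R *: blockunit (b n.+1) (e n.+1) l.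
  by rewrite /pa; case: (cid _) => k /= ->.
exists n0, I, K, b, e, pa; split; last by move=> n; exists val; apply: val_inj.
split.
- exact: E.
- move=> n i j; rewrite /e /iunit -psiphi; exact: (image_span (psih _)).
- move=> x eps /(psid x) [y [n _ [w _ <-]] xy].
  have [v hv] := psi_lift w (leq_addr n0 n).
  exists n, (psi n w); split => //; rewrite hv; exact: (image_span (psih _)).
- move=> n k; rewrite -[LHS]mulr1 -(blockunit_sum (E n.+1)) mulr_sumr [RHS]big_mkcond.
  apply: eq_bigr => l _; rewrite paP.
  by case: eqP; rewrite ?scale1r ?scale0r.
Qed.

End LimitTower.

(** * Tensor products with a tower of full matrix algebras *)

Section TensorTower.
Context (R : realType) (A Q T : cstarAlgType R) (f : A -> T) (g : Q -> T).
Hypotheses (fh : star_hom f) (gh : star_hom g) (f1 : f 1 = 1) (g1 : g 1 = 1).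
Hypothesis fgC : forall a b, f a * g b = g b * f a.
Hypothesis inj : forall n (a : 'I_n -> A) (b : 'I_n -> Q), lin_indep b ->
  \sum_(k < n) f (a k) * g (b k) = 0 -> forall k, a k = 0.
Hypothesis dense : cdense [set t | exists n (a : 'I_n -> A) (b : 'I_n -> Q),
                 t = \sum_(k < n) f (a k) * g (b k)].
Let fl := star_hom_linear fh.
Let gl := star_hom_linear gh.
Let fM := star_homM fh.
Let gM := star_homM gh.

(** Injectivity of the algebraic tensor product for elementary tensors. *)
Lemma tensor_neq0 a q : a != 0 -> q != 0 -> f a * g q != 0.
Proof.
move=> a0 q0; apply: contraNneq a0 => h; apply/eqP.
apply: (@inj 1 (fun=> a) (fun=> q) _ _ ord0); last by rewrite big_ord1.
move=> c; rewrite big_ord1 => cq k; rewrite (ord1 k).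
have := congr1 (@cnorm R Q) cq; rewrite cnormZr cnorm0 => /eqP.
rewrite mulf_eq0 => /orP[/eqP/md_eq0 //|/eqP/cnorm_eq0 h'].
by rewrite h' eqxx in q0.
Qed.

Lemma tensorM a a' q q' : (f a * g q) * (f a' * g q') = f (a * a') * g (q * q').
Proof. by rewrite fM gM -!mulrA; congr (_ * _); rewrite !mulrA fgC. Qed.

Context (I K J L : nat -> finType) (b : forall n, I n -> K n) (c : forall n, J n -> L n)
  (e : forall n, I n -> I n -> A) (u : forall n, J n -> J n -> Q)
  (pa : forall n, K n.+1 -> K n) (qa : forall n, L n.+1 -> L n).
Arguments b : clear implicits.
Arguments c : clear implicits.
Arguments e : clear implicits.
Arguments u : clear implicits.
Arguments pa : clear implicits.
Arguments qa : clear implicits.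
Hypotheses (WA : tower b e pa) (WQ : tower c u qa).
Hypothesis L1 : forall n (k l : L n), k = l.

Definition tensor_idx n : finType := (I n * J n)%type.
Definition tensor_blk n (x : tensor_idx n) : K n := b n x.1.
Definition tensor_unit n (x y : tensor_idx n) : T := f (e n x.1 y.1) * g (u n x.2 y.2).

Lemma tensor_mxspan n a q : mxspan (e n) a -> mxspan (u n) q ->
  mxspan (@tensor_unit n) (f a * g q).
Proof.
move=> [x ->] [y ->]; rewrite /lincomb (lin_sum fl) mulr_suml.
apply: mxspan_sum => i _; rewrite (lin_sum fl) mulr_suml; apply: mxspan_sum => i' _.
rewrite (lin_sum gl) mulr_sumr; apply: mxspan_sum => j _.
rewrite (lin_sum gl) mulr_sumr; apply: mxspan_sum => j' _.
rewrite (linZ fl) (linZ gl) -scalerAl -scalerAr; do 2!apply: mxspanZ.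
exact: (mxspan_unit (@tensor_unit n) (i, j) (i', j')).
Qed.

Lemma tensor_blockunit n k :
  blockunit (@tensor_blk n) (@tensor_unit n) k = f (blockunit (b n) (e n) k).
Proof.
rewrite -[RHS]mulr1 -g1 -(mu_sum (tw_mu WQ n)) (lin_sum fl) (lin_sum gl) mulr_suml.
rewrite (eq_bigr (fun i => \sum_j f (e n i i) * g (u n j j))); last first.
  by move=> i _; rewrite mulr_sumr.
by rewrite pair_big /=; apply: eq_bigl => x; rewrite andbT.
Qed.

Lemma tensor_mxunits n : mxunits (@tensor_blk n) (@tensor_unit n).
Proof.
have EA := tw_mu WA n; have EQ := tw_mu WQ n.
have cc j j' : c n j = c n j' by apply: L1.
split.
- move=> k; have [i bi] := mu_surj EA k.
  have [j _] : exists j : J n, true.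
    apply/existsP; apply: contraT; rewrite negb_exists => /forallP h.
    have := oner_neq0 Q; rewrite -(mu_sum EQ) big1 ?eqxx // => j _.
    by have := h j.
  by exists (i, j).
- by move=> x y; rewrite /tensor_unit starM -(star_hom_star fh) -(star_hom_star gh)
    (mu_star EA) (mu_star EQ) fgC.
- by move=> x y xy; rewrite /tensor_unit (mu_off EA) // (lin0 fl) mul0r.
- by move=> x y w xy; rewrite /tensor_unit tensorM (mu_mul EA) // (mu_mul EQ).
- move=> [i i'] [j j'] [k k'] [l l'] /=; rewrite xpair_eqE negb_and /tensor_unit tensorM /=.
  by case/orP => h; rewrite ?(mu_mul0 EA _ _ h) ?(mu_mul0 EQ _ _ h) ?(lin0 fl) ?(lin0 gl) ?mul0r ?mulr0.
- rewrite -[RHS]f1 -(blockunit_sum EA) (lin_sum fl).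
  rewrite (partition_big (@tensor_blk n) xpredT) //=.
  by apply: eq_bigr => k _; rewrite -tensor_blockunit.
- by move=> x; apply: tensor_neq0; [apply: (mu_neq0 EA)|apply: (mu_neq0 EQ)].
Qed.

(** Homomorphisms of C*-algebras are contractive, so approximating each factor by
    an element of a stage approximates the tensor. *)
Lemma tensor_approx a q eps : 0 < eps ->
  exists n x, mxspan (@tensor_unit n) x /\ cnorm (f a * g q - x) < eps.
Proof.
move=> e0; pose M := cnorm q + cnorm a + 1.
have M0 : 0 < M by rewrite /M; have := cnorm_ge0 q; have := cnorm_ge0 a; lra.
have m0 : 0 < Num.min 1 (eps / M) by rewrite lt_min ltr01 divr_gt0.
have [n1 [a' [sa]]] := tw_dense WA a m0; rewrite lt_min => /andP[a1 a2].
have [n2 [q' [sq]]] := tw_dense WQ q m0; rewrite lt_min => /andP[q1 q2].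
exists (maxn n1 n2), (f a' * g q'); split.
  by apply: tensor_mxspan; [apply: (tw_incn WA _ sa)|apply: (tw_incn WQ _ sq)];
    rewrite ?leq_maxl ?leq_maxr.
have -> : f a * g q - f a' * g q' = f (a - a') * g q + f a' * g (q - q').
  by rewrite (linB fl) (linB gl) mulrBl mulrBr addrA subrK.
apply: le_lt_trans (cnormD _ _) _.
have k1 := cnormM (f (a - a')) (g q); have k2 := cnormM (f a') (g (q - q')).
have k3 : cnorm (f (a - a')) * cnorm (g q) <= cnorm (a - a') * cnorm q.
  by apply: ler_pM; rewrite ?cnorm_ge0 ?star_hom_contractive.
have k4 : cnorm (f a') * cnorm (g (q - q')) <= (cnorm a + 1) * cnorm (q - q').
  apply: ler_pM; rewrite ?cnorm_ge0 ?star_hom_contractive //.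
  apply: le_trans (star_hom_contractive fh f1 _) _.
  have := cnormD (a' - a) a; rewrite subrK (nrmB (complete_norm_cnorm A)); lra.
have k5 : cnorm (a - a') * cnorm q <= eps / M * cnorm q by rewrite ler_wpM2r ?cnorm_ge0 // ltW.
have k6 : (cnorm a + 1) * cnorm (q - q') < (cnorm a + 1) * (eps / M).
  by rewrite ltr_pM2l //; have := cnorm_ge0 a; lra.
have k7 : eps / M * cnorm q + (cnorm a + 1) * (eps / M) = eps.
  by rewrite [X in X + _]mulrC -mulrDl addrA -/M mulrC divfK // gt_eqF.
lra.
Qed.

(** The stages of Q have one block each, so tensoring with Q enlarges the blocks of
    A without changing their forest. *)
Lemma tensor_tower : tower (@tensor_blk) (@tensor_unit) pa.
Proof.
have inc n x y : mxspan (@tensor_unit n.+1) (@tensor_unit n x y).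
  by apply: tensor_mxspan; [apply: (tw_inc WA)|apply: (tw_inc WQ)].
split=> //.
- exact: tensor_mxunits.
- move=> x eps e0; have [y [N [a [q ->]]] xy] := dense x (half_pos e0).
  have incn m n w : (m <= n)%N -> mxspan (@tensor_unit m) w -> mxspan (@tensor_unit n) w.
    elim: n => [|n IH]; first by rewrite leqn0 => /eqP ->.
    rewrite leq_eqVlt => /predU1P[->//|]; rewrite ltnS => /IH h /h.
    by apply: mxspan_sub.
  suff [n [w [sw hw]]] : exists n w, mxspan (@tensor_unit n) w /\
      cnorm (\sum_(k < N) f (a k) * g (q k) - w) < eps / 2.
    exists n, w; split=> //.
    apply: le_lt_trans (nrm_tri (complete_norm_cnorm T) (\sum_(k < N) f (a k) * g (q k)) _ _) _.
    lra.
  elim: N a q {xy} (eps / 2) (half_pos e0) => [|N IH] a q d d0.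
    by exists 0%N, 0; split; [exact: mxspan0|rewrite big_ord0 subrr cnorm0].
  have [n1 [w1 [s1 h1]]] := IH (a \o widen_ord (leqnSn N)) (q \o widen_ord (leqnSn N)) _ (half_pos d0).
  have [n2 [w2 [s2 h2]]] := tensor_approx (a ord_max) (q ord_max) (half_pos d0).
  exists (maxn n1 n2), (w1 + w2); split.
    by apply: mxspanD; [apply: (incn _ _ _ _ s1)|apply: (incn _ _ _ _ s2)]; rewrite ?leq_maxl ?leq_maxr.
  rewrite big_ord_recr /= opprD addrACA; apply: le_lt_trans (cnormD _ _) _.
  by move: h1 h2 => /=; lra.
- move=> n k; rewrite tensor_blockunit (tw_pa WA) (lin_sum fl).
  by apply: eq_bigr => l _; rewrite tensor_blockunit.
Qed.

End TensorTower.

(** * Isomorphism of trace simplices *)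

Section TraceIso.
Context (R : realType).
Implicit Types A B C : cstarAlgType R.

Lemma ltr0C (x : R) : (0 < x%:C%C :> R[i]) = (0 < x).
Proof. exact: (ltcR 0 x). Qed.

Lemma ptws_cvgP (U : eqType) (V : topologicalType) (F : set_system {ptws U -> V})
    (f : {ptws U -> V}) : Filter F ->
  F --> f <-> forall x, (fun g : {ptws U -> V} => g x) @ F --> f x.
Proof.
move=> FF; split=> [h x|h].
  apply: cvg_trans (@proj_continuous U (fun=> V) x f).
  exact: (cvg_app (fun g : {ptws U -> V} => g x) h).
apply/cvg_sup => x D [C] [[W] oW <-] Wfx WD.
apply: (filterS WD); apply: h; exact: open_nbhs_nbhs.
Qed.

(** Continuity into the topology of pointwise convergence is tested at one element
    b of the target at a time. *)
Lemma traces_continuous A B (F : {ptws A -> R[i]^o} -> {ptws B -> R[i]^o}) :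
  (forall s, tracial_states s -> forall b (eps : R), 0 < eps ->
     exists (a : A) (del : R), 0 < del /\ forall s', tracial_states s' ->
       md (s a - s' a : R[i]) < del -> md (F s b - F s' b : R[i]) < eps) ->
  {within @tracial_states R A, continuous F}.
Proof.
move=> h; apply/subspace_continuousP => s hs; apply/ptws_cvgP => b.
apply/cvgrPdist_lt => eps e0.
have eE : eps = (complex.Re eps)%:C%C by have [] := ge0_real (ltW e0).
have e1 : 0 < complex.Re eps by rewrite -ltr0C -eE.
have [a [del [d0 hd]]] := h s hs b _ e1.
have ev : (fun g : {ptws A -> R[i]^o} => g a) @ nbhs s --> s a.
  by have /ptws_cvgP := @cvg_id _ (nbhs s); apply.
have d1 : 0 < del%:C%C :> R[i] by rewrite ltr0C.
move/cvgrPdist_lt: ev => /(_ _ d1) ev; rewrite /= nbhs_simpl /within /=.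
apply: filterS ev => s' h1 hs'; rewrite eE.
suff : (md (F s b - F s' b : R[i]))%:C%C < (complex.Re eps)%:C%C :> R[i] by [].
by rewrite ltcR; apply: hd => //; rewrite -ltcR; exact: h1.
Qed.

Lemma traces_sequential A B (F : {ptws A -> R[i]^o} -> {ptws B -> R[i]^o})
    (u : nat -> A -> R[i]^o) (s : A -> R[i]^o) :
  {within @tracial_states R A, continuous F} ->
  (forall n, tracial_states (u n)) -> tracial_states s ->
  (forall a (eps : R), 0 < eps -> exists N, forall n, (N <= n)%N -> md (s a - u n a : R[i]) < eps) ->
  forall b (eps : R), 0 < eps -> exists N, forall n, (N <= n)%N -> md (F s b - F (u n) b : R[i]) < eps.
Proof.
move=> /subspace_continuousP hF hu hs us b eps e0.
have cu : (u : nat -> {ptws A -> R[i]^o}) @ \oo --> (s : {ptws A -> R[i]^o}).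
  apply/ptws_cvgP => a; apply/cvgrPdist_lt => eps1 e1.
  have eE : eps1 = (complex.Re eps1)%:C%C by have [] := ge0_real (ltW e1).
  have e2 : 0 < complex.Re eps1 by rewrite -ltr0C -eE.
  have [N hN] := us a _ e2; exists N => // n /= /hN; rewrite eE -ltcR; exact.
have cF : (F \o u) @ \oo --> F s.
  apply: cvg_trans (hF s hs) => U /=; rewrite nbhs_simpl /within /= => hU.
  have := cu _ hU; rewrite !nbhs_simpl /= => -[N _ hN].
  by exists N => // n /= /hN; apply.
have /ptws_cvgP /(_ b) /cvgrPdist_lt h := cF.
have e1 : 0 < eps%:C%C :> R[i] by rewrite ltr0C.
have [N _ hN] := h _ e1; exists N => n /hN h'; rewrite -ltcR; exact: h'.
Qed.

Lemma within_comp A B C (f : {ptws A -> R[i]^o} -> {ptws B -> R[i]^o})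
    (g : {ptws B -> R[i]^o} -> {ptws C -> R[i]^o}) :
  (forall s, tracial_states s -> tracial_states (f s)) ->
  {within @tracial_states R A, continuous f} ->
  {within @tracial_states R B, continuous g} ->
  {within @tracial_states R A, continuous (g \o f)}.
Proof.
move=> fS /subspace_continuousP hf /subspace_continuousP hg.
apply/subspace_continuousP => s hs.
have hgs := hg _ (fS s hs).
apply: cvg_trans hgs => U /=; rewrite nbhs_simpl /within /= => hU.
have := hf s hs _ hU; rewrite !nbhs_simpl /within /= => hV.
by apply: filterS hV => s' h hs'; apply: h => //; apply: fS.
Qed.

Lemma convex_comb_tracial A (c : R) (s t : A -> R[i]^o) : 0 <= c <= 1 ->
  tracial_states s -> tracial_states t -> tracial_states (convex_comb c s t).
Proof.
move=> /andP[c0 c1] [sl sp s1 sM] [tl tp t1 tM]; rewrite /convex_comb; split.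
- move=> k x y; rewrite sl tl /GRing.scale /=; ring.
- by move=> x; apply: addr_ge0; apply: mulr_ge0; rewrite ?sp ?tp // ler0c ?subr_ge0.
- by rewrite s1 t1 !mulr1 -rmorphD addrC subrK.
- by move=> x y; rewrite sM tM.
Qed.

Lemma traces_iso_sym A B : traces_iso A B -> traces_iso B A.
Proof.
move=> [f [g [[fS gS] [gf fg] cf cg aff]]]; exists g, f; split => // c t1 t2 c01 h1 h2.
rewrite -{1}(fg t1) // -{1}(fg t2) // -aff ?gf //; do ?exact: gS.
by apply: convex_comb_tracial => //; apply: gS.
Qed.

Lemma traces_iso_trans A B C : traces_iso A B -> traces_iso B C -> traces_iso A C.
Proof.
move=> [f [g [[fS gS] [gf fg] cf cg aff]]] [f' [g' [[fS' gS'] [gf' fg'] cf' cg' aff']]].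
exists (f' \o f), (g \o g'); split.
- by split=> s hs /=; [apply/fS'/fS|apply/gS/gS'].
- split=> s hs /=; first by rewrite gf' ?gf //; apply: fS.
  by rewrite fg ?fg' //; apply: gS'.
- exact: within_comp cf cf'.
- exact: within_comp cg' cg.
- by move=> c s1 s2 c01 h1 h2 /=; rewrite aff // aff' //; apply: fS.
Qed.

Lemma cstar_iso_traces A B : cstar_iso A B -> traces_iso A B.
Proof.
move=> [h hh [k hk kh]].
have hl := star_hom_linear hh; have hM := star_homM hh; have hS := star_hom_star hh.
have kl : linear k by move=> c x y; apply: (can_inj hk); rewrite hl !kh.
have kM : {morph k : x y / x * y} by move=> x y; apply: (can_inj hk); rewrite hM !kh.
have kS : {morph k : x / star x} by move=> x; apply: (can_inj hk); rewrite hS !kh.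
have h1 : h 1 = 1 by have := hM 1 (k 1); rewrite mul1r kh mulr1 => <-.
have k1 : k 1 = 1 by rewrite -h1 hk.
have tr (D E : cstarAlgType R) (m : D -> E) : linear m -> {morph m : x y / x * y} ->
    {morph m : x / star x} -> m 1 = 1 -> forall t : E -> R[i]^o, tracial_states t ->
    tracial_states (t \o m).
  move=> ml mM mS m1 t [tl tp t1 tM]; split.
  - by move=> c x y /=; rewrite ml tl.
  - by move=> x /=; rewrite mM mS.
  - by rewrite /= m1.
  - by move=> x y /=; rewrite !mM tM.
exists (fun s => s \o k), (fun t => t \o h); split.
- by split=> s; apply: tr.
- by split=> s _; apply/funext => x /=; rewrite ?hk ?kh.
- by apply: traces_continuous => s hs b eps e0; exists (k b), eps.
- by apply: traces_continuous => s hs b eps e0; exists (h b), eps.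
- by [].
Qed.

Definition forest_map A B (K IA IB : nat -> finType) (bA : forall n, IA n -> K n)
    (eA : forall n, IA n -> IA n -> A) (bB : forall n, IB n -> K n)
    (eB : forall n, IB n -> IB n -> B) (F : {ptws A -> R[i]^o} -> {ptws B -> R[i]^o}) :=
  forall s, tracial_states s -> tracial_states (F s) /\
    forall n k, F s (blockunit (@bB n) (@eB n) k) = s (blockunit (@bA n) (@eA n) k).

(** A trace is a consistent system of weights on the forest of blocks, so towers
    with the same forest have the same traces. *)
Section SameForest.
Context (A B : cstarAlgType R) (K : nat -> finType) (pa : forall n, K n.+1 -> K n).
Arguments pa : clear implicits.

Context (IA IB : nat -> finType) (bA : forall n, IA n -> K n)
    (eA : forall n, IA n -> IA n -> A) (bB : forall n, IB n -> K n)
    (eB : forall n, IB n -> IB n -> B).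
Arguments bA : clear implicits.
Arguments eA : clear implicits.
Arguments bB : clear implicits.
Arguments eB : clear implicits.
Hypotheses (WA : tower bA eA pa) (WB : tower bB eB pa).

Lemma forest_map_exists : exists F, forest_map bA eA bB eB F.
Proof.
suff h : forall s : {ptws A -> R[i]^o}, exists t : {ptws B -> R[i]^o},
    tracial_states s -> tracial_states t /\
    forall n k, t (blockunit (bB n) (eB n) k) = s (blockunit (bA n) (eA n) k).
  by have [F hF] := choice h; exists F.
move=> s.
have [hs|hs] := pselect (tracial_states s); last by exists (fun=> 0).
have [sl sp s1 sM] := hs.
pose w n k := complex.Re (s (blockunit (bA n) (eA n) k)).
have wE n k : s (blockunit (bA n) (eA n) k) = (w n k)%:C%C /\ 0 <= w n k.
  apply: ge0_real; have E := tw_mu WA n.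
  by rewrite -(blockunit_idem E) -{1}(blockunit_star E); apply: sp.
have [|||t [ht htE]] := @trace_of_weights R B _ _ _ _ _ WB w.
- by move=> n k; case: (wE n k).
- apply: complexI; rewrite rmorph_sum -[RHS]s1 -(blockunit_sum (tw_mu WA 0)) (lin_sum sl).
  by apply: eq_bigr => k _; case: (wE 0%N k).
- move=> n k; apply: complexI; rewrite rmorph_sum; have [<- _] := wE n k.
  by rewrite (tw_pa WA) (lin_sum sl); apply: eq_bigr => l _; case: (wE n.+1 l).
by exists t => _; split=> // n k; rewrite htE; case: (wE n k).
Qed.

(** On an element of a stage F s is a fixed linear combination of values of s, and
    traces are uniformly bounded, so F s x is a uniform limit of continuous
    functions of s. *)
Lemma forest_map_continuous F : forest_map bA eA bB eB F ->
  {within @tracial_states R A, continuous F}.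
Proof.
move=> hF; apply: traces_continuous => s hs x eps e0.
have e4 : 0 < eps / 2 / 2 / 2 by rewrite !divr_gt0.
have [n [y [[a ->] xy]]] := tw_dense WB x e4.
pose Y := \sum_i (a i i / (blocksize (bB n) (bB n i))%:R) *: blockunit (bA n) (eA n) (bB n i).
have FY s' : tracial_states s' -> F s' (lincomb (eB n) a) = s' Y.
  move=> hs'; have [ht hFE] := hF _ hs'; have [tl _ _ tM] := ht; have [sl _ _ _] := hs'.
  rewrite (trace_lincomb (tw_mu WB n)) // (lin_sum sl); apply: eq_bigr => i _.
  by rewrite (linZ sl) hFE -[RHS]/(_ * _) mulrAC mulrA.
exists Y, (eps / 2); split; first by rewrite divr_gt0.
move=> s' hs' hY.
have near t : tracial_states t -> md (F t x - F t (lincomb (eB n) a) : R[i]) <= eps / 2 / 2.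
  move=> ht; have [ht' _] := hF _ ht; have [tl _ _ _] := ht'.
  rewrite -(linB tl); apply: le_trans (tw_trace_bounded ht' _) _; lra.
have n1 := near _ hs; have n2 := near _ hs'; rewrite !FY // in n1 n2.
have t1 := nrm_tri (complete_norm_md R) (s Y) (F s x) (F s' x).
have t2 := nrm_tri (complete_norm_md R) (s' Y) (s Y) (F s' x).
rewrite (nrmB (complete_norm_md R) (F s' x)) in n2.
have : 0 < eps by [].
by move: n1 n2 t1 t2 hY; clear; move: (md _) (md _) => p q; lra.
Qed.

Lemma forest_map_inverse F G : forest_map bA eA bB eB F -> forest_map bB eB bA eA G ->
  forall s, tracial_states s -> G (F s) = s.
Proof.
move=> hF hG s hs; have [hFs FE] := hF _ hs; have [hGF GE] := hG _ hFs.
by apply: (tw_trace_unique WA) => // n k; rewrite GE FE.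
Qed.

Lemma forest_map_affine F : forest_map bA eA bB eB F ->
  forall (c : R) s1 s2, 0 <= c <= 1 -> tracial_states s1 -> tracial_states s2 ->
  F (convex_comb c s1 s2) = convex_comb c (F s1) (F s2).
Proof.
move=> hF c s1 s2 c01 h1 h2.
have [k1 E1] := hF _ h1; have [k2 E2] := hF _ h2.
have [k E] := hF _ (convex_comb_tracial c01 h1 h2).
apply: (tw_trace_unique WB k (convex_comb_tracial c01 k1 k2)) => n j.
by rewrite E /convex_comb E1 E2.
Qed.

End SameForest.

Lemma same_forest_traces_iso A B (K IA IB : nat -> finType) (pa : forall n, K n.+1 -> K n)
    (bA : forall n, IA n -> K n) (eA : forall n, IA n -> IA n -> A)
    (bB : forall n, IB n -> K n) (eB : forall n, IB n -> IB n -> B) :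
  tower bA eA pa -> tower bB eB pa -> traces_iso A B.
Proof.
move=> WA WB; have [F hF] := forest_map_exists WA WB.
have [G hG] := forest_map_exists WB WA.
exists F, G; split.
- by split=> s hs; [case: (hF s hs)|case: (hG s hs)].
- by split; [apply: (forest_map_inverse WA hF hG)|apply: (forest_map_inverse WB hG hF)].

- exact: (forest_map_continuous WB hF).
- exact: (forest_map_continuous WA hG).
- exact: (forest_map_affine WB hF).
Qed.

End TraceIso.

(** * Idempotents near a closed subring *)

Section Idempotents.
Context (R : realType) (B : pzRingType) (N : B -> R).
Hypothesis HN : complete_norm N.
Hypothesis NM : forall x y, N (x * y) <= N x * N y.
Implicit Types x y p q v w : B.

Lemma cvs_additive (u : nat -> B) l (F : B -> B) (C : R) : 0 <= C ->
  (forall x y, F (x - y) = F x - F y) -> (forall x, N (F x) <= C * N x) ->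
  cvs N u l -> (forall n, F (u n) = 0) -> F l = 0.
Proof.
move=> C0 FB Fb cu Fu; apply: (nrm_small_eq HN) => e e0.
have C1 : 0 < C + 1 by rewrite ltr_wpDl.
have [M /(_ M (leqnn M)) hM] := cu _ (divr_gt0 e0 C1).
have -> : F l - 0 = F (l - u M) by rewrite FB Fu.
apply: le_lt_trans (Fb _) _; rewrite (nrmB HN).
have k5 : C * (e / (C + 1)) + e / (C + 1) = e by field; rewrite gt_eqF.
have k6 : C * N (u M - l) <= C * (e / (C + 1)) by rewrite ler_wpM2l // ltW.
have : 0 < e / (C + 1) by rewrite divr_gt0.
lra.
Qed.

Lemma cvs_norm_le (u : nat -> B) l (C : R) : cvs N u l -> (forall n, N (u n) <= C) -> N l <= C.
Proof.
move=> cu uC; apply: le_eps => e e0; have [M /(_ M (leqnn M)) hM] := cu _ e0.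
by have := nrmD HN (l - u M) (u M); rewrite subrK (nrmB HN); have := uC M; lra.
Qed.

(** Solving y^2 = y with y = x + (1 - 2x) v, v commuting with x, amounts to
    v = u + v^2 - 4 u (v - v^2) where u = x^2 - x. *)
Lemma idem_of_fix x v : x * v = v * x ->
  (x * x - x) + v * v - ((x * x - x) * (v - v * v)) *+ 4 = v ->
  let y := x + (1 - x *+ 2) * v in y * y = y.
Proof.
move=> xv; set u := x * x - x => fv; set c := 1 - x *+ 2 => /=.
have xc : x * c = c * x by rewrite /c mulrBl mulrBr mulr1 mul1r mulrnAl mulrnAr.
have vc : v * c = c * v by rewrite /c mulrBl mulrBr mulr1 mul1r mulrnAl mulrnAr xv.
have cc : c * c = 1 + u *+ 4.
  rewrite {1}/c mulrBl mul1r /c mulrBr mulr1 mulrnAl mulrnAr -mulrnA opprB -addrA.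
  by congr (1 + _); rewrite addrCA -opprD -mulrnDr -mulrnBl.
have key : c * c * (v - v * v) = u.
  rewrite cc mulrDl mul1r mulrnAl; set W := (u * _) *+ 4 in fv *.
  by rewrite -[X in X - v * v]fv addrAC subrK addrK.
have xcv : x * (c * v) + x * (c * v) = c * v - c * c * v.
  have ccv : c * (c * v) = c * v - (x * (c * v)) *+ 2 by rewrite {1}/c mulrBl mul1r mulrnAl.
  by rewrite -(mulrA c) ccv opprB addrCA subrr addr0 mulr2n.
rewrite mulrDl !mulrDr.
have -> : c * v * x = x * (c * v) by rewrite -mulrA -xv mulrA -xc -mulrA.
have -> : c * v * (c * v) = c * c * (v * v) by rewrite -mulrA (mulrA v) vc -!mulrA.
rewrite addrA -(addrA (x * x)) xcv.
have -> : x * x = u + x by rewrite subrK.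
have e : c * c * v - c * c * (v * v) = u by rewrite -mulrBr.
rewrite -{1}e; move: (c * c * v) (c * c * (v * v)) (c * v) => a b d.
by rewrite [a - b + x]addrC addrACA [a - b - a]addrAC subrr sub0r subrK.
Qed.

(** An element close to an idempotent e is close to an idempotent of the closed
    subring it lives in: u = x^2 - x is small, and the equation above is solved by
    contraction on the ball of radius 2 del. *)
Lemma idem_near (S : B -> Prop) x e : (forall w w', S w -> S w' -> S (w - w')) ->
  (forall w w', S w -> S w' -> S (w * w')) ->
  (forall u l, (forall n, S (u n)) -> cvs N u l -> S l) ->
  (exists2 K : R, 2 * N e + 3 <= K & K * K * N (x - e) <= 16^-1) ->
  e * e = e -> S x ->
  exists y, [/\ S y, y * y = y & N (y - e) < 1].
Proof.
move=> SB SM Scl [K K3 xe] ee Sx.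
have S0 : S 0 by rewrite -(subrr x); apply: SB.
have SN w : S w -> S (- w) by move=> Sw; rewrite -sub0r; apply: SB.
have SD w w' : S w -> S w' -> S (w + w').
  by move=> Sw Sw'; rewrite -[w']opprK; apply: SB => //; apply: SN.
have Smul k w : S w -> S (w *+ k) by move=> Sw; elim: k => [|k IH]; rewrite ?mulr0n // mulrS; apply: SD.
have Nmul k w : N (w *+ k) <= k%:R * N w.
  elim: k => [|k IH]; first by rewrite mulr0n (nrm0 HN) mul0r.
  by rewrite mulrS mulrSr mulrDl mul1r addrC; apply: le_trans (nrmD HN _ _) _; rewrite lerD2r.
have e0 := nrm_ge0 HN e; have xe0 := nrm_ge0 HN (x - e).
have K0 : 0 < K by lra.
(* K dominates 2|e| + eta + 1, so |u| <= eta K = del, and also 1 + 2|x|, so the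
   correction (1 - 2x) v, where |v| <= 2 del, has norm at most 2 del K = 1/8. *)
pose eta := (16 * (K * K))^-1; pose del := (16 * K)^-1.
have KK : 0 < 16 * (K * K) by rewrite !mulr_gt0.
have xeta : N (x - e) <= eta by rewrite -(ler_pM2l KK) mulfV ?gt_eqF // -mulrA; move: xe; set t := K * K * _; lra.
have eta0 : 0 < eta by rewrite invr_gt0.
have del0 : 0 < del by rewrite invr_gt0 mulr_gt0.
have etaK : eta * K = del by rewrite /eta /del; field; rewrite gt_eqF.
have delK : del * K = 16^-1 by rewrite /del; field; rewrite gt_eqF.
have dels : del <= 16^-1 / 3.
  have : del * 3 <= del * K by rewrite ler_wpM2l //; lra.
  by rewrite delK; lra.
have etas : eta <= del by rewrite -etaK -[X in X <= _]mulr1 ler_wpM2l //; lra.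
pose u := x * x - x.
have Su : S u by apply: SB => //; apply: SM.
have Nx : N x <= N e + eta by have := nrmD HN (x - e) e; rewrite subrK; lra.
have Nu : N u <= del.
  have -> : u = (x - e) * x + e * (x - e) - (x - e).
    by rewrite /u mulrBl mulrBr ee addrA subrK opprB addrA subrK.
  have := nrmD HN ((x - e) * x + e * (x - e)) (- (x - e)); rewrite (nrmN HN).
  have := nrmD HN ((x - e) * x) (e * (x - e)).
  have := NM (x - e) x; have := NM e (x - e).
  have : N (x - e) * N x <= eta * (N e + eta) by rewrite ler_pM ?(nrm_ge0 HN).
  have : N e * N (x - e) <= N e * eta by rewrite ler_wpM2l.
  have : eta * (2 * N e + eta + 1) <= eta * K by rewrite ler_wpM2l ?ltW //; lra.
  rewrite etaK; lra.
pose Psi v := u + v * v - (u * (v - v * v)) *+ 4.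
pose P v := [/\ S v, N v <= 2 * del & x * v = v * x].
have ux : x * u = u * x by rewrite /u mulrBr mulrBl mulrA.
have dd : del * del <= del / 48.
  have : del * del <= del * (16^-1 / 3) by rewrite ler_wpM2l // ltW.
  lra.
have Nvv v : N v <= 2 * del -> N (v * v) <= 4 * (del * del).
  move=> Nv; have := NM v v.
  have : N v * N v <= 2 * del * (2 * del) by rewrite ler_pM ?(nrm_ge0 HN).
  lra.
have [||us l hP cl|v [Sv Nv cv]|v w [Sv Nv cv] [Sw Nw cw]||v [Sv Nv cv] fv] :=
  @banach_fixpoint R B N HN P Psi (9 / 16) 0.
- lra.
- lra.
- split.
  + by apply: Scl cl => n; case: (hP n).
  + by apply: cvs_norm_le cl _ => n; case: (hP n).
  + apply/eqP; rewrite -subr_eq0; apply/eqP.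
    apply: (@cvs_additive us l (fun v => x * v - v * x) (2 * N x)) => //.
    * by rewrite mulr_ge0 ?(nrm_ge0 HN).
    * move=> v w; rewrite mulrBr mulrBl !opprB addrACA [in RHS]addrACA.
      by congr (_ + _); rewrite addrC.
    * move=> v; apply: le_trans (nrmD HN _ _) _; rewrite (nrmN HN).
      have := NM x v; have := NM v x; lra.
    * by move=> n; case: (hP n) => _ _ ->; rewrite subrr.
- have Svv : S (v * v) by apply: SM.
  split.
  + by apply: (SB); [apply: SD|apply: Smul; apply: (SM) => //; apply: SB].
  + have h1 := nrmD HN (u + v * v) (- ((u * (v - v * v)) *+ 4)); rewrite (nrmN HN) in h1.
    have h2 := nrmD HN u (v * v); have h3 := Nmul 4%N (u * (v - v * v)).
    have h4 := NM u (v - v * v); have h5 := nrmD HN v (- (v * v)); rewrite (nrmN HN) in h5.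
    have h6 := Nvv _ Nv.
    have h7 : N u * N (v - v * v) <= del * (3 * del).
      by rewrite ler_pM ?(nrm_ge0 HN) //; lra.
    rewrite /Psi; move: h1 h2 h3 h4 h5 h6 h7 dd Nu; set q := del * del.
    rewrite [del * (3 * del)]mulrCA -/q; lra.
  + have cvv : GRing.comm x (v * v) by apply: commrM.
    apply: commrB; first exact: commrD.
    by apply: commrMn; apply: commrM => //; apply: commrB.
- have -> : Psi v - Psi w = (v * v - w * w) - (u * ((v - w) - (v * v - w * w))) *+ 4.
    by rewrite /Psi subr_subACA opprD addrACA subrr add0r -mulrnBl -mulrBr [v - _ - _]subr_subACA.
  set d := N (v - w).
  have d0 : 0 <= d by apply: nrm_ge0.
  have h1 : N (v * v - w * w) <= 4 * (del * d).
    have -> : v * v - w * w = v * (v - w) + (v - w) * w.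
      by rewrite mulrBr mulrBl addrA subrK.
    have := nrmD HN (v * (v - w)) ((v - w) * w); have := NM v (v - w); have := NM (v - w) w.
    have : N v * d <= 2 * del * d by rewrite ler_wpM2r.
    have : d * N w <= d * (2 * del) by rewrite ler_wpM2l.
    rewrite -/d; lra.
  have dd' : del * d <= d / 48.
    by rewrite mulrC ler_wpM2l //; lra.
  have h2 : N (v - w - (v * v - w * w)) <= 2 * d.
    have := nrmD HN (v - w) (- (v * v - w * w)); rewrite (nrmN HN) -/d; lra.
  have h3 := NM u (v - w - (v * v - w * w)).
  have h4 : N u * N (v - w - (v * v - w * w)) <= del * (2 * d).
    by rewrite ler_pM ?(nrm_ge0 HN).
  have h5 := Nmul 4%N (u * (v - w - (v * v - w * w))).
  have h6 := nrmD HN (v * v - w * w) (- ((u * (v - w - (v * v - w * w))) *+ 4)).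
  rewrite (nrmN HN) in h6; lra.
- by split; rewrite ?mulr0 ?mul0r ?(nrm0 HN) //; lra.
exists (x + (1 - x *+ 2) * v); split.
- rewrite mulrBl mul1r mulrnAl; apply: SD => //; apply: SB => //; apply: Smul; exact: SM.
- exact: idem_of_fix.
- have -> : x + (1 - x *+ 2) * v - e = (x - e) + (v - (x * v) *+ 2).
    by rewrite mulrBl mul1r mulrnAl addrAC.
  have h1 := nrmD HN (x - e) (v - (x * v) *+ 2).
  have h2 := nrmD HN v (- ((x * v) *+ 2)); rewrite (nrmN HN) in h2.
  have h3 := Nmul 2%N (x * v); have h4 := NM x v.
  have h5 : N x * N v <= (N e + eta) * (2 * del) by rewrite ler_pM ?(nrm_ge0 HN).
  have h6 : del * (4 * N e + 6) <= del * (2 * K) by rewrite ler_wpM2l ?(ltW del0) //; lra.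
  have h7 : eta * del <= del / 48 by rewrite mulrC ler_wpM2l ?(ltW del0) //; lra.
  have e7 : del * (2 * K) = 8^-1 by rewrite mulrCA delK; lra.
  lra.
Qed.

(** Close idempotents have the same trace.  For D = p - q the square c = D^2
    commutes with p and q, and p c = p - p q p while q c = q - q p q; hence the
    trace of D^(2k+1) = D c^k does not depend on k, and it tends to 0 when D has
    norm less than 1. *)
Lemma idem_trace_eq (t : B -> R[i]) (C : R) p q : 0 <= C ->
  (forall x y, t (x - y) = t x - t y) -> (forall x y, t (x * y) = t (y * x)) ->
  (forall x, md (t x) <= C * N x) ->
  p * p = p -> q * q = q -> N (p - q) < 1 -> t p = t q.
Proof.
move=> C0 tB tM tb pp qq pq.
have [c ccE] : exists c, c = (p - q) * (p - q) by eexists.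
have cE : c = p - p * q - (q * p - q).
  by rewrite ccE mulrBl !mulrBr pp qq.
have pc : p * c = p - p * q * p by rewrite cE !mulrBr !mulrA pp opprB addrA subrK.
have cp : c * p = p - p * q * p by rewrite cE !mulrBl -!mulrA pp subrr subr0.
have qc : q * c = q - q * p * q by rewrite cE !mulrBr !mulrA qq opprB addrC addrA subrK.
have cq : c * q = q - q * p * q by rewrite cE !mulrBl -!mulrA qq subrr sub0r opprB.
have pck k : p * c ^+ k = c ^+ k * p by exact: (commrX k (etrans pc (esym cp))).
have qck k : q * c ^+ k = c ^+ k * q by exact: (commrX k (etrans qc (esym cq))).
have step k : t (p * c ^+ k) - t (q * c ^+ k) = t p - t q.
  elim: k => [|k IH]; first by rewrite expr0 !mulr1.
  have e1 : t (p * q * p * c ^+ k) = t (p * q * c ^+ k).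
    by rewrite -mulrA pck mulrA tM !mulrA pp.
  have e2 : t (q * p * q * c ^+ k) = t (p * q * c ^+ k).
    by rewrite -mulrA qck mulrA tM !mulrA qq -mulrA tM -mulrA -qck mulrA.
  by rewrite !exprS !mulrA pc qc !mulrBl !tB e1 e2 subr_subACA subrr subr0.
have r0 : 0 <= N (p - q) by apply: nrm_ge0.
have rr : N (p - q) * N (p - q) < 1.
  by apply: le_lt_trans (pq); rewrite ler_piMr // ltW.
have Nc k : N ((p - q) * c ^+ k) <= (N (p - q) * N (p - q)) ^+ k * N (p - q).
  elim: k => [|k IH]; first by rewrite !expr0 mulr1 mul1r.
  rewrite exprSr mulrA exprSr; apply: le_trans (NM _ _) _.
  have : N ((p - q) * c ^+ k) * N c <=
      (N (p - q) * N (p - q)) ^+ k * N (p - q) * (N (p - q) * N (p - q)).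
    by rewrite ler_pM ?(nrm_ge0 HN) // ccE; apply: NM.
  by move=> h; apply: le_trans h _; rewrite [X in _ <= X]mulrAC.
apply: (nrm_small_eq (complete_norm_md R)) => eps e0.
have [M /(_ M (leqnn M)) hM] := pow_small (C * N (p - q)) (mulr_ge0 r0 r0) rr e0.
rewrite -(step M) -tB -mulrBl; apply: le_lt_trans (tb _) _; apply: le_lt_trans hM.
by rewrite mulrCA ler_wpM2l.
Qed.

End Idempotents.

(** * Divisibility of the stages of the universal UHF algebra *)

Lemma trace_idempotent (F : fieldType) n (Y : 'M[F]_n) : Y *m Y = Y -> \tr Y = (\rank Y)%:R.
Proof.
move=> YY; have [C hC] := row_fullP (col_base_full Y); have [D hD] := row_freeP (row_base_free Y).
have e : row_base Y *m col_base Y = 1%:M.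
  have : col_base Y *m row_base Y *m (col_base Y *m row_base Y) = col_base Y *m row_base Y.
    by rewrite !mulmx_base.
  move: hC hD; move: (col_base Y) (row_base Y) C D => P S C D hC hD PS.
  have := congr1 (fun Z => C *m Z *m D) PS.
  by rewrite /= !mulmxA hC mul1mx -!mulmxA hD mulmx1.
by rewrite -[in LHS](mulmx_base Y) mxtrace_mulC e mxtrace1.
Qed.

Section FiniteClosed.
Context (R : realType).

(** A finite-dimensional subalgebra is closed: the corners e i i x e j j of a
    convergent sequence converge, and so do their coefficients. *)
Lemma mxspan_closed (T : cstarAlgType R) (I K : finType) (b : I -> K) (e : I -> I -> T)
    (u : nat -> T) l : mxunits b e -> (forall n, mxspan e (u n)) -> cvs (@cnorm R T) u l ->
  mxspan e l.
Proof.
move=> E su cu; have [a ha] := choice su.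
have HN := complete_norm_cnorm T.
rewrite -[l]mulr1 -[l]mul1r -(mu_sum E) mulr_suml mulr_suml; apply: mxspan_sum => i _.
rewrite mulr_sumr; apply: mxspan_sum => j _.
have small (x : T) : cnorm (e i i * x * e j j) <= cnorm x.
  have n1 := cnorm_mu_le1 E i i; have n2 := cnorm_mu_le1 E j j.
  apply: le_trans (cnormM _ _) _; apply: le_trans (ler_piMr (cnorm_ge0 _) n2) _.
  by apply: le_trans (cnormM _ _) _; apply: ler_piMl (cnorm_ge0 _) n1.
have conv : cvs (@cnorm R T) (fun n => e i i * u n * e j j) (e i i * l * e j j).
  move=> eps /cu [M hM]; exists M => n /hM; apply: le_lt_trans.
  by rewrite -mulrBl -mulrBr.
have [bij|bij] := eqVneq (b i) (b j); last first.
  have z n : e i i * u n * e j j = 0.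
    rewrite ha /lincomb mulr_sumr mulr_suml big1 // => k _.
    rewrite mulr_sumr mulr_suml big1 // => m _; rewrite -scalerAr -scalerAl.
    have [<-|ik] := eqVneq i k; last by rewrite (mu_mul0 E) // mul0r scaler0.
    have [->|mj] := eqVneq m j; first by rewrite (mu_off E bij) mulr0 mul0r scaler0.
    by rewrite -mulrA (mu_mul0 E _ _ mj) mulr0 scaler0.
  suff -> : e i i * l * e j j = 0 by apply: mxspan0.
  apply: (nrm_small_eq HN) => eps /conv [M /(_ M (leqnn M))].
  by rewrite z sub0r cnormN subr0.
have eE n : e i i * u n * e j j = a n i j *: e i j by rewrite ha (mu_corner E).
have mdE c d : md (c - d) = cnorm (c *: e i j - d *: e i j).
  by rewrite -scalerBl cnormZr (cnorm_mu E bij) mulr1.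
have cau : cauchy_seq (fun c : R[i] => md c) (fun n => a n i j).
  move=> eps e0; have [M hM] := conv _ (half_pos e0); exists M => m n /hM h1 /hM h2.
  rewrite mdE -!eE; apply: le_lt_trans (nrm_tri HN (e i i * l * e j j) _ _) _.
  by rewrite (nrmB HN (e i i * l * e j j)); lra.
have [c hc] := nrm_complete (complete_norm_md R) cau.
suff -> : e i i * l * e j j = c *: e i j by apply: mxspanZ; apply: mxspan_unit.
apply: (nrm_small_eq HN) => eps e0.
have [M1 h1] := conv _ (half_pos e0); have [M2 h2] := hc _ (half_pos e0).
have k1 := h1 _ (leq_maxl M1 M2); have k2 := h2 _ (leq_maxr M1 M2).
rewrite mdE -eE in k2.
apply: le_lt_trans (nrm_tri HN (e i i * u (maxn M1 M2) * e j j) _ _) _.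
by rewrite (nrmB HN (e i i * l * e j j)); lra.
Qed.

Section MatrixNorm.
Context (Q : cstarAlgType R) (n : nat).
Implicit Types x y : 'M[Q]_n.

(** A Banach algebra norm on matrices over a C*-algebra. *)
Definition mxnorm (x : 'M[Q]_n) : R := \sum_i \sum_j cnorm (x i j).

Lemma mxnorm_entry x i j : cnorm (x i j) <= mxnorm x.
Proof.
rewrite /mxnorm (bigD1 i) //= (bigD1 j) //= -addrA lerDl addr_ge0 //.
  by apply: sumr_ge0 => k _; apply: cnorm_ge0.
by apply: sumr_ge0 => k _; apply: sumr_ge0 => l _; apply: cnorm_ge0.
Qed.

Lemma mxnorm_small (u : 'I_n -> 'I_n -> nat -> R) :
  (forall i j (eps : R), 0 < eps -> exists M, forall m, (M <= m)%N -> u i j m < eps) ->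
  forall eps : R, 0 < eps -> exists M, forall m, (M <= m)%N -> \sum_i \sum_j u i j m < eps.
Proof.
move=> h eps e0.
have d0 : 0 < eps / (n * n).+1%:R by rewrite divr_gt0 ?ltr0n.
have [M hM] := choice (fun p : 'I_n * 'I_n => h p.1 p.2 _ d0).
exists (\max_p M p)%N => m hm.
apply: (@le_lt_trans _ _ (\sum_(i < n) \sum_(j < n) eps / (n * n).+1%:R)).
  apply: ler_sum => i _; apply: ler_sum => j _; apply: ltW; apply: (hM (i, j)).
  by apply: leq_trans hm; apply: (leq_bigmax (i, j)).
rewrite !sumr_const !card_ord -mulrnA -[X in X < _]mulr_natr mulrAC ltr_pdivrMr ?ltr0n //.
by rewrite ltr_pM2l // ltr_nat.
Qed.

Lemma complete_norm_mx : complete_norm mxnorm.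
Proof.
have HN := complete_norm_cnorm Q.
split.
- by rewrite /mxnorm big1 // => i _; rewrite big1 // => j _; rewrite mxE cnorm0.
- move=> x x0; apply/matrixP => i j; rewrite mxE; apply: cnorm_eq0.
  by apply/eqP; rewrite eq_le cnorm_ge0 andbT -x0 mxnorm_entry.
- move=> x y; rewrite /mxnorm -big_split; apply: ler_sum => i _ /=.
  by rewrite -big_split; apply: ler_sum => j _ /=; rewrite mxE cnormD.
- by move=> x; apply: eq_bigr => i _; apply: eq_bigr => j _; rewrite mxE cnormN.
- move=> u cu.
  have h i j : exists l, cvs (@cnorm R Q) (fun m => u m i j) l.
    apply: (nrm_complete HN) => eps /cu [M hM]; exists M => m m' k k'.
    by apply: le_lt_trans (hM _ _ k k'); have := mxnorm_entry (u m - u m') i j; rewrite !mxE.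
  have [l hl] := choice (fun p : 'I_n * 'I_n => h p.1 p.2).
  exists (\matrix_(i, j) l (i, j)) => eps e0.
  have [||M hM] := @mxnorm_small (fun i j m => cnorm (u m i j - l (i, j))) _ eps.
  + by move=> i j; apply: (hl (i, j)).
  + exact: e0.
  exists M => m /hM; congr (_ < _).
  by apply: eq_bigr => i _; apply: eq_bigr => j _; rewrite !mxE.
Qed.

Lemma mxnormM x y : mxnorm (x * y) <= mxnorm x * mxnorm y.
Proof.
have HN := complete_norm_cnorm Q.
rewrite /mxnorm mulr_suml; apply: ler_sum => i _.
apply: (@le_trans _ _ (\sum_j \sum_k cnorm (x i k) * cnorm (y k j))).
  apply: ler_sum => j _; rewrite mxE; apply: le_trans (nrm_sum HN _ _) _.
  by apply: ler_sum => k _; apply: cnormM.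
rewrite exchange_big /= mulr_suml; apply: ler_sum => k _.
rewrite -mulr_sumr ler_wpM2l ?cnorm_ge0 //.
rewrite [X in _ <= X](bigD1 k) //= lerDl; apply: sumr_ge0 => l _.
by apply: sumr_ge0 => m _; apply: cnorm_ge0.
Qed.

End MatrixNorm.
End FiniteClosed.

Section UniversalDivisible.
Context (R : realType) (Q : cstarAlgType R) (J L : nat -> finType)
  (c : forall n, J n -> L n) (u : forall n, J n -> J n -> Q) (qa : forall n, L n.+1 -> L n).
Arguments c : clear implicits.
Arguments u : clear implicits.
Arguments qa : clear implicits.
Hypothesis W : tower c u qa.
Hypothesis L1 : forall n (k l : L n), k = l.

Lemma uhf_block_eq n i j : c n i = c n j. Proof. exact: L1. Qed.

Lemma uhf_card_gt0 n : (0 < #|J n|)%N.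
Proof.
apply/card_gt0P; apply/not_existsP => h.
have := oner_neq0 Q; rewrite -(mu_sum (tw_mu W n)) big1 ?eqxx // => j _; by case: (h j).
Qed.

Lemma uhf_blockunit n k : blockunit (c n) (u n) k = 1.
Proof.
rewrite -(mu_sum (tw_mu W n)); apply: eq_bigl => i; apply/eqP; exact: L1.
Qed.

Lemma uhf_blocksize n k : blocksize (c n) k = #|J n|.
Proof. by apply: eq_card => i; rewrite !inE; apply/eqP; exact: L1. Qed.

Lemma uhf_trace_exists : exists t : Q -> R[i]^o, tracial_states t.
Proof.
have cL n : \sum_(k : L n) (1 : R) = 1.
  have /card_gt0P [j _] := uhf_card_gt0 n.
  rewrite (bigD1 (c n j)) //= big1 ?addr0 // => k.
  by rewrite (L1 k (c n j)) eqxx.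
have [|||t [ht _]] := @trace_of_weights R Q _ _ _ _ _ W (fun _ _ => 1).
- by move=> n k; apply: ler01.
- exact: cL.
- move=> n k; apply: etrans (esym (cL n.+1)) _; apply: eq_bigl => l; apply/esym/eqP; exact: L1.
by exists t.
Qed.

Context (t : Q -> R[i]^o).
Hypothesis ht : tracial_states t.

Lemma uhf_trace_lincomb n a : t (lincomb (u n) a) = (\sum_i a i i) / #|J n|%:R.
Proof.
have [tl _ t1 tM] := ht; rewrite (trace_lincomb (tw_mu W n)) // mulr_suml.
by apply: eq_bigr => i _; rewrite uhf_blockunit uhf_blocksize t1 mul1r.
Qed.

Definition mxtr n (x : 'M[Q]_n) : R[i] := \sum_i t (x i i).

Lemma mxtrB n (x y : 'M[Q]_n) : mxtr (x - y) = mxtr x - mxtr y.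
Proof.
have [tl _ _ _] := ht; rewrite /mxtr -sumrB; apply: eq_bigr => i _.
by rewrite !mxE (linB tl).
Qed.

Lemma mxtrM m n (x : 'M[Q]_(m, n)) (y : 'M[Q]_(n, m)) : mxtr (x *m y) = mxtr (y *m x).
Proof.
have [tl _ _ tM] := ht; rewrite /mxtr.
transitivity (\sum_i \sum_j (t (x i j * y j i) : R[i])).
  by apply: eq_bigr => i _; rewrite mxE (lin_sum tl).
rewrite exchange_big; apply: eq_bigr => j _; rewrite mxE (lin_sum tl).
by apply: eq_bigr => i _; rewrite tM.
Qed.

Lemma mxtr_bound n (x : 'M[Q]_n) : md (mxtr x) <= 2 * mxnorm x.
Proof.
apply: le_trans (md_sum _ _) _; rewrite /mxnorm mulr_sumr; apply: ler_sum => i _.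
apply: le_trans (tw_trace_bounded ht _) _; rewrite ler_wpM2l // (bigD1 i) //= lerDl.
by apply: sumr_ge0 => j _; apply: cnorm_ge0.
Qed.

Lemma mxtr_dsum m n (x : 'M[Q]_m) (y : 'M[Q]_n) : mxtr (dsum_mx x y) = mxtr x + mxtr y.
Proof.
rewrite /mxtr /dsum_mx big_split_ord /=; congr (_ + _); apply: eq_bigr => i _.
  by rewrite block_mxEul.
by rewrite block_mxEdr.
Qed.

Lemma stably_equiv_mxtr m n (x : 'M[Q]_m) (y : 'M[Q]_n) : stably_equiv x y -> mxtr x = mxtr y.
Proof.
move=> [k [g [_ [v [h1 h2]]]]].
have : mxtr (dsum_mx x g) = mxtr (dsum_mx y g) by rewrite -h1 -h2 mxtrM.
by rewrite !mxtr_dsum => /addIr.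
Qed.

Lemma is_proj_dsum m n (x : 'M[Q]_m) (y : 'M[Q]_n) :
  is_proj x -> is_proj y -> is_proj (dsum_mx x y).
Proof.
move=> [sx px] [sy py]; split; last first.
  by rewrite /dsum_mx mulmx_block !mulmx0 !mul0mx !addr0 !add0r px py.
rewrite -[in RHS]sx -[in RHS]sy /star_mx /dsum_mx tr_block_mx map_block_mx.
by congr block_mx; apply/matrixP => i j; rewrite !mxE star0.
Qed.

(** Over a stage, which is a full matrix algebra, an idempotent matrix becomes an
    idempotent complex matrix, whose trace is its rank. *)
Lemma mxtr_idem_stage m n (x : 'M[Q]_n) : (forall i j, mxspan (u m) (x i j)) ->
  x * x = x -> exists r : nat, mxtr x = r%:R / #|J m|%:R.
Proof.
move=> sx xx; have E := tw_mu W m.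
have [a ha] := choice (fun p : 'I_n * 'I_n => sx p.1 p.2).
pose I : finType := ('I_n * J m)%type.
pose Y : 'M[R[i]]_#|I| := \matrix_(s, s')
  a ((enum_val s).1, (enum_val s').1) (enum_val s).2 (enum_val s').2.
have coef (a1 a2 : J m -> J m -> R[i]) : lincomb (u m) a1 = lincomb (u m) a2 ->
    forall s s', a1 s s' = a2 s s'.
  move=> h s s'; apply/eqP; rewrite -subr_eq0; apply/eqP/md_eq0/eqP.
  have := lincombD (u m) a1 (fun k l => -1 * a2 k l).
  rewrite -lincombZ scaleN1r h subrr => e0.
  have := coef_bound E (fun k l => a1 k l + -1 * a2 k l) (uhf_block_eq s s').
  by rewrite -e0 cnorm0 mulN1r eq_le md_ge0 andbT.
have YY : Y *m Y = Y.
  apply/matrixP => s s'; rewrite !mxE.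
  set i := (enum_val s).1; set j := (enum_val s').1.
  have := congr1 (fun z : 'M[Q]_n => z i j) xx; rewrite mxE => h.
  have h' : lincomb (u m) (fun k l => \sum_p mxprod (c m) (a (i, p)) (a (p, j)) k l) =
      lincomb (u m) (a (i, j)).
    rewrite -(ha (i, j)) -[RHS]h /lincomb.
    transitivity (\sum_p lincomb (u m) (mxprod (c m) (a (i, p)) (a (p, j)))); last first.
      by apply: eq_bigr => p _; rewrite (ha (i, p)) (ha (p, j)) (lincombM E).
    rewrite [RHS]exchange_big /=; apply: eq_bigr => k _; rewrite [RHS]exchange_big /=.
    by apply: eq_bigr => l _; rewrite scaler_suml.
  have := coef _ _ h' (enum_val s).2 (enum_val s').2 => <-.
  rewrite (reindex (@enum_rank I)) /=; last first.
    by exists (@enum_val I predT) => y _; [apply: enum_rankK|apply: enum_valK].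
  transitivity (\sum_(y : I) a (i, y.1) (enum_val s).2 y.2 * a (y.1, j) y.2 (enum_val s').2).
    by apply: eq_bigr => y _; rewrite !mxE !enum_rankK.
  rewrite -(pair_bigA _ (fun p q => a (i, p) (enum_val s).2 q * a (p, j) q (enum_val s').2)) /=.
  by apply: eq_bigr => p _; apply: eq_bigl => q; apply/esym/eqP; apply: L1.
exists (\rank Y); rewrite -(trace_idempotent YY) /mxtrace.
rewrite (reindex (@enum_rank I)) /=; last first.
  by exists (@enum_val I predT) => y _; [apply: enum_rankK|apply: enum_valK].
rewrite (eq_bigr (fun y : I => a (y.1, y.1) y.2 y.2)); last by move=> y _; rewrite mxE !enum_rankK.
rewrite -(pair_bigA _ (fun p q => a (p, p) q q)) /= mulr_suml; apply: eq_bigr => i _.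
by rewrite (ha (i, i)) uhf_trace_lincomb.
Qed.

(** An idempotent matrix over Q is close to an idempotent matrix over some stage,
    which has the same trace. *)
Lemma mxtr_idem_rational m0 n (e : 'M[Q]_n) : e * e = e ->
  exists m (r : nat), (m0 <= m)%N /\ mxtr e = r%:R / #|J m|%:R.
Proof.
move=> ee; pose K := 2 * mxnorm e + 3.
have HN := complete_norm_mx Q n.
have K0 : 0 < K by have := nrm_ge0 HN e; rewrite /K; lra.
pose eta := (16 * (K * K))^-1; have eta0 : 0 < eta by rewrite invr_gt0 !mulr_gt0.
pose d := eta / (n * n).+1%:R; have d0 : 0 < d by rewrite divr_gt0 ?ltr0n.
have [N hN] := choice (fun p : 'I_n * 'I_n => tw_dense W (e p.1 p.2) d0).
have [X hX] := choice hN.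
pose m := maxn m0 (\max_p N p).
have Np p : (N p <= m)%N by rewrite leq_max (leq_bigmax p) orbT.
pose x : 'M[Q]_n := \matrix_(i, j) X (i, j).
have sx i j : mxspan (u m) (x i j).
  by rewrite mxE; apply: (tw_incn W (Np (i, j))); case: (hX (i, j)).
have xe : mxnorm (x - e) <= eta.
  apply: (@le_trans _ _ (\sum_(i < n) \sum_(j < n) d)).
    apply: ler_sum => i _; apply: ler_sum => j _; rewrite !mxE -cnormN opprB.
    by case: (hX (i, j)) => _ /ltW.
  rewrite !sumr_const !card_ord -mulrnA -[X in X <= _]mulr_natr /d mulrAC ler_pdivrMr ?ltr0n //.
  by rewrite ler_pM2l // ler_nat.
pose S (y : 'M[Q]_n) := forall i j, mxspan (u m) (y i j).
have [||||y [Sy yy ye]] := @idem_near R 'M[Q]_n (@mxnorm R Q n) HN (@mxnormM R Q n) S x e _ _ _ _ ee sx.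
- by move=> w w' Sw Sw' i j; rewrite !mxE; apply: mxspanD => //; apply: mxspanN.
- move=> w w' Sw Sw' i j; rewrite mxE; apply: mxspan_sum => k _.
  by apply: (mxspanM (tw_mu W m)).
- move=> us l Su cu i j; apply: (mxspan_closed (tw_mu W m) (u := fun k => us k i j)).
    by move=> k; apply: Su.
  move=> eps /cu [M hM]; exists M => k /hM; apply: le_lt_trans.
  by have := mxnorm_entry (us k - l) i j; rewrite !mxE.
- exists K; first exact: lexx.
  have : K * K * mxnorm (x - e) <= K * K * eta by rewrite ler_wpM2l // mulr_ge0 // ltW.
  rewrite /eta; suff -> : K * K * (16 * (K * K))^-1 = 16^-1 by [].
  by field; rewrite gt_eqF.
have [r hr] := mxtr_idem_stage Sy yy.
exists m, r; split; first by rewrite leq_maxl.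
rewrite -hr; apply: esym; apply: (idem_trace_eq HN (@mxnormM R Q n) (C := 2)) => //.
- exact: mxtrB.
- exact: mxtrM.
- exact: mxtr_bound.
Qed.

End UniversalDivisible.

(** A projection e with class 1/N in K_0: the class of the sum of N copies of e is
    that of 1, so e has trace 1/N.  But its trace is a multiple of the inverse of
    the size of some stage, hence N divides that size. *)
Lemma universal_divisible (R : realType) (Q : cstarAlgType R) (J L : nat -> finType)
    (c : forall n, J n -> L n) (u : forall n, J n -> J n -> Q) (qa : forall n, L n.+1 -> L n) :
  tower c u qa -> (forall n (k l : L n), k = l) ->
  K0_isomorphic Q [set x : rat | 0 <= x] 1 ->
  forall N m0, (0 < N)%N -> exists m, (m0 <= m)%N /\ (N %| #|J m|)%N.
Proof.
move=> W L1 [d [dD dE _ dP d1]] N m0 N0.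
have [t ht] := uhf_trace_exists W L1.
have [n [e [pe de]]] : exists n (e : 'M[Q]_n), is_proj e /\ d _ e = N%:R^-1.
  by apply/dP => /=; rewrite invr_ge0 ler0n.
have [k [E [pE dEN tE]]] : exists k (E : 'M[Q]_k),
    [/\ is_proj E, d _ E = N%:R / N%:R & mxtr t E = N%:R * mxtr t e].
  rewrite -{1}(prednK N0) -{3}(prednK N0); move: (N.-1) => M.
  elim: M => [|M [k [E [pE dE' tE]]]]; first by exists n, e; rewrite !mul1r.
  exists (k + n)%N, (dsum_mx E e); split; first exact: is_proj_dsum.
    by rewrite dD // dE' de [in RHS]mulrSr mulrDl mul1r.
  by rewrite mxtr_dsum tE [in RHS]mulrSr mulrDl mul1r.
have p1 : is_proj (1%:M : 'M[Q]_1).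
  split; last by rewrite mulmx1.
  by apply/matrixP => i j; rewrite !mxE !ord1 !eqxx star1.
have t1 : mxtr t (1%:M : 'M[Q]_1) = 1.
  by have [_ _ t1 _] := ht; rewrite /mxtr big_ord1 mxE eqxx.
have Nn0 : N%:R != 0 :> rat by rewrite pnatr_eq0 -lt0n.
have sE : stably_equiv E (1%:M : 'M[Q]_1).
  by apply/dE => //; rewrite dEN d1 divff.
have := stably_equiv_mxtr ht sE; rewrite tE t1 => Nt.
have [m [r [m0m hr]]] := mxtr_idem_rational W L1 ht m0 (proj2 pe).
exists m; split=> //; apply/dvdnP; exists r.
have J0 : #|J m|%:R != 0 :> R[i] by rewrite pnatr_eq0 -lt0n (uhf_card_gt0 W).
have := congr1 (fun w => w * #|J m|%:R) Nt.
by rewrite hr mulrA -natrM divfK // mul1r => /eqP; rewrite eqr_nat mulnC => /eqP.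
Qed.

(** * Matrix units in corners *)

Section CornerUnits.
Context (R : realType) (T : cstarAlgType R).
Implicit Types (A D M : finType).

(** A full matrix algebra in the corner cut by the projection z. *)
Record cunits D (z : T) (w : D -> D -> T) : Prop := CUnits {
  cu_star : forall a b, star (w a b) = w b a;
  cu_mul : forall a b c, w a b * w b c = w a c;
  cu_mul0 : forall a b b' c, b != b' -> w a b * w b' c = 0;
  cu_sum : \sum_a w a a = z }.

Lemma cu_mulE D z w : @cunits D z w -> forall a b b' c, w a b * w b' c = (b == b')%:R *: w a c.
Proof.
move=> W a b b' c; case: eqVneq => [<-|h]; last by rewrite (cu_mul0 W) // scale0r.
by rewrite (cu_mul W) scale1r.
Qed.

Lemma cu_unitl D z w : @cunits D z w -> forall a b, z * w a b = w a b.
Proof.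
move=> W a b; rewrite -(cu_sum W) mulr_suml (bigD1 a) //= big1 => [|c ca].
  by rewrite addr0 (cu_mul W).
by rewrite (cu_mul0 W).
Qed.

Lemma cu_unitr D z w : @cunits D z w -> forall a b, w a b * z = w a b.
Proof.
move=> W a b; rewrite -(cu_sum W) mulr_sumr (bigD1 b) //= big1 => [|c cb].
  by rewrite addr0 (cu_mul W).
by rewrite (cu_mul0 W) // eq_sym.
Qed.

Lemma cunits_frame D (z eps : T) (X : D -> T) :
  (forall a b, star (X a) * X b = (a == b)%:R *: eps) -> (forall a, X a * eps = X a) ->
  \sum_a X a * star (X a) = z -> cunits z (fun a b => X a * star (X b)).
Proof.
move=> XX Xe Xz; split => //.
- by move=> a b; rewrite starM starK.
- by move=> a b c; rewrite mulrA -(mulrA (X a)) XX eqxx scale1r Xe.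
- by move=> a b b' c /negPf bb; rewrite mulrA -(mulrA (X a)) XX bb scale0r mulr0 mul0r.
Qed.

Lemma cunits_tensor D M (z : T) (w : D -> D -> T) (h : M -> M -> T) :
  cunits z w -> cunits 1 h -> (forall a b s t, h s t * w a b = w a b * h s t) ->
  cunits z (fun x y : D * M => w x.1 y.1 * h x.2 y.2).
Proof.
move=> W H C.
have pr a b a' b' s t s' t' : w a b * h s t * (w a' b' * h s' t') =
    (w a b * w a' b') * (h s t * h s' t').
  by rewrite -mulrA (mulrA (h s t)) C !mulrA.
split.
- by move=> x y; rewrite starM (cu_star W) (cu_star H) C.
- by move=> x y v; rewrite pr (cu_mul W) (cu_mul H).
- move=> [a s] [b t] [b' t'] [c v] /=; rewrite xpair_eqE negb_and pr => /orP[h1|h1].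
    by rewrite (cu_mul0 W) ?mul0r.
  by rewrite (cu_mul0 H) ?mulr0.
- rewrite -(pair_bigA _ (fun a s => w a a * h s s)) /= -(cu_sum W); apply: eq_bigr => a _.
  by rewrite -mulr_sumr (cu_sum H) mulr1.
Qed.

Lemma cunits_reindex D D' (z : T) (w : D -> D -> T) (be : D' -> D) : bijective be ->
  cunits z w -> cunits z (fun x y => w (be x) (be y)).
Proof.
move=> bb W; split.
- by move=> a b; rewrite (cu_star W).
- by move=> a b c; rewrite (cu_mul W).
- by move=> a b b' c h; rewrite (cu_mul0 W) // (bij_eq bb).
- by rewrite -(cu_sum W) [RHS](reindex be) //; apply: onW_bij.
Qed.

(** Matrix units of a tensor factor: D = A x M, forgetting A. *)
Lemma cunits_coarse D A M (z : T) (g : D -> D -> T) (be : A * M -> D) : bijective be ->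
  cunits z g -> cunits z (fun s t => \sum_q g (be (q, s)) (be (q, t))).
Proof.
move=> bb G.
have pr s t s' t' : (\sum_q g (be (q, s)) (be (q, t))) * (\sum_q g (be (q, s')) (be (q, t'))) =
    (t == s')%:R *: \sum_q g (be (q, s)) (be (q, t')).
  rewrite mulr_suml scaler_sumr; apply: eq_bigr => q _; rewrite mulr_sumr (bigD1 q) //= big1.
    by rewrite addr0 (cu_mulE G) (bij_eq bb) xpair_eqE eqxx.
  by move=> q' qq; rewrite (cu_mul0 G) // (bij_eq bb) xpair_eqE eq_sym (negPf qq).
split.
- by move=> s t; rewrite star_sum; apply: eq_bigr => q _; rewrite (cu_star G).
- by move=> a b c; rewrite pr eqxx scale1r.
- by move=> a b b' c /negPf h; rewrite pr h scale0r.
- rewrite exchange_big (pair_bigA _ (fun q s => g (be (q, s)) (be (q, s)))) /=.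
  rewrite -(cu_sum G) [RHS](reindex be) /=; last exact: onW_bij.
  by apply: eq_bigr => -[].
Qed.

Lemma cunits_sum D (K : finType) (z : K -> T) (w : K -> D -> D -> T) :
  (forall k, cunits (z k) (w k)) -> (forall k l, k != l -> z k * z l = 0) ->
  \sum_k z k = 1 -> cunits 1 (fun a b => \sum_k w k a b).
Proof.
move=> W zz z1.
have pr a b b' c : (\sum_k w k a b) * (\sum_k w k b' c) = \sum_k w k a b * w k b' c.
  rewrite mulr_suml; apply: eq_bigr => k _; rewrite mulr_sumr (bigD1 k) //= big1 ?addr0 //.
  move=> l lk; rewrite -(cu_unitr (W k)) -(cu_unitl (W l)) -mulrA (mulrA (z k)) zz ?mul0r ?mulr0 //.
  by rewrite eq_sym.
split.
- by move=> a b; rewrite star_sum; apply: eq_bigr => k _; rewrite (cu_star (W k)).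
- by move=> a b c; rewrite pr; apply: eq_bigr => k _; rewrite (cu_mul (W k)).
- by move=> a b b' c h; rewrite pr big1 // => k _; rewrite (cu_mul0 (W k)).
- by rewrite exchange_big /= -z1; apply: eq_bigr => k _; rewrite (cu_sum (W k)).
Qed.

Lemma cunits_card D (w : D -> D -> T) : cunits 1 w -> (0 < #|D|)%N.
Proof.
move=> W; apply/card_gt0P; apply/not_existsP => h.
have := oner_neq0 T; rewrite -(cu_sum W) big1 ?eqxx // => j _; by case: (h j).
Qed.

(** The columns of a block, that is the elements of T e i0 i0 in the span of e,
    form a Hilbert space: star x * y is a multiple of e i0 i0. *)
Section GramSchmidt.
Context (I K : finType) (b : I -> K) (e : I -> I -> T) (i0 : I).
Hypothesis E : mxunits b e.
Local Notation z := (blockunit b e (b i0)).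
Local Notation eps := (e i0 i0).

Definition column (x : T) : Prop := exists v : I -> R[i], x = \sum_l v l *: e l i0.

Lemma column_span x : column x -> mxspan e x.
Proof. by move=> [v ->]; apply: mxspan_sum => l _; apply: mxspanZ; apply: mxspan_unit. Qed.

Lemma column_unit l : column (e l i0).
Proof.
exists (fun m => (m == l)%:R); rewrite (bigD1 l) //= big1 ?eqxx ?addr0 ?scale1r // => m ml.
by rewrite (negPf ml) scale0r.
Qed.

Lemma columnD x y : column x -> column y -> column (x + y).
Proof.
move=> [v ->] [w ->]; exists (fun l => v l + w l); rewrite -big_split /=.
by apply: eq_bigr => l _; rewrite scalerDl.
Qed.

Lemma columnZ c x : column x -> column (c *: x).
Proof.
move=> [v ->]; exists (fun l => c * v l); rewrite scaler_sumr.
by apply: eq_bigr => l _; rewrite cscalerA.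
Qed.

Lemma column_sum (A : finType) (r : seq A) (F : A -> T) :
  (forall s, column (F s)) -> column (\sum_(s <- r) F s).
Proof.
move=> h; elim/big_ind: _ => //; last exact: columnD.
by exists (fun _ => 0); rewrite big1 // => l _; rewrite scale0r.
Qed.

Lemma columnM x y : mxspan e x -> column y -> column (x * y).
Proof.
move=> [a ->] [v ->]; rewrite mulr_sumr; apply: column_sum => l.
rewrite -scalerAr; apply: columnZ; rewrite /lincomb mulr_suml; apply: column_sum => i.
rewrite mulr_suml; apply: column_sum => j; rewrite -scalerAl; apply: columnZ.
rewrite (mu_mulE E); apply: columnZ; exact: column_unit.
Qed.

Lemma column_eps x : column x -> x * eps = x.
Proof.
move=> [v ->]; rewrite mulr_suml; apply: eq_bigr => l _; rewrite -scalerAl.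
have [bl|bl] := eqVneq (b l) (b i0); first by rewrite (mu_mul E).
by rewrite (mu_off E bl) mul0r.
Qed.

Lemma column_z x : column x -> z * x = x.
Proof.
move=> cx; rewrite (blockunit_comm E); last exact: column_span.
transitivity (x * eps * z); first by rewrite column_eps.
by rewrite -mulrA (blockunitEr E) eqxx scale1r column_eps.
Qed.

Lemma column_innerE (v w : I -> R[i]) :
  star (\sum_l v l *: e l i0) * (\sum_l w l *: e l i0) =
  (\sum_(l | b l == b i0) (v l)^* * w l) *: eps.
Proof.
rewrite star_sum mulr_suml scaler_suml [RHS]big_mkcond; apply: eq_bigr => l _.
rewrite mulr_sumr (bigD1 l) //= [X in _ + X]big1 => [|m ml]; last first.
  by rewrite starZ (mu_star E) -scalerAl -scalerAr (mu_mul0 E) ?scaler0 // eq_sym.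
rewrite addr0 starZ (mu_star E) -scalerAl -scalerAr cscalerA.
case: eqVneq => bl; first by rewrite (mu_mul E).
by rewrite (mu_off E bl) mulr0 scaler0.
Qed.

Lemma column_inner x y : column x -> column y -> exists c, star x * y = c *: eps.
Proof. by move=> [v ->] [w ->]; rewrite column_innerE; eexists. Qed.

Lemma column_inner_ge0 x : column x -> exists2 c, 0 <= c & star x * x = c *: eps.
Proof.
move=> [v ->]; rewrite column_innerE; eexists; last by [].
by apply: sumr_ge0 => l _; rewrite mulrC mul_conjC_ge0.
Qed.

Lemma column_normalise x : column x -> x != 0 ->
  exists c : R[i], [/\ c != 0, c^* = c & star (c *: x) * (c *: x) = eps].
Proof.
move=> cx x0; have [d d0 ed] := column_inner_ge0 cx.
have dn0 : d != 0.
  apply: contraNneq x0 => dz; apply/eqP/cnorm_eq0.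
  have := cnorm_star x; rewrite ed dz scale0r cnorm0 => /esym/eqP.
  by rewrite expf_eq0 => /andP[_ /eqP].
exists (sqrtC d)^-1.
have s0 : 0 <= sqrtC d by rewrite sqrtC_ge0.
have cc : ((sqrtC d)^-1)^* = (sqrtC d)^-1.
  by apply/CrealP; apply: ger0_real; rewrite invr_ge0.
split=> //; first by rewrite invr_eq0 sqrtC_eq0.
rewrite starZ cc -scalerAl -scalerAr cscalerA ed cscalerA -expr2 exprVn sqrtCK mulVf //.
by rewrite scale1r.
Qed.

(** The range of the projection P in the column space has an orthonormal basis,
    obtained by orthogonalising the projections P e l i0 of the standard one. *)
Lemma gram_schmidt (P : T) : mxspan e P -> star P = P -> P * P = P ->
  exists (a : nat) (y : nat -> T),
    [/\ forall s, column (y s), forall s, (s < a)%N -> P * y s = y s,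
       forall s t, (s < a)%N -> (t < a)%N -> star (y s) * y t = (s == t)%:R *: eps &
       \sum_(s < a) y s * star (y s) = P * z].
Proof.
move=> sP stP PP.
pose Q a (y : nat -> T) := [/\ forall s, column (y s), forall s, (s < a)%N -> P * y s = y s &
       forall s t, (s < a)%N -> (t < a)%N -> star (y s) * y t = (s == t)%:R *: eps].
suff [a [y [[h1 h2 h3] hy]]] : exists a y, Q a y /\
    forall l, l \in enum I -> (\sum_(s < a) y s * star (y s)) * e l i0 = P * e l i0.
  exists a, y; split => //.
  have zE : z = \sum_(l | b l == b i0) e l i0 * e i0 l.
    by apply: eq_bigr => l /eqP bl; rewrite (mu_mul E).
  transitivity ((\sum_(s < a) y s * star (y s)) * z).
    rewrite mulr_suml; apply: eq_bigr => s _; rewrite -mulrA; congr (_ * _).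
    by rewrite -{1}(column_z (h1 s)) starM (blockunit_star E).
  rewrite zE !mulr_sumr; apply: eq_bigr => l _.
  by rewrite !mulrA hy // mem_enum.
elim: (enum I) => [|l ls [a [y [[h1 h2 h3] hy]]]].
  by exists 0%N, (fun=> eps); split=> //; split=> // s; apply: column_unit.
pose p := \sum_(s < a) y s * star (y s).
have [r rE] : exists r, r = P * e l i0 - p * e l i0 by eexists.
have sp : mxspan e p.
  apply: mxspan_sum => s _; apply: (mxspanM E); first exact: column_span.
  by apply: (mxspanS E); apply: column_span.
have Pp : P * p = p.
  by rewrite mulr_sumr; apply: eq_bigr => s _; rewrite mulrA h2.
have cr : column r.
  rewrite rE -scaleN1r; apply: columnD; first by apply: columnM => //; apply: column_unit.
  by apply: columnZ; apply: columnM => //; apply: column_unit.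
have Pr : P * r = r by rewrite rE mulrBr !mulrA PP Pp.
have yr s : (s < a)%N -> star (y s) * r = 0.
  move=> sa; rewrite rE mulrBr !mulrA.
  have -> : star (y s) * P = star (y s) by rewrite -{2}(h2 s sa) starM stP.
  suff -> : star (y s) * p = star (y s) by rewrite subrr.
  rewrite mulr_sumr (bigD1 (Ordinal sa)) //= [X in _ + X]big1 => [|t ts].
    rewrite addr0 mulrA h3 // eqxx scale1r -{1}(column_eps (h1 s)) starM (mu_star E).
    by rewrite mulrA (mu_idem E) -{1}(mu_star E) -starM column_eps.
  rewrite mulrA h3 // (_ : s == t = false) ?scale0r ?mul0r //.
  by apply/negbTE; rewrite eq_sym; apply: contraNneq ts => ts; apply/eqP/val_inj.
have [r0|r0] := eqVneq r 0.
  exists a, y; split=> // l'; rewrite inE => /orP[/eqP ->|/hy //].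
  by apply/eqP; rewrite eq_sym -subr_eq0 -rE r0.
have sr : star r * P = star r by rewrite -{2}Pr starM stP.
have [c [c0 cc nc]] := column_normalise cr r0.
pose y' s := if s == a then c *: r else y s.
have ya s : (s < a)%N -> y' s = y s by move=> sa; rewrite /y' ltn_eqF.
have yna : y' a = c *: r by rewrite /y' eqxx.
have ry s : (s < a)%N -> star r * y s = 0.
  by move=> sa; rewrite -[LHS]starK starM starK yr // star0.
exists a.+1, y'; split; first split.
- by move=> s; rewrite /y'; case: ifP => // _; apply: columnZ.
- move=> s; rewrite ltnS leq_eqVlt => /predU1P[->|sa]; last by rewrite ya ?h2.
  by rewrite yna -scalerAr Pr.
- move=> s t; rewrite ltnS leq_eqVlt => /predU1P[->|sa]; rewrite ltnS leq_eqVlt => /predU1P[->|ta].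
  + by rewrite yna eqxx scale1r.
  + rewrite yna ya // starZ -scalerAl ry // scaler0 eq_sym ltn_eqF // scale0r //.
  + by rewrite yna ya // -scalerAr yr // scaler0 ltn_eqF // scale0r.
  + by rewrite !ya // h3.
have pE : \sum_(s < a.+1) y' s * star (y' s) = p + (c *: r) * star (c *: r).
  rewrite big_ord_recr /= yna; congr (_ + _); apply: eq_bigr => s _.
  by rewrite ya.
move=> l'; rewrite pE inE => /orP[/eqP ->|hl].
  rewrite mulrDl -mulrA.
  have -> : star (c *: r) * e l i0 = star (c *: r) * (c^-1 *: (c *: r)).
    rewrite cscalerA mulVf // scale1r [X in _ = _ * X]rE mulrBr.
    suff rp : star (c *: r) * p = 0 by rewrite !mulrA rp mul0r subr0 starZ -!scalerAl sr.
    rewrite mulr_sumr big1 // => s _; rewrite mulrA starZ -scalerAl ry //.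
    by rewrite scaler0 mul0r.
  rewrite -scalerAr nc -scalerAr column_eps; last exact: columnZ.
  by rewrite cscalerA mulVf // scale1r rE addrC subrK.
rewrite mulrDl hy // -mulrA.
suff -> : star (c *: r) * e l' i0 = 0 by rewrite mulr0 addr0.
rewrite starZ -scalerAl -sr -mulrA -hy // mulrA mulr_sumr big1 ?mul0r ?scaler0 // => s _.
by rewrite mulrA ry // mul0r.
Qed.

End GramSchmidt.
End CornerUnits.

(** * Stages with matrix algebras in their commutants *)

Section BlockFrame.
Context (R : realType) (T : cstarAlgType R) (I K J : finType) (b : I -> K)
  (e : I -> I -> T) (f : J -> J -> T).
Hypotheses (E : mxunits b e) (F : cunits 1 f) (fe : forall i j, mxspan e (f i j)).

(** The restriction of a system of matrix units f to a block is a multiple of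
    the standard one: a basis of the range of f j0 j0 is moved around by f. *)
Lemma block_frame k : exists i0 (a : nat) (X : J * 'I_a -> T),
  [/\ b i0 = k, forall p, column e i0 (X p),
      forall p q, star (X p) * X q = (p == q)%:R *: e i0 i0,
      \sum_p X p * star (X p) = blockunit b e k &
      forall i j, f i j * blockunit b e k = \sum_q X (i, q) * star (X (j, q))].
Proof.
have [i0 bi0] := mu_surj E k.
have /card_gt0P [j0 _] := cunits_card F.
have [|||a [y [yc yP yy ys]]] := @gram_schmidt R T I K b e i0 E (f j0 j0).
- exact: fe.
- exact: (cu_star F).
- exact: (cu_mul F).
rewrite bi0 in ys.
pose X (p : J * 'I_a) := f p.1 j0 * y p.2.
have Xsum i j : f i j * blockunit b e k = \sum_q X (i, q) * star (X (j, q)).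
  transitivity (f i j0 * (f j0 j0 * blockunit b e k) * f j0 j).
    rewrite mulrA (cu_mul F) -mulrA (blockunit_comm E) // mulrA (cu_mul F) //.
  rewrite -ys mulr_sumr mulr_suml; apply: eq_bigr => q _.
  by rewrite /X /= starM (cu_star F) !mulrA.
exists i0, a, X; split=> //.
- by move=> p; apply: (columnM E).
- move=> [i q] [j r]; rewrite /X /= starM (cu_star F) mulrA -(mulrA (star _)) (cu_mulE F).
  rewrite -scalerAr -scalerAl -mulrA yP // yy // cscalerA xpair_eqE.
  by rewrite mulr_natl; case: (i == j); rewrite /= ?mulr1n ?mulr0n ?scale0r.
- rewrite -(pair_bigA _ (fun i q => X (i, q) * star (X (i, q)))) /=.
  rewrite (eq_bigr (fun i => f i i * blockunit b e k)); last by move=> i _; rewrite Xsum.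
  by rewrite -mulr_suml (cu_sum F) mul1r.
Qed.

Lemma frame_span k i0 (D : finType) (X : D -> T) x :
  b i0 = k -> (forall p, column e i0 (X p)) ->
  \sum_p X p * star (X p) = blockunit b e k -> mxspan e x ->
  mxspan (fun p q => X p * star (X q)) (blockunit b e k * x).
Proof.
move=> bi0 Xc Xs sx.
have zz : blockunit b e k * x = blockunit b e k * x * blockunit b e k.
  by rewrite -mulrA -(blockunit_comm E) // mulrA (blockunit_idem E).
rewrite zz -{1}Xs -{1}Xs mulr_suml mulr_suml; apply: mxspan_sum => p _.
rewrite mulr_sumr; apply: mxspan_sum => q _.
have [c hc] := column_inner E (Xc p) (columnM E sx (Xc q)).
have -> : X p * star (X p) * x * (X q * star (X q)) = c *: (X p * star (X q)).
  rewrite !mulrA -(mulrA (X p)) -(mulrA (X p)) -(mulrA (star _)) hc.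
  by rewrite -scalerAr -scalerAl (column_eps E).
by apply: mxspanZ; apply: (mxspan_unit (fun p q => X p * star (X q))).
Qed.

End BlockFrame.

Lemma product_index (M : finType) (a r : nat) : #|M| = (a * r)%N ->
  exists be : 'I_a * 'I_r -> M, bijective be.
Proof.
move=> h; have h' : #|{: 'I_a * 'I_r}| = #|M| by rewrite card_prod !card_ord.
exists (fun x => enum_val (cast_ord h' (enum_rank x))).
exists (fun y => enum_val (cast_ord (esym h') (enum_rank y))).
  by move=> x; rewrite enum_valK cast_ordK enum_rankK.
by move=> y; rewrite enum_valK cast_ordKV enum_rankK.
Qed.

Section Absorbing.
Context (R : realType).

(** The relative commutants of the stages contain full matrix algebras of every
    size: the trace left in the finite stages by a tensor factor Q. *)
Definition absorbing (T : cstarAlgType R) (I : nat -> finType)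
    (e : forall n, I n -> I n -> T) : Prop :=
  forall n (M : finType), (0 < #|M|)%N -> exists m (g : M -> M -> T),
    [/\ (n <= m)%N, cunits 1 g, forall s t, mxspan (@e m) (g s t) &
        forall s t x, mxspan (@e n) x -> g s t * x = x * g s t].

Section Uhf.
Context (Q : cstarAlgType R) (J L : nat -> finType)
  (c : forall n, J n -> L n) (u : forall n, J n -> J n -> Q) (qa : forall n, L n.+1 -> L n).
Arguments c : clear implicits.
Arguments u : clear implicits.
Arguments qa : clear implicits.
Hypothesis W : tower c u qa.
Hypothesis L1 : forall n (k l : L n), k = l.

Lemma uhf_cunits n : cunits 1 (u n).
Proof.
have E := tw_mu W n; split.
- exact: (mu_star E).
- by move=> i j l; rewrite (mu_mul E) //; apply: L1.
- by move=> i j k l h; rewrite (mu_mul0 E).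
- exact: (mu_sum E).
Qed.

(** A unital copy of M_n in M_(n a) is M_n (x) 1 for suitable matrix units, so its
    commutant is M_a, which contains M_N when N divides a. *)
Lemma uhf_absorbing :
  (forall N m0, (0 < N)%N -> exists m, (m0 <= m)%N /\ (N %| #|J m|)%N) -> absorbing u.
Proof.
move=> div n M M0.
have Jn0 := uhf_card_gt0 W n.
have [m [nm dm]] : exists m, (n <= m)%N /\ (#|J n| * #|M| %| #|J m|)%N.
  by apply: div; rewrite muln_gt0 Jn0.
have E := tw_mu W m.
have /card_gt0P [j1 _] := uhf_card_gt0 W m.
have sp i j : mxspan (u m) (u n i j) by apply: (tw_incn W nm); apply: mxspan_unit.
have [i0 [a [X [bi0 Xc XX Xs Xf]]]] := block_frame E (uhf_cunits n) sp (c m j1).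
have z1 : blockunit (c m) (u m) (c m j1) = 1 by apply: (uhf_blockunit W L1).
rewrite z1 in Xs Xf.
have [tau ht] := uhf_trace_exists W L1.
have [tl _ t1 tM] := ht.
have ca : #|J m| = (#|J n| * a)%N.
  have e1 : (1 : R[i]) = (#|J n| * a)%:R / #|J m|%:R.
    transitivity (tau 1 : R[i]); first by rewrite t1.
    rewrite -Xs (lin_sum tl).
    rewrite (eq_bigr (fun=> 1 / #|J m|%:R : R[i])) => [|p _].
      by rewrite sumr_const card_prod card_ord mul1r -[LHS]mulr_natl.
    rewrite tM XX eqxx scale1r -(lincomb1 (u m)) (uhf_trace_lincomb W L1 ht).
    rewrite (bigD1 i0) //= big1 ?eqxx ?addr0 // => i ii.
    by rewrite (negPf ii).
  have J0 : #|J m|%:R != 0 :> R[i] by rewrite pnatr_eq0 -lt0n (uhf_card_gt0 W).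
  have := congr1 (fun w => w * #|J m|%:R) e1; rewrite divfK // mul1r => /eqP.
  by rewrite eqr_nat => /eqP.
have [r hr] : exists r, a = (r * #|M|)%N.
  apply/dvdnP; rewrite -(dvdn_pmul2l Jn0) -ca; exact: dm.
have [|be bbe] := @product_index 'I_a r #|M|; first by rewrite card_ord.
have bM : bijective (@enum_rank M) by exists enum_val; [apply: enum_rankK|apply: enum_valK].
pose be' (x : 'I_r * M) := be (x.1, enum_rank x.2).
have bbe' : bijective be'.
  apply: (bij_comp bbe); case: bM => v h1 h2.
  by exists (fun x => (x.1, v x.2)) => -[x1 x2] /=; rewrite ?h1 ?h2.
pose ga (x : (J n * 'I_r) * M) : J n * 'I_a := (x.1.1, be' (x.1.2, x.2)).
have bga : bijective ga.
  case: bbe' => v h1 h2; exists (fun y => ((y.1, (v y.2).1), (v y.2).2)).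
    by move=> [[j q] s]; rewrite /ga /= h1.
  by move=> [j q]; rewrite /ga /= -surjective_pairing h2.
have WX : cunits 1 (fun p q : J n * 'I_a => X p * star (X q)).
  apply: (cunits_frame (eps := u m i0 i0)) => // p; exact: (column_eps E).
pose g s t := \sum_q X (ga (q, s)) * star (X (ga (q, t))).
have G : cunits 1 g by apply: (cunits_coarse bga WX).
exists m, g; split=> //.
- move=> s t; apply: mxspan_sum => q _; apply: (mxspanM E).
    by apply: column_span; apply: Xc.
  by apply: (mxspanS E); apply: column_span; apply: Xc.
- have comm s t i j : g s t * u n i j = u n i j * g s t.
    have -> : u n i j = \sum_q X (i, q) * star (X (j, q)) by rewrite -Xf mulr1.
    have gE s' t' : g s' t' = \sum_i \sum_q X (i, be' (q, s')) * star (X (i, be' (q, t'))).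
      by rewrite /g pair_bigA.
    transitivity (\sum_q X (i, be' (q, s)) * star (X (j, be' (q, t)))).
      rewrite gE mulr_suml (bigD1 i) //= [X in _ + X]big1 => [|i' ii']; last first.
        rewrite mulr_suml big1 // => q _; rewrite mulr_sumr big1 // => q' _.
        by rewrite (cu_mul0 WX) // xpair_eqE (negPf ii').
      rewrite addr0 mulr_suml; apply: eq_bigr => q _.
      rewrite mulr_sumr (bigD1 (be' (q, t))) //= [X in _ + X]big1 => [|q' qq].
        by rewrite addr0 (cu_mul WX).
      by rewrite (cu_mul0 WX) // xpair_eqE eqxx eq_sym.
    rewrite gE mulr_sumr (bigD1 j) //= [X in _ + X]big1 => [|i' ii']; last first.
      rewrite mulr_sumr big1 // => q _; rewrite mulr_suml big1 // => q' _.
      by rewrite (cu_mul0 WX) // xpair_eqE eq_sym (negPf ii').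
    rewrite addr0 mulr_sumr; apply: eq_bigr => q _.
    rewrite mulr_suml (bigD1 (be' (q, s))) //= [X in _ + X]big1 => [|q' qq].
      by rewrite addr0 (cu_mul WX).
    by rewrite (cu_mul0 WX) // xpair_eqE eqxx.
  move=> s t x [a' ->]; rewrite /lincomb mulr_sumr mulr_suml; apply: eq_bigr => i _.
  rewrite mulr_sumr mulr_suml; apply: eq_bigr => j _.
  by rewrite -scalerAr -scalerAl comm.
Qed.

End Uhf.
End Absorbing.

Lemma tensor_absorbing (R : realType) (A Q T : cstarAlgType R) (f : A -> T) (g : Q -> T)
    (I K J : nat -> finType) (b : forall n, I n -> K n)
    (e : forall n, I n -> I n -> A) (u : forall n, J n -> J n -> Q)
    (pa : forall n, K n.+1 -> K n) :
  star_hom f -> star_hom g -> f 1 = 1 -> g 1 = 1 -> (forall a q, f a * g q = g q * f a) ->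
  tower b e pa -> absorbing u -> absorbing (tensor_unit f g e u).
Proof.
move=> fh gh f1 g1 fgC W ab n M M0; have [m [v [nm V sv vC]]] := ab n M M0.
have gl := star_hom_linear gh; have gM := star_homM gh.
exists m, (fun s t => g (v s t)); split=> //.
- split.
  + by move=> s t; rewrite -(star_hom_star gh) (cu_star V).
  + by move=> s t r; rewrite -gM (cu_mul V).
  + by move=> s t t' r h; rewrite -gM (cu_mul0 V) ?(lin0 gl).
  + by rewrite -(lin_sum gl) (cu_sum V).
- move=> s t; rewrite -[g _]mul1r -f1; apply: (tensor_mxspan fh gh) => //.
  exact: (mxspan1 (tw_mu W m)).
- move=> s t x [a ->]; rewrite /lincomb mulr_sumr mulr_suml; apply: eq_bigr => i _.
  rewrite mulr_sumr mulr_suml; apply: eq_bigr => j _.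
  rewrite -scalerAr -scalerAl; congr (_ *: _); rewrite /tensor_unit mulrA -fgC -!mulrA -!gM.
  by rewrite vC //; apply: mxspan_unit.
Qed.

Section Forth.
Context (R : realType) (T : cstarAlgType R) (I K : nat -> finType) (b : forall n, I n -> K n)
  (e : forall n, I n -> I n -> T) (pa : forall n, K n.+1 -> K n).
Arguments b : clear implicits.
Arguments e : clear implicits.
Arguments pa : clear implicits.
Hypotheses (W : tower b e pa) (ab : absorbing e).

(** The matrix units of span (z k) (x) span g for a partition z of the unit. *)
Definition cutunit (K' D : finType) (z : K' -> T) (g : D -> D -> T) (p q : K' * D) : T :=
  (p.1 == q.1)%:R *: (z p.1 * g p.2 q.2).

Lemma forth_other (n : nat) (J M : finType) (f : J -> J -> T) : cunits 1 f ->
  (forall i j, mxspan (e n) (f i j)) -> (0 < #|M|)%N ->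
  exists m (g : J * M -> J * M -> T), [/\ cunits 1 g, forall p q, mxspan (e m) (g p q) &
    forall i j, f i j = \sum_s g (i, s) (j, s)].
Proof.
move=> F fe M0; have [m [g [nm G sg gC]]] := ab n M0.
exists m, (fun x y => f x.1 y.1 * g x.2 y.2); split.
- by apply: cunits_tensor => // i j s t; apply: gC.
- by move=> p q; apply: (mxspanM (tw_mu W m)) => //; apply: (tw_incn W nm).
- by move=> i j /=; rewrite -mulr_sumr (cu_sum G) mulr1.
Qed.

(** In the k-th block of stage n the system f has some multiplicity a k.  Matrix
    units g0 of size prod_k a k in the commutant of the stage contain, for each k,
    a system of size prod_k a k / a k, which brings the multiplicities of all
    blocks to the common value prod_k a k.  The sum over k of the systems obtained
    in the blocks is a single full matrix algebra which, together with the block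
    units, spans the stage. *)
Lemma forth_stage (n : nat) (J : finType) (f : J -> J -> T) : cunits 1 f ->
  (forall i j, mxspan (e n) (f i j)) ->
  exists (M : finType) m (g : J * M -> J * M -> T), [/\ (0 < #|M|)%N, cunits 1 g,
    forall p q, mxspan (e m) (g p q), forall i j, f i j = \sum_s g (i, s) (j, s) &
    forall x, mxspan (e n) x -> mxspan (cutunit (blockunit (b n) (e n)) g) x].
Proof.
move=> F fe; have E := tw_mu W n.
set z := blockunit (b n) (e n).
have [i0 h0] := choice (block_frame E F fe).
have [a h1] := choice h0.
have [X hX] : exists X : forall k, J * 'I_(a k) -> T, forall k,
  [/\ b n (i0 k) = k, forall p, column (e n) (i0 k) (X k p),
      forall p q, star (X k p) * X k q = (p == q)%:R *: e n (i0 k) (i0 k),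
      \sum_p X k p * star (X k p) = z k &
      forall i j, f i j * z k = \sum_q X k (i, q) * star (X k (j, q))].
  by exists (fun k => projT1 (cid (h1 k))) => k; case: (cid _).
have a0 k : (0 < a k)%N.
  rewrite lt0n; apply: contraNneq (blockunit_neq0 E k) => ak.
  have [_ _ _ Xs _] := hX k; rewrite -/(z k) -Xs big1 // => -[j q] _; exfalso.
  by move: q; rewrite ak => -[].
pose M : finType := 'I_(\prod_k a k).
pose r k := (\prod_(l | l != k) a l)%N.
have cM k : #|M| = (a k * r k)%N by rewrite card_ord (bigD1 k).
have M0 : (0 < #|M|)%N by rewrite card_ord prodn_gt0.
have [be hbe] : exists be : forall k, 'I_(a k) * 'I_(r k) -> M, forall k, bijective (be k).
  exists (fun k => projT1 (cid (product_index (cM k)))) => k; by case: (cid _).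
have [bi hbi] : exists bi : forall k, M -> 'I_(a k) * 'I_(r k), forall k,
    cancel (be k) (bi k) /\ cancel (bi k) (be k).
  have ex k : exists v, cancel (be k) v /\ cancel v (be k) by case: (hbe k) => v; exists v.
  by exists (fun k => projT1 (cid (ex k))) => k; case: (cid _).
have [m [g0 [nm G0 sg0 gC0]]] := ab n M0.
pose w k (p q : J * 'I_(a k)) := X k p * star (X k q).
have Ww k : cunits (z k) (w k).
  have [bk Xc XX Xs _] := hX k.
  by apply: (cunits_frame (eps := e n (i0 k) (i0 k))) => // p; exact: (column_eps E).
pose h k (s t : 'I_(r k)) := \sum_q g0 (be k (q, s)) (be k (q, t)).
have Hh k : cunits 1 (h k) by exact: (cunits_coarse (hbe k) G0).
have sX k p : mxspan (e n) (X k p) by have [_ Xc _ _ _] := hX k; apply: column_span.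
have sw k p q : mxspan (e n) (w k p q) by apply: (mxspanM E) => //; apply: (mxspanS E).
have hC k p q s t : h k s t * w k p q = w k p q * h k s t.
  by rewrite mulr_suml mulr_sumr; apply: eq_bigr => o _; apply: gC0.
pose wh k (x y : (J * 'I_(a k)) * 'I_(r k)) := w k x.1 y.1 * h k x.2 y.2.
have Wh k : cunits (z k) (wh k) by apply: cunits_tensor.
pose ga k (x : J * M) := ((x.1, (bi k x.2).1), (bi k x.2).2).
have hga k : bijective (ga k).
  exists (fun y => (y.1.1, be k (y.1.2, y.2))).
    by move=> [j s]; rewrite /ga /= -surjective_pairing; case: (hbi k) => _ ->.
  by move=> [[j q] s]; rewrite /ga /=; case: (hbi k) => -> _.
pose v k (x y : J * M) := wh k (ga k x) (ga k y).
have Wv k : cunits (z k) (v k) by exact: (cunits_reindex (hga k) (Wh k)).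
pose g x y := \sum_k v k x y.
have zz k l : k != l -> z k * z l = 0.
  by move=> /negPf kl; rewrite (blockunitM E) kl scale0r.
have G : cunits 1 g by apply: cunits_sum Wv zz (blockunit_sum E).
have zg k x y : z k * g x y = v k x y.
  rewrite mulr_sumr (bigD1 k) //= big1 ?addr0 ?(cu_unitl (Wv k)) // => l lk.
  by rewrite -(cu_unitl (Wv l)) mulrA zz ?mul0r // eq_sym.
exists M, m, g; split=> //.
- move=> p q; apply: mxspan_sum => k _; apply: (mxspanM (tw_mu W m)); first exact: (tw_incn W nm).
  by apply: mxspan_sum => o _.
- move=> i j; rewrite exchange_big /= -[f i j]mulr1 -(blockunit_sum E) mulr_sumr.
  apply: eq_bigr => k _; have [_ _ _ _ ->] := hX k.
  rewrite (reindex (be k)) /=; last exact: onW_bij.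
  transitivity (\sum_q \sum_s v k (i, be k (q, s)) (j, be k (q, s))); last first.
    by rewrite pair_bigA /=; apply: eq_bigr => -[].
  apply: eq_bigr => q _; rewrite -[LHS]mulr1 -(cu_sum (Hh k)) mulr_sumr.
  apply: eq_bigr => s _; rewrite /v /wh /ga /=.
  by case: (hbi k) => -> _.
- move=> x sx; rewrite -[x]mul1r -(blockunit_sum E) mulr_suml; apply: mxspan_sum => k _.
  have [bk Xc XX Xs _] := hX k.
  apply: mxspan_sub (frame_span E bk Xc Xs sx) => p q.
  rewrite -[_ * star _]mulr1 -(cu_sum (Hh k)) mulr_sumr; apply: mxspan_sum => s _.
  have [ig hg1 hg2] := hga k.
  have -> : X k p * star (X k q) * h k s s = cutunit z g (k, ig (p, s)) (k, ig (q, s)).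
    by rewrite /cutunit /= eqxx scale1r zg /v !hg2.
  exact: mxspan_unit.
Qed.

End Forth.

(** * Pure traces and clopen sets of the boundary of the forest *)

Section PureTraces.
Context (R : realType) (T : cstarAlgType R) (I K : nat -> finType) (b : forall n, I n -> K n)
  (e : forall n, I n -> I n -> T) (pa : forall n, K n.+1 -> K n).
Arguments b : clear implicits.
Arguments e : clear implicits.
Arguments pa : clear implicits.
Hypothesis W : tower b e pa.
Local Notation z n k := (blockunit (b n) (e n) k).
Implicit Types s t : T -> R[i]^o.

(** The traces concentrated on a single infinite branch of the forest. *)
Definition pure (t : T -> R[i]^o) : Prop :=
  tracial_states t /\ forall n k, t (z n k) = 0 \/ t (z n k) = 1.

Definition extreme (t : T -> R[i]^o) : Prop :=
  tracial_states t /\ forall c s1 s2, 0 < c < 1 -> tracial_states s1 -> tracial_states s2 ->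
    t = convex_comb c s1 s2 -> s1 = t.

Lemma trace_proj_ge0 t p : tracial_states t -> star p = p -> p * p = p -> 0 <= t p.
Proof. by move=> [_ tp _ _] sp pp; rewrite -pp -{1}sp. Qed.

Lemma trace_proj_le1 t p : tracial_states t -> star p = p -> p * p = p -> t p <= 1.
Proof.
move=> ht sp pp; have [tl _ t1 _] := ht; rewrite -subr_ge0 -[X in X - _]t1 -(linB tl).
apply: trace_proj_ge0 => //; first by rewrite starB star1 sp.
by rewrite mulrBl mul1r mulrBr mulr1 pp subrr subr0.
Qed.

Lemma trace_cut t p : tracial_states t -> star p = p -> p * p = p -> (forall x, p * x = x * p) ->
  t p != 0 -> tracial_states (fun x => t (p * x) / t p).
Proof.
move=> ht sp pp pC tp0; have [tl tpos t1 tM] := ht; split.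
- move=> c x y; rewrite mulrDr (linD tl) -scalerAr (linZ tl) mulrDl.
  by rewrite -[c *: t _]/(c * _) -[c *: (_ / _)]/(c * _) mulrA.
- move=> x; apply: divr_ge0; last exact: trace_proj_ge0.
  have -> : p * (star x * x) = star (x * p) * (x * p).
    by rewrite starM sp -[RHS]mulrA [X in _ = _ * X]mulrA -pC [RHS]mulrA pp.
  exact: tpos.
- by rewrite mulr1 divff.
- by move=> x y; rewrite mulrA tM mulrA -pC -mulrA.
Qed.

(** A trace t that takes a value strictly between 0 and 1 on a block unit p is a
    proper convex combination of its restrictions to p and 1 - p. *)
Lemma extreme_pure t : extreme t -> pure t.
Proof.
move=> [ht hext]; split=> // n k; set p := z n k.
have E := tw_mu W n.
have sp : star p = p by apply: (blockunit_star E).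
have pp : p * p = p by apply: (blockunit_idem E).
have pC x : p * x = x * p by apply: (tw_central W).
have [tp0|tp0] := eqVneq (t p : R[i]) 0; [by left|right].
have [tl _ t1 _] := ht.
apply/eqP; apply: contraT => tp1.
pose q := 1 - p.
have sq : star q = q by rewrite starB star1 sp.
have qq : q * q = q by rewrite /q mulrBl mul1r mulrBr mulr1 pp subrr subr0.
have qC x : q * x = x * q by rewrite /q mulrBl mulrBr mul1r mulr1 pC.
have tq : t q = 1 - t p by rewrite (linB tl) t1.
have tq0 : (t q : R[i]) != 0 by rewrite tq subr_eq0 eq_sym.
have [tpE rp] := ge0_real (trace_proj_ge0 ht sp pp).
have [tqE rq] := ge0_real (trace_proj_ge0 ht sq qq).
pose c := complex.Re (t p).
have cE : c%:C%C = t p by rewrite -tpE.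
have c1E : (1 - c)%:C%C = t q by rewrite tq -cE; exact: (rmorphB (real_complex R) 1 c).
have c01 : 0 < c < 1.
  rewrite lt_neqAle rp andbT.
  apply/andP; split.
    by apply: contraNneq tp0 => c0; rewrite -cE -c0.
  rewrite lt_neqAle; apply/andP; split; first by apply: contraNneq tp1 => c1; rewrite -cE c1.
  by rewrite -lecR cE; apply: trace_proj_le1.
have tE : t = convex_comb c (fun x => t (p * x) / t p) (fun x => t (q * x) / t q).
  apply/funext => x; rewrite /convex_comb cE c1E ![_ * (_ / _)]mulrC !divfK //.
  by rewrite -(linD tl) -mulrDl /q addrC subrK mul1r.
have := hext c _ _ c01 (trace_cut ht sp pp pC tp0) (trace_cut ht sq qq qC tq0) tE.
move=> /(congr1 (fun s => s p)); rewrite pp divff // => h.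
by rewrite h eqxx in tp1.
Qed.

(** The numbers 0 and 1 are extreme in the unit interval, and traces are determined
    by their values on block units. *)
Lemma pure_extreme t : pure t -> extreme t.
Proof.
move=> [ht t01]; split=> // c s1 s2 /andP[c0 c1] h1 h2 tE.
apply: (tw_trace_unique W) => // n k; have E := tw_mu W n.
have sp := blockunit_star E k; have pp := blockunit_idem E k.
have a1 := trace_proj_ge0 h1 sp pp; have a2 := trace_proj_ge0 h2 sp pp.
have b1 := trace_proj_le1 h1 sp pp; have b2 := trace_proj_le1 h2 sp pp.
have cp : 0 < c%:C%C :> R[i] by rewrite ltr0C.
have dp : 0 < (1 - c)%:C%C :> R[i] by rewrite ltr0C subr_gt0.
have tzE : t (z n k) = c%:C%C * s1 (z n k) + (1 - c)%:C%C * s2 (z n k) by rewrite {1}tE.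
have split0 (u v : R[i]) : 0 <= u -> 0 <= v -> c%:C%C * u + (1 - c)%:C%C * v = 0 -> u = 0.
  move=> u0 v0 /eqP; rewrite paddr_eq0; [|exact: mulr_ge0 (ltW cp) u0|exact: mulr_ge0 (ltW dp) v0].
  by case/andP; rewrite mulf_eq0 gt_eqF //= => /eqP.
have [t0|t1] := t01 n k; first by rewrite t0; apply: split0 a1 a2 _; rewrite -tzE.
rewrite t1; apply: esym; apply/eqP; rewrite -subr_eq0; apply/eqP.
apply: (split0 _ (1 - s2 (z n k))); rewrite ?subr_ge0 //.
rewrite !mulrBr !mulr1 addrACA -opprD -tzE t1.
have -> : c%:C%C + (1 - c)%:C%C = 1 :> R[i].
  by have := rmorphD (real_complex R) c (1 - c); rewrite addrC subrK => <-.
exact: subrr.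
Qed.

Lemma pure_node t n : pure t -> exists k, forall l, t (z n l) = (l == k)%:R.
Proof.
move=> [ht t01]; have [tl _ t1 _] := ht; have E := tw_mu W n.
have [k tk] : exists k, t (z n k) = 1.
  apply/not_existsP => h; have : (1 : R[i]) = 0.
    rewrite -t1 -(blockunit_sum E) (lin_sum tl) big1 // => k _.
    by case: (t01 n k) => // /h.
  by move/eqP; rewrite oner_eq0.
exists k => l; have [->//|lk] := eqVneq l k.
case: (t01 n l) => // tl1; exfalso.
have := t1; rewrite -(blockunit_sum E) (lin_sum tl) (bigD1 k) //= (bigD1 l) //= tk tl1.
rewrite addrA => /eqP; rewrite -subr_eq0 addrAC addrK => /eqP s0.
have : (1 : R[i]) <= 0.
  rewrite -s0 lerDl; apply: sumr_ge0 => m _; apply: trace_proj_ge0 => //.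
    exact: (blockunit_star E).
  exact: (blockunit_idem E).
by rewrite ler10.
Qed.

Definition agree n s t := forall k, s (z n k) = t (z n k).

Lemma agree_le m n s t : tracial_states s -> tracial_states t -> (m <= n)%N ->
  agree n s t -> agree m s t.
Proof.
move=> [sl _ _ _] [tl _ _ _] mn st; rewrite -(subnK mn) in st.
elim: (n - m)%N st => [//|d IH] st; apply: IH => k.
by rewrite (tw_pa W) (lin_sum sl) (lin_sum tl); apply: eq_bigr => l _; apply: st.
Qed.

Lemma thread_choice (G : forall m, K m -> Prop) : (exists l, G 0%N l) ->
  (forall m l, G m l -> exists l', pa m l' = l /\ G m.+1 l') ->
  exists nu : forall m, K m, (forall m, pa m (nu m.+1) = nu m) /\ forall m, G m (nu m).
Proof.
move=> /cid [l0 g0] step.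
pose S m := {l : K m | G m l}.
have next m (x : S m) : {y : S m.+1 | pa m (sval y) = sval x}.
  have /cid [l' [pl gl]] := step m (sval x) (svalP x).
  by exists (exist _ l' gl).
pose nu := fix nu m : S m := match m with 0%N => exist _ l0 g0 | m'.+1 => sval (next m' (nu m')) end.
exists (fun m => sval (nu m)); split=> m; last exact: svalP.
exact: (svalP (next m (nu m))).
Qed.

Lemma thread_trace (nu : forall m, K m) : (forall m, pa m (nu m.+1) = nu m) ->
  exists t, pure t /\ forall n k, t (z n k) = (k == nu n)%:R.
Proof.
move=> pn; have [|||t [ht tE]] := @trace_of_weights R T _ _ _ _ _ W (fun n k => (k == nu n)%:R).
- by move=> n k; apply: ler0n.
- rewrite (bigD1 (nu 0%N)) //= eqxx big1 ?addr0 // => k /negPf ->; by [].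
- move=> n k; rewrite -pn; have [->|kn] := eqVneq k (pa n (nu n.+1)).
    rewrite (bigD1 (nu n.+1)) //= eqxx big1 ?addr0 // => l /andP[_ /negPf ->]; by [].
  rewrite big1 // => l /eqP pl; case: eqVneq => // ln.
  by rewrite -pl ln eqxx in kn.
have tE' n k : t (z n k) = (k == nu n)%:R by rewrite tE; case: eqP.
exists t; split=> //; split=> // n k; rewrite tE'.
by case: (k == nu n); [right|left].
Qed.

(** A branch through k: at every level pick a block that meets k. *)
Lemma thread_through n k : exists t, pure t /\ t (z n k) = 1.
Proof.
have [||nu [pn gn]] := @thread_choice (fun m l => z m l * z n k != 0).
- apply/not_existsP => h; have := blockunit_neq0 (tw_mu W n) k.
  rewrite -[z n k]mul1r -(blockunit_sum (tw_mu W 0%N)) mulr_suml big1 ?eqxx // => l _.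
  by apply/eqP; apply: contraT => /h.
- move=> m l; rewrite (tw_pa W) => h.
  apply/not_existsP => h'; move: h; rewrite mulr_suml big1 ?eqxx // => l' /eqP pl.
  by apply/eqP; apply: contraT => h''; case: (h' l').
have [t [ht tE]] := thread_trace pn; exists t; split=> //; rewrite tE.
suff -> : nu n = k by rewrite eqxx.
apply/eqP; apply: contraTT (gn n) => /negPf h.
by rewrite (blockunitM (tw_mu W n)) h scale0r eqxx.
Qed.

(** Koenig's lemma: a locally constant predicate on branches only depends on a
    finite part of the branch. *)
Lemma locally_constant_uniform (h : (T -> R[i]^o) -> Prop) :
  (forall x, pure x -> exists n, forall x', pure x' -> agree n x' x -> (h x' <-> h x)) ->
  exists n, forall x x', pure x -> pure x' -> agree n x x' -> (h x <-> h x').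
Proof.
move=> loc; apply: contrapT => /forallNP nu.
have bad n : exists x x', [/\ pure x, pure x', agree n x x', h x & ~ h x'].
  apply: contrapT => h0; apply: (nu n) => x x' px px' xx.
  split=> hx; apply: contrapT => hx'; apply: h0; first by exists x, x'.
  by exists x', x; split=> // k; rewrite xx.
(* Blocks l such that arbitrarily deep agreement below l does not decide h. *)
pose B N m l x x' := [/\ pure x, pure x', agree N x x', h x & ~ h x'] /\ x (z m l) = 1.
have [||th [pth Gth]] := @thread_choice (fun m l => forall N, exists x x', B N m l x x').
- apply: contrapT => /forallNP hn.
  have hn' l : exists N, ~ exists x x', B N 0%N l x x'.
    by apply: contrapT => /forallNP k; apply: (hn l) => N; apply: contrapT => /k.
  have [N hN] := choice hn'.
  have [x [x' [px px' xx hx hx']]] := bad (\max_l N l)%N.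
  have [l xl] := pure_node 0 px.
  apply: (hN l); exists x, x'; split; last by rewrite xl eqxx.
  split=> //; by apply: agree_le xx; [case: px|case: px'|apply: leq_bigmax].
- move=> m l Gl; apply: contrapT => /forallNP hn.
  have hn' l' : exists N, pa m l' = l -> ~ exists x x', B N m.+1 l' x x'.
    have [pl|pl] := eqVneq (pa m l') l; last by exists 0%N => /eqP; rewrite (negPf pl).
    have /existsNP [N hN] : ~ forall N, exists x x', B N m.+1 l' x x'.
      by move=> k; apply: (hn l').
    by exists N.
  have [N hN] := choice hn'.
  have [x [x' [[px px' xx hx hx'] xl]]] := Gl (\max_l N l)%N.
  have [l' xl'] := pure_node m.+1 px.
  apply: (hN l'); last first.
    exists x, x'; split; last by rewrite xl' eqxx.
    split=> //; by apply: agree_le xx; [case: px|case: px'|apply: leq_bigmax].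
  have [[xlin _ _ _] _] := px.
  apply/eqP; apply: contraT => pl; have := xl.
  rewrite (tw_pa W) (lin_sum xlin) big1 => [/eqP|l'' pl'']; first by rewrite eq_sym oner_eq0.
  by rewrite xl'; case: eqP => // ll; rewrite ll (negPf pl) in pl''.
have [x0 [px0 x0E]] := thread_trace pth.
have [n hn] := loc x0 px0.
have [x [x' [[px px' xx hx hx'] xl]]] := Gth n n.
have [k xk] := pure_node n px.
have kE : th n = k.
  by apply/eqP; apply: contraT => ne; move: xl; rewrite xk (negPf ne) => /esym/eqP; rewrite oner_eq0.
have ax : agree n x x0 by move=> l; rewrite xk x0E kE.
have ax' : agree n x' x0 by move=> l; rewrite -xx ax.
by apply: hx'; apply/(hn x' px' ax')/(hn x px ax).
Qed.

End PureTraces.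

Section CentralElements.
Context (R : realType) (T : cstarAlgType R) (I K : nat -> finType) (b : forall n, I n -> K n)
  (e : forall n, I n -> I n -> T) (pa : forall n, K n.+1 -> K n).
Arguments b : clear implicits.
Arguments e : clear implicits.
Arguments pa : clear implicits.
Hypothesis W : tower b e pa.
Local Notation z n k := (blockunit (b n) (e n) k).

(** Locally constant functions on the boundary of the forest. *)
Definition central_at n (x : T) : Prop := exists v : K n -> R[i], x = \sum_k v k *: z n k.

Lemma central_at_le m n x : (m <= n)%N -> central_at m x -> central_at n x.
Proof.
move=> mn; rewrite -(subnK mn); elim: (n - m)%N => [//|d IH] /IH [v ->].
exists (fun l => v (pa _ l)).
rewrite [RHS](partition_big (pa (d + m)%N) xpredT) //=; apply: eq_bigr => k _.
by rewrite (tw_pa W) scaler_sumr; apply: eq_bigr => l /eqP ->.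
Qed.

Lemma central_at_sumz n (S : pred (K n)) : central_at n (\sum_(k | S k) z n k).
Proof.
exists (fun k => (S k)%:R); rewrite big_mkcond; apply: eq_bigr => k _.
by case: (S k); rewrite ?scale1r ?scale0r.
Qed.

Lemma central_at_sum n (J : Type) (r : seq J) (P : pred J) (F : J -> T) :
  (forall j, P j -> central_at n (F j)) -> central_at n (\sum_(j <- r | P j) F j).
Proof.
move=> h; elim/big_ind: _ => // [|x y [v ->] [w ->]].
  by exists (fun _ => 0); rewrite big1 // => k _; rewrite scale0r.
by exists (fun k => v k + w k); rewrite -big_split; apply: eq_bigr => k _; rewrite scalerDl.
Qed.

Lemma central_atM n (v w : K n -> R[i]) :
  (\sum_k v k *: z n k) * (\sum_k w k *: z n k) = \sum_k (v k * w k) *: z n k.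
Proof.
rewrite mulr_suml; apply: eq_bigr => k _; rewrite mulr_sumr (bigD1 k) //= big1 => [|l lk].
  by rewrite addr0 -scalerAl -scalerAr (blockunit_idem (tw_mu W n)) cscalerA.
rewrite -scalerAl -scalerAr (blockunitM (tw_mu W n)) eq_sym (negPf lk).
by rewrite scale0r !scaler0.
Qed.

Lemma central_at_mul n x y : central_at n x -> central_at n y -> central_at n (x * y).
Proof. by move=> [v ->] [w ->]; rewrite central_atM; eexists. Qed.

(** A pure trace is evaluation at a point of the boundary. *)
Lemma pure_eval t n : pure b e t -> exists k, forall v, t (\sum_l v l *: z n l) = v k.
Proof.
move=> pt; have [k tk] := pure_node W n pt; have [[tl _ _ _] _] := pt.
exists k => v; rewrite (lin_sum tl) (bigD1 k) //= big1 => [|l lk]; rewrite (linZ tl) tk.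
  by rewrite eqxx addr0 -[LHS]/(_ * _) mulr1.
by rewrite (negPf lk) scaler0.
Qed.

Lemma pure_central t n x y : pure b e t -> central_at n x -> central_at n y ->
  t (x * y) = t x * t y.
Proof.
move=> pt [v ->] [w ->]; have [k ev] := pure_eval n pt.
by rewrite central_atM !ev.
Qed.

Lemma central_eq m n x y : central_at m x -> central_at n y ->
  (forall t, pure b e t -> t x = t y) -> x = y.
Proof.
move=> cx cy h.
have [v xE] := central_at_le (leq_maxl m n) cx.
have [w yE] := central_at_le (leq_maxr m n) cy.
rewrite xE yE; apply: eq_bigr => k _; congr (_ *: _).
have [t [pt tk]] := thread_through W k.
have [k' ev] := pure_eval (maxn m n) pt.
have kk : k = k'.
  apply/eqP; apply: contraT => ne; have := ev (fun l => (l == k)%:R).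
  rewrite (bigD1 k) //= eqxx scale1r big1 => [|l /negPf ->]; last by rewrite scale0r.
  by rewrite addr0 tk eq_sym (negPf ne) => /eqP; rewrite oner_eq0.
rewrite kk; have := h t pt; by rewrite xE yE !ev.
Qed.

Lemma central_at_central n x y : central_at n x -> x * y = y * x.
Proof.
move=> [v ->]; rewrite mulr_suml mulr_sumr; apply: eq_bigr => k _.
by rewrite -scalerAl -scalerAr (tw_central W).
Qed.

End CentralElements.

Section Matching.
Context (R : realType) (T1 T2 : cstarAlgType R).
Context (I1 K1 : nat -> finType) (b1 : forall n, I1 n -> K1 n)
  (e1 : forall n, I1 n -> I1 n -> T1) (pa1 : forall n, K1 n.+1 -> K1 n).
Context (I2 K2 : nat -> finType) (b2 : forall n, I2 n -> K2 n)
  (e2 : forall n, I2 n -> I2 n -> T2) (pa2 : forall n, K2 n.+1 -> K2 n).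
Arguments b1 : clear implicits.
Arguments e1 : clear implicits.
Arguments pa1 : clear implicits.
Arguments b2 : clear implicits.
Arguments e2 : clear implicits.
Arguments pa2 : clear implicits.
Hypotheses (W1 : tower b1 e1 pa1) (W2 : tower b2 e2 pa2).
Local Notation z1 n k := (blockunit (b1 n) (e1 n) k).
Local Notation z2 n k := (blockunit (b2 n) (e2 n) k).

Lemma affine_extreme (f : {ptws T1 -> R[i]^o} -> {ptws T2 -> R[i]^o})
    (g : {ptws T2 -> R[i]^o} -> {ptws T1 -> R[i]^o}) :
  (forall s, tracial_states s -> tracial_states (f s)) ->
  (forall t, tracial_states t -> tracial_states (g t)) ->
  (forall s, tracial_states s -> g (f s) = s) ->
  (forall t, tracial_states t -> f (g t) = t) ->
  (forall (c : R) s1 s2, 0 <= c <= 1 -> tracial_states s1 -> tracial_states s2 ->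
        g (convex_comb c s1 s2) = convex_comb c (g s1) (g s2)) ->
  forall s, extreme s -> extreme (f s).
Proof.
move=> fS gS gf fg aff s [hs hext]; split; first exact: fS.
move=> c u1 u2 c01 h1 h2 e.
have c01' : 0 <= c <= 1 by case/andP: c01 => /ltW -> /ltW ->.
rewrite -(fg _ h1); congr (f _).
by apply: (hext c _ (g u2) c01); rewrite -?aff -?e ?gf //; apply: gS.
Qed.

(** A continuous map between trace simplices that preserves pure traces pulls a
    block of the second forest back to a clopen set, that is, to a finite union
    of blocks of the first. *)
Lemma clopen_transport (f : {ptws T1 -> R[i]^o} -> {ptws T2 -> R[i]^o}) :
  {within @tracial_states R T1, continuous f} ->
  (forall s, pure b1 e1 s -> pure b2 e2 (f s)) ->
  forall m l, exists n (S : pred (K1 n)), forall s, pure b1 e1 s ->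
    f s (z2 m l) = s (\sum_(k | S k) z1 n k).
Proof.
move=> cf fp m l.
pose h (s : T1 -> R[i]^o) := f s (z2 m l) = 1.
have [x px|n hn] := @locally_constant_uniform R T1 I1 K1 b1 e1 pa1 W1 h.
  apply: contrapT => /forallNP nloc.
  have ex n : exists x', [/\ pure b1 e1 x', agree b1 e1 n x' x & ~ (h x' <-> h x)].
    apply: contrapT => h0; apply: (nloc n) => x' px' ag; apply: contrapT => hx.
    by apply: h0; exists x'.
  have [u hu] := choice ex.
  have [tx _] := px.
  have tu n : tracial_states (u n) by case: (hu n) => -[].
  have conv : forall a (eps : R), 0 < eps -> exists N, forall n, (N <= n)%N ->
      md (x a - u n a : R[i]) < eps.
    move=> a eps e0.
    have e8 : 0 < eps / 8 by rewrite divr_gt0.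
    have [N [y [[v ->] ay]]] := tw_dense W1 a e8.
    exists N => n Nn; have [[xl _ _ xM] _] := px; have [ul _ _ uM] := tu n.
    have ag : agree b1 e1 N (u n) x.
      by apply: (agree_le W1 _ _ Nn) => //; case: (hu n).
    have same : x (lincomb (e1 N) v) = u n (lincomb (e1 N) v).
      rewrite (trace_lincomb (tw_mu W1 N) _ xl xM) (trace_lincomb (tw_mu W1 N) _ ul uM).
      by apply: eq_bigr => i _; rewrite ag.
    have -> : x a - u n a = x (a - lincomb (e1 N) v) - u n (a - lincomb (e1 N) v) :> R[i].
      by rewrite (linB xl) (linB ul) same opprB addrA subrK.
    apply: le_lt_trans (mdD _ _) _; rewrite mdN.
    have := tw_trace_bounded tx (a - lincomb (e1 N) v).
    have := tw_trace_bounded (tu n) (a - lincomb (e1 N) v); lra.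
  have [N hN] := traces_sequential cf tu tx conv (z2 m l) (ltr01 : 0 < 1 :> R).
  have [_ _ neq] := hu N; apply: neq.
  have := hN N (leqnn N); rewrite /h.
  have [_ p1] := fp _ px; have [_ p2] : pure b2 e2 (f (u N)) by apply: fp; case: (hu N).
  by case: (p1 m l) => ->; case: (p2 m l) => -> //; rewrite ?subr0 ?sub0r ?mdN md1 ltxx.
pose S k := `[< exists x, [/\ pure b1 e1 x, x (z1 n k) = 1 & h x] >].
exists n, S => s ps; have [k sk] := pure_node W1 n ps; have [[sl _ _ _] _] := ps.
have -> : s (\sum_(k | S k) z1 n k) = (S k)%:R.
  rewrite (lin_sum sl) big_mkcond (bigD1 k) //= big1 => [|j jk].
    by rewrite addr0; case: (S k); rewrite // sk eqxx.
  by case: (S j); rewrite // sk (negPf jk).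
have [_ /(_ m l) pf] := fp _ ps.
rewrite /S; case: asboolP => [[x [px xk hx]]|hS].
  have ag : agree b1 e1 n x s.
    have [k' xk'] := pure_node W1 n px.
    have kk : k = k'.
      by apply/eqP; apply: contraT => ne; move: xk; rewrite xk' (negPf ne) => /esym/eqP; rewrite oner_eq0.
    by move=> j; rewrite xk' sk kk.
  exact: (proj1 (hn x s px ps ag) hx).
case: pf => // pf1; exfalso; apply: hS; exists s; split=> //.
by rewrite sk eqxx.
Qed.

End Matching.

Section PartitionSystems.
Context (R : realType).

(** A decreasing sequence of finite partitions of the unit into central
    projections, indexed by a forest. *)
Record partition_system (T : cstarAlgType R) (K : nat -> finType)
    (pa : forall n, K n.+1 -> K n) (z : forall n, K n -> T) : Prop := PartitionSystem {
  ps_star : forall n k, star (z n k) = z n k;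
  ps_mul : forall n k l, z n k * z n l = (k == l)%:R *: z n l;
  ps_sum : forall n, \sum_k z n k = 1;
  ps_neq0 : forall n k, z n k != 0;
  ps_central : forall n k x, z n k * x = x * z n k;
  ps_pa : forall n k, z n k = \sum_(l | pa n l == k) z n.+1 l }.

Lemma tower_partition_system (T : cstarAlgType R) (I K : nat -> finType)
    (b : forall n, I n -> K n) (e : forall n, I n -> I n -> T) (pa : forall n, K n.+1 -> K n) :
  tower b e pa -> partition_system pa (fun n k => blockunit (@b n) (@e n) k).
Proof.
move=> W; split=> n *.
- exact: (blockunit_star (tw_mu W n)).
- exact: (blockunitM (tw_mu W n)).
- exact: (blockunit_sum (tw_mu W n)).
- exact: (blockunit_neq0 (tw_mu W n)).
- exact: (tw_central W).
- exact: (tw_pa W).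
Qed.

Context (T1 T2 : cstarAlgType R).
Context (I1 K1 : nat -> finType) (b1 : forall n, I1 n -> K1 n)
  (e1 : forall n, I1 n -> I1 n -> T1) (pa1 : forall n, K1 n.+1 -> K1 n).
Context (I2 K2 : nat -> finType) (b2 : forall n, I2 n -> K2 n)
  (e2 : forall n, I2 n -> I2 n -> T2) (pa2 : forall n, K2 n.+1 -> K2 n).
Arguments b1 : clear implicits.
Arguments e1 : clear implicits.
Arguments pa1 : clear implicits.
Arguments b2 : clear implicits.
Arguments e2 : clear implicits.
Arguments pa2 : clear implicits.
Hypotheses (W1 : tower b1 e1 pa1) (W2 : tower b2 e2 pa2).
Local Notation z1 n k := (blockunit (b1 n) (e1 n) k).
Local Notation z2 n k := (blockunit (b2 n) (e2 n) k).

(** An affine homeomorphism of trace simplices restricts to the extreme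
    boundaries, hence carries the partitions of the first algebra to partitions
    of the second; two locally constant functions on the boundary agree when all
    pure traces agree on them. *)
Lemma central_matching : traces_iso T1 T2 -> exists zeta : forall n, K1 n -> T2,
  partition_system pa1 zeta /\
  forall m l, exists n (S : pred (K1 n)), z2 m l = \sum_(k | S k) zeta n k.
Proof.
move=> tiso; have [g [f [[gS fS] [fg gf] cg cf gaff]]] := traces_iso_sym tiso.
have faff : forall (c : R) s1 s2, 0 <= c <= 1 -> tracial_states s1 -> tracial_states s2 ->
        f (convex_comb c s1 s2) = convex_comb c (f s1) (f s2).
  move=> c s1 s2 c01 h1 h2; rewrite -{1}(gf s1) // -{1}(gf s2) // -gaff ?fg //; do ?exact: fS.
  by apply: convex_comb_tracial => //; apply: fS.
have fp s : pure b1 e1 s -> pure b2 e2 (f s).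
  move=> ps; apply: (extreme_pure W2); apply: (affine_extreme fS gS gf fg gaff).
  exact: (pure_extreme W1).
have gp s : pure b2 e2 s -> pure b1 e1 (g s).
  move=> ps; apply: (extreme_pure W1); apply: (affine_extreme gS fS fg gf faff).
  exact: (pure_extreme W2).
have ex n k : exists x, [/\ exists m, central_at b2 e2 m x, star x = x &
    forall s, pure b2 e2 s -> s x = g s (z1 n k)].
  have [m [S hS]] := clopen_transport W2 cg gp k.
  exists (\sum_(l | S l) z2 m l); split; first by exists m; apply: central_at_sumz.
    by rewrite star_sum; apply: eq_bigr => l _; apply: (blockunit_star (tw_mu W2 m)).
  by move=> s /hS ->.
pose zeta n k := projT1 (cid (ex n k)).
have zeta_spec n k : [/\ exists m, central_at b2 e2 m (zeta n k), star (zeta n k) = zeta n k &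
    forall s, pure b2 e2 s -> s (zeta n k) = g s (z1 n k)] := projT2 (cid (ex n k)).
have zc n k : exists m, central_at b2 e2 m (zeta n k) by case: (zeta_spec n k).
have zE n k s : pure b2 e2 s -> s (zeta n k) = g s (z1 n k).
  by case: (zeta_spec n k) => _ _; apply.
have [lv hlv] : exists lv : forall n, K1 n -> nat, forall n k, central_at b2 e2 (lv n k) (zeta n k).
  by exists (fun n k => projT1 (cid (zc n k))) => n k; case: (cid _).
have lev n (P : pred (K1 n)) : central_at b2 e2 (\max_k lv n k) (\sum_(k | P k) zeta n k).
  apply: central_at_sum => k _; apply: (central_at_le W2) (hlv n k).
  exact: leq_bigmax.
have c1 : central_at b2 e2 0 1.
  rewrite -(blockunit_sum (tw_mu W2 0%N)); exact: (central_at_sumz b2 e2 xpredT).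
have ze01 n k s : pure b2 e2 s -> (s (zeta n k) : R[i]) = 0 \/ (s (zeta n k) : R[i]) = 1.
  by move=> ps; rewrite zE //; have [_ /(_ n k)] := gp s ps.
have zeM n k l s : pure b2 e2 s -> s (zeta n k * zeta n l) = (k == l)%:R * s (zeta n l) :> R[i].
  move=> ps; pose m := maxn (lv n k) (lv n l).
  rewrite (pure_central W2 ps (n := m)); first last.
  - by apply: (central_at_le W2) (hlv n l); apply: leq_maxr.
  - by apply: (central_at_le W2) (hlv n k); apply: leq_maxl.
  have [j gj] := pure_node W1 n (gp s ps).
  rewrite !zE // !gj; have [->|kj] := eqVneq k j; last first.
    by rewrite mul0r; case: eqVneq => [<-|_]; rewrite ?(negPf kj) ?mulr0 ?mul0r.
  by rewrite mul1r eq_sym; case: eqVneq; rewrite ?mulr1 ?mulr0.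
exists zeta; split; last first.
  move=> m l; have [n [S hS]] := clopen_transport W1 cf fp l.
  exists n, S; apply: (central_eq W2 (m := m) (n := \max_k lv n k)%N) => //.
    exists (fun k => (k == l)%:R); rewrite (bigD1 l) //= eqxx scale1r big1 ?addr0 // => k kl.
    by rewrite (negPf kl) scale0r.
  move=> s ps; have [tsl _ _ _] : tracial_states s by case: ps.
  have pg := gp s ps; have [[gl _ _ _] _] := pg.
  have -> : s (z2 m l) = f (g s) (z2 m l) by rewrite fg //; case: ps.
  rewrite (hS _ pg) (lin_sum gl) (lin_sum tsl).
  by apply: eq_bigr => k _; rewrite zE.
split.
- by move=> n k; case: (zeta_spec n k).
- move=> n k l; pose m := maxn (lv n k) (lv n l).
  have ck : central_at b2 e2 m (zeta n k) by apply: (central_at_le W2) (hlv n k); apply: leq_maxl.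
  have cl : central_at b2 e2 m (zeta n l) by apply: (central_at_le W2) (hlv n l); apply: leq_maxr.
  apply: (central_eq W2 (m := m) (n := m)).
  + exact: (central_at_mul W2).
  + by have [v ->] := cl; exists (fun j => (k == l)%:R * v j); rewrite scaler_sumr;
      apply: eq_bigr => j _; rewrite cscalerA.
  + by move=> s ps; have [[sl _ _ _] _] := ps; rewrite zeM // (linZ sl).
- move=> n; apply: (central_eq W2 (lev n xpredT) c1) => s ps.
  have [[sl _ s1 _] _] := ps; have [[gl _ g1 _] _] := gp s ps.
  rewrite (lin_sum sl) s1 -g1 -(blockunit_sum (tw_mu W1 n)) (lin_sum gl).
  by apply: eq_bigr => k _; rewrite zE.
- move=> n k; have [s [ps sk]] := thread_through W1 k.
  apply/eqP => z0; have := zE n k (f s) (fp s ps); have [ts _] := ps.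
  have [[fl _ _ _] _] := fp s ps.
  by rewrite z0 (lin0 fl) gf // sk => /esym/eqP; rewrite oner_eq0.
- move=> n k x; exact: (central_at_central W2 x (hlv n k)).
- move=> n k; apply: (central_eq W2 (hlv n k) (lev n.+1 _)) => s ps.
  have [[sl _ _ _] _] := ps; have [[gl _ _ _] _] := gp s ps.
  rewrite (lin_sum sl) zE // (tw_pa W1) (lin_sum gl).
  by apply: eq_bigr => l _; rewrite zE.
Qed.

End PartitionSystems.

(** * Intertwining *)

Section PairSpan.
Context (R : realType) (T1 T2 : cstarAlgType R).

(** The graph of the linear map sending one system of matrix units to another. *)
Definition pspan (I : finType) (e1 : I -> I -> T1) (e2 : I -> I -> T2) (x : T1) (y : T2) : Prop :=
  exists a, x = lincomb e1 a /\ y = lincomb e2 a.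

Section Span.
Context (I : finType) (e1 : I -> I -> T1) (e2 : I -> I -> T2).

Lemma pspan_unit i j : pspan e1 e2 (e1 i j) (e2 i j).
Proof. by exists (fun k l => ((k == i) && (l == j))%:R); rewrite !lincomb1. Qed.

Lemma pspanD x y x' y' : pspan e1 e2 x y -> pspan e1 e2 x' y' -> pspan e1 e2 (x + x') (y + y').
Proof. by move=> [a [-> ->]] [c [-> ->]]; rewrite !lincombD; eexists. Qed.

Lemma pspanZ c x y : pspan e1 e2 x y -> pspan e1 e2 (c *: x) (c *: y).
Proof. by move=> [a [-> ->]]; rewrite !lincombZ; eexists. Qed.

Lemma pspan_sum (A : Type) (r : seq A) (P : pred A) (F : A -> T1) (G : A -> T2) :
  (forall s, P s -> pspan e1 e2 (F s) (G s)) ->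
  pspan e1 e2 (\sum_(s <- r | P s) F s) (\sum_(s <- r | P s) G s).
Proof.
move=> h; elim/big_ind2: _ => //; last by move=> x1 x2 y1 y2; apply: pspanD.
exists (fun _ _ => 0); rewrite /lincomb; split; rewrite big1 // => i _; rewrite big1 // => j _;
  by rewrite scale0r.
Qed.

End Span.

Lemma pspan_sub (I J : finType) (e1 : I -> I -> T1) (e2 : I -> I -> T2)
    (f1 : J -> J -> T1) (f2 : J -> J -> T2) :
  (forall i j, pspan f1 f2 (e1 i j) (e2 i j)) ->
  forall x y, pspan e1 e2 x y -> pspan f1 f2 x y.
Proof.
move=> h x y [a [-> ->]]; rewrite /lincomb.
by apply: pspan_sum => i _; apply: pspan_sum => j _; apply: pspanZ.
Qed.

Lemma pspanl (I : finType) (e1 : I -> I -> T1) (e2 : I -> I -> T2) x y :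
  pspan e1 e2 x y -> mxspan e1 x.
Proof. by move=> [a [-> _]]; exists a. Qed.

Lemma pspanr (I : finType) (e1 : I -> I -> T1) (e2 : I -> I -> T2) x y :
  pspan e1 e2 x y -> mxspan e2 y.
Proof. by move=> [a [_ ->]]; exists a. Qed.

End PairSpan.

Section Cut.
Context (R : realType).

Lemma cut_mxunits (T : cstarAlgType R) (K D : finType) (z : K -> T) (g : D -> D -> T) :
  (forall k, star (z k) = z k) -> (forall k l, z k * z l = (k == l)%:R *: z l) ->
  \sum_k z k = 1 -> (forall k, z k != 0) -> (forall k x, z k * x = x * z k) ->
  cunits 1 g -> mxunits (fun p : K * D => p.1) (cutunit z g).
Proof.
move=> zs zm z1 z0 zC G.
have pr k l a c c' d : z k * g a c * (z l * g c' d) = (k == l)%:R *: (z l * (g a c * g c' d)).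
  by rewrite -mulrA (mulrA (g a c)) -zC !mulrA zm -!scalerAl.
split.
- move=> k; have /card_gt0P [a _] := cunits_card G; by exists (k, a).
- move=> [k a] [l c]; rewrite /cutunit /= starZ conjC_nat starM zs (cu_star G) -zC eq_sym.
  by case: eqVneq => [->|_] //; rewrite !scale0r.
- by move=> [k a] [l c] /= kl; rewrite /cutunit /= (negPf kl) scale0r.
- move=> [k a] [l c] [m d] /= <-; rewrite /cutunit /= eqxx scale1r -scalerAr pr eqxx scale1r.
  by rewrite (cu_mul G).
- move=> [k a] [l c] [l' c'] [m d]; rewrite xpair_eqE negb_and /cutunit /= -scalerAl -scalerAr pr.
  case/orP => h; last by rewrite (cu_mul0 G) // mulr0 !scaler0.
  have [->|_] := eqVneq k l; last by rewrite scale0r.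
  by rewrite (negPf h) scale0r !scaler0.
- rewrite -(pair_bigA _ (fun k a => cutunit z g (k, a) (k, a))) /= -z1; apply: eq_bigr => k _.
  rewrite -[RHS]mulr1 -(cu_sum G) mulr_sumr; apply: eq_bigr => a _.
  by rewrite /cutunit /= eqxx scale1r.
- move=> [k a]; rewrite /cutunit /= eqxx scale1r; apply: contraNneq (z0 k) => h.
  rewrite -[z k]mulr1 -(cu_sum G) mulr_sumr big1 // => c _.
  by rewrite -(cu_mul G c a c) -(cu_mul G a a c) mulrA zC -!mulrA (mulrA (z k)) h mul0r mulr0.
Qed.

Context (T1 T2 : cstarAlgType R).

Lemma cut_refine (K D D' : finType) (z1 : K -> T1) (z2 : K -> T2)
    (g1 : D -> D -> T1) (g2 : D -> D -> T2) (f1 : D' -> D' -> T1) (f2 : D' -> D' -> T2) :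
  (forall a c, pspan f1 f2 (g1 a c) (g2 a c)) ->
  forall p q, pspan (cutunit z1 f1) (cutunit z2 f2) (cutunit z1 g1 p q) (cutunit z2 g2 p q).
Proof.
move=> h [k a] [l c]; rewrite {3}/cutunit {3}/cutunit /=; apply: pspanZ.
have [v [-> ->]] := h a c; rewrite /lincomb !mulr_sumr; apply: pspan_sum => x _.
rewrite !mulr_sumr; apply: pspan_sum => y _; rewrite -!scalerAr; apply: pspanZ.
have := pspan_unit (cutunit z1 f1) (cutunit z2 f2) (k, x) (k, y).
by rewrite {3}/cutunit {3}/cutunit /= eqxx !scale1r.
Qed.

Lemma cut_next (D : finType) (K : nat -> finType) (pa : forall n, K n.+1 -> K n)
    (z1 : forall n, K n -> T1) (z2 : forall n, K n -> T2) (g1 : D -> D -> T1) (g2 : D -> D -> T2) n :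
  partition_system pa z1 -> partition_system pa z2 ->
  forall p q, pspan (cutunit (@z1 n.+1) g1) (cutunit (@z2 n.+1) g2)
    (cutunit (@z1 n) g1 p q) (cutunit (@z2 n) g2 p q).
Proof.
move=> P1 P2 [k a] [l c]; rewrite {3}/cutunit {3}/cutunit /=; apply: pspanZ.
rewrite (ps_pa P1) (ps_pa P2) !mulr_suml; apply: pspan_sum => j _.
have := pspan_unit (cutunit (@z1 n.+1) g1) (cutunit (@z2 n.+1) g2) (j, a) (j, c).
by rewrite {3}/cutunit {3}/cutunit /= eqxx !scale1r.
Qed.

End Cut.

Section HalfStep.
Context (R : realType) (T1 T2 : cstarAlgType R).
Context (I1 K1 : nat -> finType) (b1 : forall n, I1 n -> K1 n)
  (e1 : forall n, I1 n -> I1 n -> T1) (pa1 : forall n, K1 n.+1 -> K1 n).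
Context (I2 K2 : nat -> finType) (b2 : forall n, I2 n -> K2 n)
  (e2 : forall n, I2 n -> I2 n -> T2) (pa2 : forall n, K2 n.+1 -> K2 n).
Arguments b1 : clear implicits.
Arguments e1 : clear implicits.
Arguments pa1 : clear implicits.
Arguments b2 : clear implicits.
Arguments e2 : clear implicits.
Arguments pa2 : clear implicits.
Hypotheses (W1 : tower b1 e1 pa1) (W2 : tower b2 e2 pa2).
Hypotheses (ab1 : absorbing e1) (ab2 : absorbing e2).

(** A pair of equal-size unital matrix algebras, one in each tower. *)
Record matched (J : finType) (f1 : J -> J -> T1) (f2 : J -> J -> T2) : Prop := Matched {
  md_units1 : cunits 1 f1;
  md_units2 : cunits 1 f2;
  md_span1 : exists m, forall i j, mxspan (e1 m) (f1 i j);
  md_span2 : exists m, forall i j, mxspan (e2 m) (f2 i j) }.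

(** Refine the system in the first tower until it spans a stage together with the
    block units, and tensor the system in the second tower with a commuting one of
    the size that this takes. *)
Lemma half_step (J : finType) (f1 : J -> J -> T1) (f2 : J -> J -> T2) n : matched f1 f2 ->
  exists (J' : finType) (g1 : J' -> J' -> T1) (g2 : J' -> J' -> T2),
    [/\ matched g1 g2, forall i j, pspan g1 g2 (f1 i j) (f2 i j) &
      exists n1, forall x, mxspan (e1 n) x ->
        mxspan (cutunit (blockunit (b1 n1) (e1 n1)) g1) x].
Proof.
move=> [F1 F2 [m1 s1] [m2 s2]].
have s1' i j : mxspan (e1 (maxn n m1)) (f1 i j) by apply: (tw_incn W1 (leq_maxr n m1)).
have [M [m1' [g1 [M0 G1 sg1 fg1 span1]]]] := forth_stage W1 ab1 F1 s1'.
have [m2' [g2 [G2 sg2 fg2]]] := forth_other W2 ab2 F2 s2 M0.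
exists (J * M)%type, g1, g2; split.
- by split=> //; [exists m1'|exists m2'].
- move=> i j; rewrite fg1 fg2; apply: pspan_sum => s _; exact: pspan_unit.
- exists (maxn n m1) => x sx; apply: span1; exact: (tw_incn W1 (leq_maxl n m1)).
Qed.

End HalfStep.

(** An isometric *-isomorphism between dense *-subalgebras, presented as a
    relation, extends to the completions. *)
Section ExtendIso.
Context (R : realType) (T1 T2 : cstarAlgType R) (G : T1 -> T2 -> Prop).
Hypotheses (Glin : forall c x y x' y', G x y -> G x' y' -> G (c *: x + x') (c *: y + y'))
  (GM : forall x y x' y', G x y -> G x' y' -> G (x * x') (y * y'))
  (GS : forall x y, G x y -> G (star x) (star y))
  (Gnorm : forall x y, G x y -> cnorm x = cnorm y)
  (Gd1 : forall x eps, 0 < eps -> exists x' y', G x' y' /\ cnorm (x - x') < eps)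
  (Gd2 : forall y eps, 0 < eps -> exists x' y', G x' y' /\ cnorm (y - y') < eps).

Lemma extend_iso : cstar_iso T1 T2.
Proof.
have HN1 := complete_norm_cnorm T1; have HN2 := complete_norm_cnorm T2.
have [||||h [hl hG hb]] := @bounded_extension R T1 T2 (@cnorm R T1) (@cnorm R T2)
  (complete_norm_cnorm T1) (complete_norm_cnorm T2) (@cnormZr R T1) (@cnormZr R T2) G 1.
- exact: ler01.
- exact: Glin.
- by move=> x y /Gnorm ->; rewrite mul1r.
- exact: Gd1.
have [||||k [kl kG kb]] := @bounded_extension R T2 T1 (@cnorm R T2) (@cnorm R T1)
  (complete_norm_cnorm T2) (complete_norm_cnorm T1) (@cnormZr R T2) (@cnormZr R T1)
  (fun y x => G x y) 1.
- exact: ler01.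
- by move=> c y x y' x'; apply: Glin.
- by move=> y x /Gnorm ->; rewrite mul1r.
- by move=> y eps /(Gd2 y) [x' [y' [g yy]]]; exists y', x'.
pose S1 x := exists y, G x y; pose S2 y := exists x, G x y.
have d1 x eps : 0 < eps -> exists2 x', S1 x' & cnorm (x - x') < eps.
  by move=> /(Gd1 x) [x' [y' [g xx]]]; exists x' => //; exists y'.
have d2 y eps : 0 < eps -> exists2 y', S2 y' & cnorm (y - y') < eps.
  by move=> /(Gd2 y) [x' [y' [g yy]]]; exists y' => //; exists x'.
have hb1 x : cnorm (h x) <= cnorm x by have := hb x; rewrite mul1r.
have kb1 x : cnorm (k x) <= cnorm x by have := kb x; rewrite mul1r.
have two (E : cstarAlgType R) (x y : E) (c : R) : cnorm x <= c -> cnorm y <= c ->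
    cnorm (x - y) <= 2 * c.
  by move=> p q; have := cnormD x (- y); rewrite cnormN; lra.
have kh x : k (h x) = x.
  apply/eqP; rewrite -subr_eq0; apply/eqP; move: x; apply: (dense_zero (C := 2) HN1 d1) => //.
  - by move=> x y; rewrite (linB hl) (linB kl) subr_subACA.
  - by move=> x; apply: two => //; apply: le_trans (kb1 _) (hb1 _).
  - by move=> x [y g]; rewrite (hG _ _ g) (kG _ _ g) subrr.
have hk x : h (k x) = x.
  apply/eqP; rewrite -subr_eq0; apply/eqP; move: x; apply: (dense_zero (C := 2) HN2 d2) => //.
  - by move=> x y; rewrite (linB kl) (linB hl) subr_subACA.
  - by move=> x; apply: two => //; apply: le_trans (hb1 _) (kb1 _).
  - by move=> y [x g]; rewrite (kG _ _ g) (hG _ _ g) subrr.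
exists h; last by exists k.
split=> //.
- have prod x x' : cnorm (h (x * x') - h x * h x') <= 2 * (cnorm x * cnorm x').
    apply: two; first exact: le_trans (hb1 _) (cnormM _ _).
    by apply: le_trans (cnormM _ _) _; rewrite ler_pM ?cnorm_ge0.
  have step1 x x' : S1 x' -> h (x * x') - h x * h x' = 0.
    move=> [y' g']; move: x; apply: (dense_zero (C := 2 * cnorm x') HN2 d1).
    + by rewrite mulr_ge0 ?cnorm_ge0.
    + by move=> x y; rewrite mulrBl !(linB hl) mulrBl subr_subACA.
    + by move=> x; rewrite -mulrA [_ * cnorm x]mulrC; apply: prod.
    + by move=> x [y g]; rewrite (hG _ _ (GM g g')) (hG _ _ g) (hG _ _ g') subrr.
  move=> x x'; apply/eqP; rewrite -subr_eq0; apply/eqP; move: x'.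
  apply: (dense_zero (C := 2 * cnorm x) HN2 d1).
  + by rewrite mulr_ge0 ?cnorm_ge0.
  + by move=> y y'; rewrite mulrBr !(linB hl) mulrBr subr_subACA.
  + by move=> x'; rewrite -mulrA; apply: prod.
  + by move=> x'; apply: step1.
- move=> x; apply/eqP; rewrite -subr_eq0; apply/eqP; move: x.
  apply: (dense_zero (C := 2) HN2 d1) => //.
  + by move=> x y; rewrite starB !(linB hl) starB subr_subACA.
  + move=> x; apply: two; rewrite -[X in _ <= X]cnormS //.
    by rewrite cnormS -[X in _ <= X]cnormS starK.
  + by move=> x [y g]; rewrite (hG _ _ (GS g)) (hG _ _ g) subrr.
Qed.
End ExtendIso.

Section Intertwining.
Context (R : realType) (T1 T2 : cstarAlgType R).
Context (I1 K1 : nat -> finType) (b1 : forall n, I1 n -> K1 n)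
  (e1 : forall n, I1 n -> I1 n -> T1) (pa1 : forall n, K1 n.+1 -> K1 n).
Context (I2 K2 : nat -> finType) (b2 : forall n, I2 n -> K2 n)
  (e2 : forall n, I2 n -> I2 n -> T2) (pa2 : forall n, K2 n.+1 -> K2 n).
Arguments b1 : clear implicits.
Arguments e1 : clear implicits.
Arguments pa1 : clear implicits.
Arguments b2 : clear implicits.
Arguments e2 : clear implicits.
Arguments pa2 : clear implicits.
Hypotheses (W1 : tower b1 e1 pa1) (W2 : tower b2 e2 pa2).
Hypotheses (ab1 : absorbing e1) (ab2 : absorbing e2).
Local Notation z1 n := (blockunit (b1 n) (e1 n)).
Local Notation z2 n := (blockunit (b2 n) (e2 n)).

Lemma mxspan_cut_refine (T : cstarAlgType R) (K D D' : finType) (z : K -> T)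
    (g : D -> D -> T) (f : D' -> D' -> T) :
  (forall a c, mxspan f (g a c)) -> forall x, mxspan (cutunit z g) x -> mxspan (cutunit z f) x.
Proof.
move=> h; apply: mxspan_sub => p q.
apply: (@pspanl R T T _ _ (cutunit z f) _ (cutunit z g p q)).
by apply: cut_refine => a c; have [v hv] := h a c; exists v.
Qed.

Lemma full_step (J : finType) (f1 : J -> J -> T1) (f2 : J -> J -> T2) n : matched e1 e2 f1 f2 ->
  exists (J' : finType) (g1 : J' -> J' -> T1) (g2 : J' -> J' -> T2),
    [/\ matched e1 e2 g1 g2, forall i j, pspan g1 g2 (f1 i j) (f2 i j),
      exists n1, forall x, mxspan (e1 n) x -> mxspan (cutunit (z1 n1) g1) x &
      exists n2, forall x, mxspan (e2 n) x -> mxspan (cutunit (z2 n2) g2) x].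
Proof.
move=> M; have [J1 [g1 [g2 [Mg pg [n1 hn1]]]]] := half_step W1 W2 ab1 ab2 n M.
have Mg' : matched e2 e1 g2 g1 by case: Mg.
have [J2 [h2 [h1 [Mh ph [n2 hn2]]]]] := half_step W2 W1 ab2 ab1 n Mg'.
exists J2, h1, h2.
have ph' i j : pspan h1 h2 (g1 i j) (g2 i j).
  by have [v [-> ->]] := ph i j; exists v.
split; first by case: Mh.
- by move=> i j; apply: pspan_sub (pg i j).
- exists n1 => x /hn1; apply: mxspan_cut_refine => a c; exact: pspanl (ph' a c).
- by exists n2.
Qed.

Record mstate := MState { ms_J : finType; ms1 : ms_J -> ms_J -> T1; ms2 : ms_J -> ms_J -> T2;
  ms_ok : matched e1 e2 ms1 ms2 }.

Definition mstep n (s s' : mstate) : Prop :=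
  [/\ forall i j, pspan (@ms1 s') (@ms2 s') (@ms1 s i j) (@ms2 s i j),
      exists n1, forall x, mxspan (e1 n) x -> mxspan (cutunit (z1 n1) (@ms1 s')) x &
      exists n2, forall x, mxspan (e2 n) x -> mxspan (cutunit (z2 n2) (@ms2 s')) x].

Lemma mstate_sequence : exists st : nat -> mstate, forall i, mstep i (st i) (st i.+1).
Proof.
have step n (s : mstate) : {s' | mstep n s s'}.
  apply: cid; have [J [g1 [g2 [M p h1 h2]]]] := full_step n (ms_ok s).
  by exists (MState M).
have M0 : matched e1 e2 (fun _ _ : unit => 1) (fun _ _ : unit => 1).
  have cu1 (T : cstarAlgType R) : cunits 1 (fun _ _ : unit => 1 : T).
    split; [by rewrite star1|by rewrite mulr1|by move=> _ [] []|].
    by rewrite (big_pred1 tt) // => -[].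
  split=> //; exists 0%N => _ _; [exact: (mxspan1 (tw_mu W1 0%N))|exact: (mxspan1 (tw_mu W2 0%N))].
pose st := fix st i := match i with 0%N => MState M0 | i'.+1 => sval (step i' (st i')) end.
by exists st => i; exact: (svalP (step i (st i))).
Qed.

(** Towers whose stages have full matrix algebras of all sizes in their
    commutants are determined by their trace simplices.  Matched systems of
    matrix units are refined back and forth until, together with the matched
    central partitions, they exhaust both algebras. *)
Lemma traces_iso_cstar_iso : traces_iso T1 T2 -> cstar_iso T1 T2.
Proof.
move=> tiso; have [ze [Pz hz]] := central_matching W1 W2 tiso.
have P1 := tower_partition_system W1.
have [st hst] := mstate_sequence.
pose E1 i n := cutunit (z1 n) (@ms1 (st i)).
pose E2 i n := cutunit (ze n) (@ms2 (st i)).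
have U1 i n : mxunits (fun p : K1 n * ms_J (st i) => p.1) (E1 i n).
  apply: cut_mxunits; [exact: (ps_star P1)|exact: (ps_mul P1)|exact: (ps_sum P1)|
    exact: (ps_neq0 P1)|exact: (ps_central P1)|exact: (md_units1 (ms_ok (st i)))].
have U2 i n : mxunits (fun p : K1 n * ms_J (st i) => p.1) (E2 i n).
  apply: cut_mxunits; [exact: (ps_star Pz)|exact: (ps_mul Pz)|exact: (ps_sum Pz)|
    exact: (ps_neq0 Pz)|exact: (ps_central Pz)|exact: (md_units2 (ms_ok (st i)))].
have up_i i n x y : pspan (E1 i n) (E2 i n) x y -> pspan (E1 i.+1 n) (E2 i.+1 n) x y.
  by apply: pspan_sub; apply: cut_refine; case: (hst i).
have up_n i n x y : pspan (E1 i n) (E2 i n) x y -> pspan (E1 i n.+1) (E2 i n.+1) x y.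
  by apply: pspan_sub => p q; exact: (cut_next _ _ P1 Pz p q).
have up i i' n n' x y : (i <= i')%N -> (n <= n')%N ->
    pspan (E1 i n) (E2 i n) x y -> pspan (E1 i' n') (E2 i' n') x y.
  move=> ii nn h; rewrite -(subnK ii) -(subnK nn).
  elim: (i' - i)%N => [|d IH]; last exact: up_i.
  by elim: (n' - n)%N => [//|d IH]; apply: up_n.
(* Raising i refines the matrix units, raising n the central partition. *)
pose G x y := exists i n, pspan (E1 i n) (E2 i n) x y.
have common x y x' y' : G x y -> G x' y' ->
    exists i n, pspan (E1 i n) (E2 i n) x y /\ pspan (E1 i n) (E2 i n) x' y'.
  move=> [i [n h]] [i' [n' h']]; exists (maxn i i'), (maxn n n').
  by split; [apply: up h|apply: up h']; rewrite ?leq_maxl ?leq_maxr.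
apply: (@extend_iso R T1 T2 G).
- move=> c x y x' y' g g'; have [i [n [h h']]] := common _ _ _ _ g g'.
  by exists i, n; apply: pspanD => //; apply: pspanZ.
- move=> x y x' y' g g'; have [i [n [[a [-> ->]] [a' [-> ->]]]]] := common _ _ _ _ g g'.
  by exists i, n; rewrite (lincombM (U1 i n)) (lincombM (U2 i n)); eexists.
- move=> x y [i [n [a [-> ->]]]]; exists i, n.
  by rewrite (star_lincomb (U1 i n)) (star_lincomb (U2 i n)); eexists.
- move=> x y [i [n [a [-> ->]]]]; apply/eqP; rewrite eq_le.
  by rewrite (cnorm_lincomb_le (U1 i n) (U2 i n)) (cnorm_lincomb_le (U2 i n) (U1 i n)).
- move=> x eps /(tw_dense W1 x) [n [x' [sx xx]]].
  have [_ [n1 /(_ _ sx) [a ha]] _] := hst n.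
  exists x', (lincomb (E2 n.+1 n1) a); split=> //; exists n.+1, n1, a; split=> //.
- move=> y eps /(tw_dense W2 y) [n [y' [sy yy]]].
  have [_ _ [n2 /(_ _ sy) sy']] := hst n.
  have [lv hlv] := choice (fun l => hz n2 l).
  suff [a ha] : mxspan (E2 n.+1 (\max_l lv l)%N) y'.
    by exists (lincomb (E1 n.+1 (\max_l lv l)%N) a), y'; split=> //; exists n.+1, (\max_l lv l)%N, a.
  apply: mxspan_sub sy' => -[l a] [l' c]; rewrite {1}/cutunit /=; apply: mxspanZ.
  have [S ->] := hlv l; rewrite mulr_suml; apply: mxspan_sum => k _.
  apply: (@pspanr R T1 T2 _ (E1 n.+1 (\max_l lv l)%N) _ (z1 (lv l) k * @ms1 (st n.+1) a c)).
  apply: (up n.+1 _ (lv l)) => //; first exact: leq_bigmax.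
  have := pspan_unit (E1 n.+1 (lv l)) (E2 n.+1 (lv l)) (k, a) (k, c).
  by rewrite {2}/E1 {2}/E2 /cutunit /= eqxx !scale1r.
Qed.

End Intertwining.

(** * The theorem *)

Section Assembly.
Context (R : realType).

Lemma classD_tower (A : cstarAlgType R) : classD A ->
  exists (I K : nat -> finType) (b : forall n, I n -> K n)
    (e : forall n, I n -> I n -> A) (pa : forall n, K n.+1 -> K n), tower b e pa.
Proof.
move=> [r [p [phi [[phih [psi [psih psiphi _ psid]]] par]]]].
have [n0 [I [K [b [e [pa [W _]]]]]]] := tower_of_limit phih psih psiphi psid par.
by exists I, K, b, e, pa.
Qed.

Lemma uhf_tower (Q : cstarAlgType R) : is_UHF Q ->
  exists (J L : nat -> finType) (c : forall n, J n -> L n)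
    (u : forall n, J n -> J n -> Q) (qa : forall n, L n.+1 -> L n),
    tower c u qa /\ forall n (k l : L n), k = l.
Proof.
move=> [p [phi [[phih [psi [psih psiphi _ psid]]] phi1]]].
have par n (j : 'I_1) : exists! k : 'I_1, repr_mx (phi n) j k != 0.
  exists ord0; split; last by move=> k _; rewrite (ord1 k).
  apply/eqP => /(repr_mx0 phih); rewrite (_ : fdblock _ _ _ = 1) ?phi1 => [/eqP|].
    by rewrite oner_eq0.
  by rewrite -fdblock_sum big_ord1.
have [n0 [J [L [c [u [qa [W inj]]]]]]] := tower_of_limit phih psih psiphi psid par.
exists J, L, c, u, qa; split=> // n k l; have [h hi] := inj n.
by apply: hi; rewrite (ord1 (h k)) (ord1 (h l)).
Qed.

End Assembly.

Theorem theorem1p1 (R : realType) (A B Q AQ BQ : cstarAlgType R)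
    (hA : classD A) (hB : classD B) (hQ : is_universal_UHF Q)
    (hAQ : is_tensor_product A Q AQ) (hBQ : is_tensor_product B Q BQ) :
  traces_iso A B <-> cstar_iso AQ BQ.
Proof.
have [IA [KA [bA [eA [paA WA]]]]] := classD_tower hA.
have [IB [KB [bB [eB [paB WB]]]]] := classD_tower hB.
have [uhfQ K0Q] := hQ.
have [J [L [c [u [qa [WQ L1]]]]]] := uhf_tower uhfQ.
have absQ : absorbing u := uhf_absorbing WQ L1 (universal_divisible WQ L1 K0Q).
have [fA [gA [[fAh gAh fA1 gA1] fgA injA dA]]] := hAQ.
have [fB [gB [[fBh gBh fB1 gB1] fgB injB dB]]] := hBQ.
have WAQ := tensor_tower fAh gAh fA1 gA1 fgA injA dA WA WQ L1.
have WBQ := tensor_tower fBh gBh fB1 gB1 fgB injB dB WB WQ L1.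
have absA := tensor_absorbing fAh gAh fA1 gA1 fgA WA absQ.
have absB := tensor_absorbing fBh gBh fB1 gB1 fgB WB absQ.
have isoA : traces_iso A AQ := same_forest_traces_iso WA WAQ.
have isoB : traces_iso B BQ := same_forest_traces_iso WB WBQ.
split=> [iso|/cstar_iso_traces iso].
  apply: (traces_iso_cstar_iso WAQ WBQ absA absB).
  exact: traces_iso_trans (traces_iso_sym isoA) (traces_iso_trans iso isoB).
exact: traces_iso_trans isoA (traces_iso_trans iso (traces_iso_sym isoB)).
Qed.
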